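(* Let $(v_{s,t})_{(s,t)\in\Delta(I)}$ be a family in $\mathfrak{BF}$ such that $v_{s,s}=\mathrm{id}_{\mathbb{H}}$ for any $s\in I$, and $v_{s,u}=v_{s,t}\circ v_{t,u}$ for any $s,t,u\in I$ with $s\le t\le u$. Suppose that the following assertions hold: (i) $v_{0,t}(0)=0$ for all $t\in I$; (ii) $v_{0,t}'(0)$ and $v_{0,t}''(0)$ are finite for all $t\in I$; (iii) the mappings $I\ni t\mapsto v'_{0,t}(0)$ and $I\ni t\mapsto v''_{0,t}(0)$ are of class $AC_{\mathrm{loc}}(I)$. Then $(v_{s,t})$ is an absolutely continuous reverse evolution family (in $\mathbb{H}$ over $I$).
   Context: $\mathbb{H}:=\{z\in\mathbb{C}\colon\operatorname{Re}z>0\}$; $\mathsf{Hol}(D,E)$ is the set of holomorphic functions $f$ in $D$ with $f(D)\subset E$. A Bernstein function is a non-negative $C^\infty$ function $f$ on $(0,+\infty)$ such that $(-1)^{n+1}f^{(n)}(x)\ge0$ for all $x>0$ and all $n\in\mathbb{N}=\{1,2,\dots\}$. $\mathfrak{BF}$ denotes the class of all $v\in\mathsf{Hol}(\mathbb{H},\mathbb{C})$ such that $v|_{(0,+\infty)}$ is a Bernstein function that is not identically zero; one has $\mathfrak{BF}\subset\mathsf{Hol}(\mathbb{H},\mathbb{H})$. For $f\in\mathfrak{BF}$, $f(0):=\lim_{\mathbb{R}\ni x\to0^+}f(x)\in[0,+\infty)$ and $f^{(n)}(0):=\lim_{\mathbb{R}\ni x\to0^+}f^{(n)}(x)$, $n\in\mathbb{N}$;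 these limits exist (finite or infinite for $n\ge1$) by monotonicity. $I\subset\mathbb{R}$ is an interval of the form $[0,T]$ with $T\in(0,+\infty)$ or $[0,T)$ with $T\in(0,+\infty]$; $\Delta(I):=\{(s,t)\colon s,t\in I,\ s\le t\}$; $AC_{\mathrm{loc}}(I)$ is the class of functions on $I$ absolutely continuous on each compact subinterval of $I$; $L^1_{\mathrm{loc}}(I)$ is the class of measurable functions on $I$ integrable on each compact subinterval. An absolutely continuous reverse evolution family in $\mathbb{H}$ over $I$ is a family $(v_{s,t})_{(s,t)\in\Delta(I)}\subset\mathsf{Hol}(\mathbb{H},\mathbb{H})$ such that: REF1: $v_{s,s}=\mathrm{id}_{\mathbb{H}}$ for all $s\in I$; REF2: $v_{s,u}=v_{s,t}\circ v_{t,u}$ whenever $s\le t\le u$ in $I$; REF3: for each $z\in\mathbb{H}$ there is a non-negative $f_z\in L^1_{\mathrm{loc}}(I)$ with $|v_{s,u}(z)-v_{s,t}(z)|\le\int_t^u f_z(r)\,\mathrm{d}r$ whenever $s\le t\le u$ in $I$. *)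

(* Defs.v *)
From HB Require Import structures.
From mathcomp Require Export all_boot all_order all_algebra.
From mathcomp Require Export all_classical all_reals all_analysis.
From mathcomp Require Export complex.

Set Implicit Arguments.
Unset Strict Implicit.
Unset Printing Implicit Defensive.

Export Order.TTheory GRing.Theory Num.Theory.
Export numFieldNormedType.Exports.

Local Open Scope classical_set_scope.
Local Open Scope ring_scope.
Local Open Scope complex_scope.

Section Definitions.
Variable R : realType.

Definition right_half_plane : set R[i] := [set z | 0 < complex.Re z].

(* Functions on an open set are represented by total functions on R[i]; only
   their values on that set are constrained.  [R[i]^o] is R[i] as a normed
   space over itself, so [derivable f z 1] is complex differentiability. *)
Definition Hol (D E : set R[i]) (f : R[i]^o -> R[i]^o) : Prop :=
  (forall z, D z -> derivable f z 1) /\ (forall z, D z -> E (f z)).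

(* Again only the values of [g] on the open half-line matter. *)
Definition bernstein (g : R -> R) : Prop :=
  [/\ forall x, 0 < x -> 0 <= g x,
      forall n x, 0 < x -> derivable (derive1n n g) x 1
    & forall n x, (0 < n)%N -> 0 < x ->
        0 <= (-1) ^+ n.+1 * derive1n n g x].

Definition real_restr (f : R[i] -> R[i]) : R -> R :=
  fun x => complex.Re (f x%:C).

Definition BF (f : R[i] -> R[i]) : Prop :=
  [/\ Hol right_half_plane setT f,
      forall x : R, 0 < x -> complex.Im (f x%:C) = 0,
      bernstein (real_restr f)
    & exists2 x : R, 0 < x & f x%:C != 0].

(* f^(n)(0), an extended real; for [f] in [BF] the derivatives of the
   restriction to the half-line are monotone, so this limit exists. *)
Definition bdry_deriv (n : nat) (f : R[i] -> R[i]) : \bar R :=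
  lim ((derive1n n (real_restr f) x)%:E @[x --> (0 : R)^'+]).

Definition time_interval (I : interval R) : Prop :=
  (exists2 T : R, 0 < T & (I = `[0, T] \/ I = `[0, T[)) \/ I = `[0, +oo[.

Definition abs_cont (a b : R) (F : R -> R) : Prop :=
  forall e : R, 0 < e -> exists2 d : R, 0 < d &
    forall (n : nat) (x y : 'I_n -> R),
      (forall i, a <= x i /\ x i <= y i /\ y i <= b) ->
      trivIset setT (fun i => [set` `]x i, y i[]) ->
      \sum_(i < n) (y i - x i) < d ->
      \sum_(i < n) `|F (y i) - F (x i)| < e.

Definition AC_loc (I : interval R) (F : R -> R) : Prop :=
  forall a b, a \in I -> b \in I -> a <= b -> abs_cont a b F.

Definition L1_loc (I : interval R) (f : R -> R) : Prop :=
  measurable_fun [set` I] f /\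
  forall a b, a \in I -> b \in I -> a <= b ->
    lebesgue_measure.-integrable [set` `[a, b]] (EFin \o f).

(* In REF3 both sides live in R[i], whose order compares real parts of
   numbers with equal imaginary part; here both are real. *)
Definition ac_reverse_evolution_family
    (I : interval R) (v : R -> R -> R[i] -> R[i]) : Prop :=
  [/\ forall s t, s \in I -> t \in I -> s <= t ->
        Hol right_half_plane right_half_plane (v s t),
      forall s, s \in I -> forall z, right_half_plane z -> v s s z = z,
      forall s t u, s \in I -> t \in I -> u \in I -> s <= t -> t <= u ->
        forall z, right_half_plane z -> v s u z = v s t (v t u z)
    & forall z, right_half_plane z ->
        exists f : R -> R,
          [/\ forall r, r \in I -> 0 <= f r,
              L1_loc I f
            & forall s t u, s \in I -> t \in I -> u \in I -> s <= t -> t <= u ->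
                `|v s u z - v s t z|
                  <= (\int[lebesgue_measure]_(r in [set` `[t, u]]) f r)%:C]].

End Definitions.

(* Main.v *)
(** The Taylor series of a Bernstein function at a point [x > 0] represents its
    holomorphic extension on the disc [|z - x| < x] (Goursat's theorem and Cauchy's
    formula on squares), and its coefficients of order [n >= 1] alternate in sign.
    On the disc [|h| <= r] such a series varies at most as fast as at the real
    point [-r], so every estimate on the half-plane reduces to one on the positive
    axis: [f] has positive real part, is Lipschitz with constant [f'(0)], and if
    [f(0) = 0] then [|f(z) - f'(0) z| <= 2 |f''(0)| |z|^2].

    Put [A(t) = v_{0,t}'(0)] and [B(t) = v_{0,t}''(0)].  Letting [x] decrease to [0]
    in the chain rule for [v_{0,u} = v_{0,t} o v_{t,u}] gives
    [v_{t,u}'(0) = A(u)/A(t)] and [v_{t,u}''(0) = (B(u) - B(t) (A(u)/A(t))^2)/A(t)].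
    Since [v_{s,u} - v_{s,t} = v_{s,t} o v_{t,u} - v_{s,t}], on a compact interval of
    times [|v_{s,u}(z) - v_{s,t}(z)| <= K (|A(u) - A(t)| + |B(u) - B(t)|)].

    The right-hand side is dominated by the integral of an integrable function: the
    total variation of an absolutely continuous function induces a Stieltjes measure
    absolutely continuous with respect to Lebesgue measure, and Radon-Nikodym gives
    its density.  The densities obtained on an exhaustion of [I] by compact intervals
    are patched together, which is possible because [|v_{s,u}(z) - v_{s,t}(z)|]
    satisfies the triangle inequality in [(t, u)]. *)

From HB Require Import structures.
Require Import Defs.
From mathcomp Require Import ring lra.

Set Implicit Arguments.
Unset Strict Implicit.
Unset Printing Implicit Defensive.

Local Open Scope classical_set_scope.
Local Open Scope ring_scope.
Local Open Scope complex_scope.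

(** The sign conditions bear on real derivatives of every order, while [Hol] gives only one complex
    derivative at each point. The bridge is uniqueness of asymptotic expansions: Cauchy's
    coefficients at [x] and the real Taylor coefficients both expand [f (x + t)] as [t] decreases to
    0, so they agree. The discs [|z - x| < x] increase with [x] and exhaust the half-plane; any two
    points share one of them, which makes every constant uniform on the half-plane.

    Nothing is assumed at 0 on [v_{t,u}] for [t > 0]: its boundary limits are extracted from those
    of [v_{0,t}] and [v_{0,u}], and dividing by [A(t)] requires [A(t) > 0], a consequence of
    concavity. On a compact interval of times [A] stays away from 0 because it attains its minimum.

    REF3 wants one function for all [s]. The time [s] enters only through the Lipschitz constant
    [A(t)/A(s)], bounded on compact intervals. What remains, [v_{t,u}(z) - z], is the deviation of
    [v_{t,u}(z)] from [(A(u)/A(t)) z] plus [(A(u)/A(t) - 1) z]; increments of [A] and [B] control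
    both. *)

Local Notation cabs := (@Normc.normc _).
Local Notation cRe := (@complex.Re _).
Local Notation cIm := (@complex.Im _).

(** * Complex derivatives *)

Section Modulus.
Variable R : realType.
Implicit Types (x y z : R[i]).

(** The norm of [R[i]] takes its values in [R[i]]; [cabs] is the same number in [R], where the order
    is total and [lra] and [nra] apply. *)
Lemma cabsE z : `|z| = (cabs z)%:C.
Proof. by []. Qed.

Lemma cabs_ge0 z : 0 <= cabs z.
Proof. by case: z => a b; rewrite /= sqrtr_ge0. Qed.

Lemma cabsD x y : cabs (x + y) <= cabs x + cabs y.
Proof. exact: (le_normcD x y). Qed.

Lemma cabsN x : cabs (- x) = cabs x.
Proof. exact: (normcN x). Qed.

Lemma cabsB x y : cabs (x - y) <= cabs x + cabs y.
Proof. by rewrite -(cabsN y); exact: cabsD. Qed.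

Lemma cabsM x y : cabs (x * y) = cabs x * cabs y.
Proof. exact: Normc.normcM. Qed.

Lemma cabs0 : cabs (0 : R[i]) = 0.
Proof. exact: Normc.normc0. Qed.

Lemma cabs1 : cabs (1 : R[i]) = 1.
Proof. exact: Normc.normc1. Qed.

Lemma cabsV x : cabs x^-1 = (cabs x)^-1.
Proof. exact: Normc.normcV. Qed.

Lemma cabsX x n : cabs (x ^+ n) = cabs x ^+ n.
Proof. by elim: n => [|n IH]; rewrite ?expr0 ?cabs1 // !exprS cabsM IH. Qed.

Lemma cabs_eq0 x : (cabs x == 0) = (x == 0).
Proof.
by apply/eqP/eqP => [/Normc.eq0_normc //|->]; rewrite cabs0.
Qed.

Lemma cabs_gt0 x : (0 < cabs x) = (x != 0).
Proof. by rewrite lt_def cabs_ge0 cabs_eq0 andbT. Qed.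

Lemma cabs_real (r : R) : cabs r%:C = `|r|.
Proof. by rewrite /= expr0n /= addr0 sqrtr_sqr. Qed.

Lemma cabs_Re z : `|cRe z| <= cabs z.
Proof. by have := normc_ge_Re z; rewrite cabsE lecR. Qed.

Lemma cabs_Im z : `|cIm z| <= cabs z.
Proof.
case: z => a b /=; rewrite -(sqrtr_sqr b) ler_wsqrtr// lerDr; exact: sqr_ge0.
Qed.

Lemma cabs_le_ReIm z : cabs z <= `|cRe z| + `|cIm z|.
Proof.
rewrite [X in cabs X]complexE; apply: le_trans (cabsD _ _) _.
rewrite cabsM !cabs_real; have -> : cabs ('i : R[i]) = 1.
  by rewrite /= expr0n /= add0r expr1n sqrtr1.
by rewrite mul1r.
Qed.

Lemma cabs_sum n (F : 'I_n -> R[i]) :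
  cabs (\sum_(i < n) F i) <= \sum_(i < n) cabs (F i).
Proof.
elim: n F => [|n IH] F; first by rewrite !big_ord0 cabs0.
rewrite !big_ord_recr /=; apply: le_trans (cabsD _ _) _.
by rewrite lerD2r IH.
Qed.

Lemma ReD x y : cRe (x + y) = cRe x + cRe y.
Proof. by case: x => a b; case: y => c d. Qed.
Lemma ImD x y : cIm (x + y) = cIm x + cIm y.
Proof. by case: x => a b; case: y => c d. Qed.
Lemma ReN x : cRe (- x) = - cRe x.
Proof. by case: x => a b. Qed.
Lemma ImN x : cIm (- x) = - cIm x.
Proof. by case: x => a b. Qed.
Lemma ReM x y : cRe (x * y) = cRe x * cRe y - cIm x * cIm y.
Proof. by case: x => a b; case: y => c d. Qed.
Lemma ImM x y : cIm (x * y) = cRe x * cIm y + cIm x * cRe y.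
Proof. by case: x => a b; case: y => c d. Qed.
Lemma complex_ReIm x : x = cRe x +i* cIm x.
Proof. by case: x. Qed.

End Modulus.

Arguments Normc.normc : simpl never.

Section ComplexDerivative.
Variable R : realType.
Implicit Types (f : R[i] -> R[i]) (z d : R[i]).

(** Complex differentiability in remainder form: without a quotient, [h = 0] is no exception, and
    the differentiation rules become inequalities in [R]. *)
Definition cdiff f z d := forall e : R, 0 < e ->
  exists2 r : R, 0 < r & forall h, cabs h < r ->
    cabs (f (z + h) - f z - d * h) <= e * cabs h.

Lemma derivable_cdiff (f : R[i]^o -> R[i]^o) z :
  derivable f z 1 -> exists d, cdiff f z d.
Proof.
move=> df; exists ('D_1 f z) => e e0.
have /cvgrPdist_le /(_ e%:C) := df.
rewrite ltcR => /(_ e0) [r /= r0 H].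
(* The radius produced by the filter is a positive element of [R[i]], hence its imaginary part is
   0. *)
have r0' : 0 < cRe r by move: r0; rewrite ltcE => /andP[].
have rE : r = (cRe r)%:C.
  by move: r0; rewrite ltcE => /andP[/eqP i0 _]; rewrite {1}(complex_ReIm r) i0.
exists (cRe r) => // h hr.
have [->|h0] := eqVneq h 0.
  by rewrite addr0 mulr0 !subrr cabs0 mulr0.
have := H h; rewrite /= sub0r normrN rE ltcR => /(_ hr h0).
have -> : 'D_1 f z - h^-1 *: (f (h *: 1 + z) - f z) =
  - (h^-1 * (f (z + h) - f z - 'D_1 f z * h)).
  have scE (a b : R[i]^o) : a *: b = (a : R[i]) * b by [].
  by rewrite !scE mulr1 (addrC h z); field.
rewrite normrN cabsE lecR cabsM cabsV mulrC ler_pdivrMr // cabs_gt0 //.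
Qed.

Lemma cdiff_cont f z d : cdiff f z d -> forall e : R, 0 < e ->
  exists2 r : R, 0 < r & forall h, cabs h < r -> cabs (f (z + h) - f z) < e.
Proof.
move=> /(_ 1 ltr01)[r r0 H] e e0.
exists (Num.min r (e / (1 + cabs d + 1))).
  rewrite lt_min r0 /= divr_gt0//; have := cabs_ge0 d; lra.
move=> h; rewrite lt_min => /andP[/H Hh he].
have -> : f (z + h) - f z = f (z + h) - f z - d * h + d * h by ring.
apply: le_lt_trans (cabsD _ _) _; rewrite cabsM.
move: he; rewrite ltr_pdivlMr; last by have := cabs_ge0 d; lra.
have := cabs_ge0 h; have := cabs_ge0 d; nra.
Qed.

Lemma cdiffD f g z d d' : cdiff f z d -> cdiff g z d' ->
  cdiff (fun x => f x + g x) z (d + d').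
Proof.
move=> Hf Hg e e0; have e20 : 0 < e / 2 by lra.
have [r r0 H] := Hf _ e20; have [s s0 K] := Hg _ e20.
exists (Num.min r s); first by rewrite lt_min r0.
move=> h; rewrite lt_min => /andP[/H h1 /K h2].
have -> : f (z + h) + g (z + h) - (f z + g z) - (d + d') * h =
  (f (z + h) - f z - d * h) + (g (z + h) - g z - d' * h) by ring.
apply: le_trans (cabsD _ _) _; lra.
Qed.

Lemma cdiffM f g z d d' : cdiff f z d -> cdiff g z d' ->
  cdiff (fun x => f x * g x) z (d * g z + f z * d').
Proof.
move=> Hf Hg e e0.
(* The remainder of the product splits into four terms, each at most [e' * A * cabs h], whence the 4
   in [e']. The summand 1 in [A] dominates the increment of [g], which stays below [e' <= 1]. *)
pose A := cabs (f z) + cabs (g z) + cabs d + 1.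
have A1 : 1 <= A.
  by have := cabs_ge0 (f z); have := cabs_ge0 (g z); have := cabs_ge0 d; rewrite /A; lra.
have A0 : 0 < A by lra.
pose e' := Num.min 1 (e / (4 * A)).
have e'0 : 0 < e' by rewrite lt_min ltr01 /= divr_gt0 //; lra.
have e'1 : e' <= 1 by rewrite ge_min lexx.
have e'A : e' * (4 * A) <= e.
  rewrite -ler_pdivlMr; last by lra.
  by rewrite ge_min lexx orbT.
have [r r0 H] := Hf _ e'0; have [s s0 K] := Hg _ e'0.
have [t t0 L] := cdiff_cont Hg e'0.
exists (Num.min r (Num.min s t)); first by rewrite !lt_min r0 s0.
move=> h; rewrite !lt_min => /andP[/H h1 /andP[/K h2 /L h3]].
have -> : f (z + h) * g (z + h) - f z * g z - (d * g z + f z * d') * h =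
  (f (z + h) - f z - d * h) * g z + f z * (g (z + h) - g z - d' * h)
  + (f (z + h) - f z - d * h) * (g (z + h) - g z)
  + d * h * (g (z + h) - g z) by ring.
have a1 : cabs ((f (z + h) - f z - d * h) * g z) <= e' * A * cabs h.
  rewrite cabsM; apply: le_trans (ler_wpM2r (cabs_ge0 _) h1) _.
  rewrite mulrAC ler_wpM2r ?cabs_ge0 // ler_wpM2l ?(ltW e'0) //.
  by rewrite /A; have := cabs_ge0 (f z); have := cabs_ge0 d; lra.
have a2 : cabs (f z * (g (z + h) - g z - d' * h)) <= e' * A * cabs h.
  rewrite cabsM mulrC; apply: le_trans (ler_wpM2r (cabs_ge0 _) h2) _.
  rewrite mulrAC ler_wpM2r ?cabs_ge0 // ler_wpM2l ?(ltW e'0) //.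
  by rewrite /A; have := cabs_ge0 (g z); have := cabs_ge0 d; lra.
have a3 : cabs ((f (z + h) - f z - d * h) * (g (z + h) - g z)) <= e' * A * cabs h.
  rewrite cabsM; apply: le_trans (ler_wpM2r (cabs_ge0 _) h1) _.
  rewrite mulrAC ler_wpM2r ?cabs_ge0 // ler_wpM2l ?(ltW e'0) //.
  by apply: le_trans (ltW h3) _; lra.
have a4 : cabs (d * h * (g (z + h) - g z)) <= e' * A * cabs h.
  rewrite !cabsM mulrAC ler_wpM2r ?cabs_ge0 // mulrC.
  apply: ler_pM; rewrite ?cabs_ge0 ?(ltW h3) //.
  by rewrite /A; have := cabs_ge0 (f z); have := cabs_ge0 (g z); lra.
have : e' * A * cabs h *+ 4 <= e * cabs h.
  rewrite -mulrnAl ler_wpM2r ?cabs_ge0 //; move: e'A; lra.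
move: (cabsD ((f (z + h) - f z - d * h) * g z) (f z * (g (z + h) - g z - d' * h))).
move: (cabsD ((f (z + h) - f z - d * h) * g z + f z * (g (z + h) - g z - d' * h))
  ((f (z + h) - f z - d * h) * (g (z + h) - g z))).
move: (cabsD ((f (z + h) - f z - d * h) * g z + f z * (g (z + h) - g z - d' * h)
  + (f (z + h) - f z - d * h) * (g (z + h) - g z)) (d * h * (g (z + h) - g z))).
lra.
Qed.

Lemma cdiff_cst (c : R[i]) z : cdiff (fun=> c) z 0.
Proof.
move=> e e0; exists 1 => // h _.
by rewrite subrr mul0r subr0 cabs0 mulr_ge0 ?cabs_ge0 // ltW.
Qed.

Lemma cdiff_id z : cdiff id z 1.
Proof.
move=> e e0; exists 1 => // h _.
have -> : z + h - z - 1 * h = 0 by ring.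
by rewrite cabs0 mulr_ge0 ?cabs_ge0 // ltW.
Qed.

Lemma cdiff_inv z : z != 0 -> cdiff (fun x => x^-1) z (- z ^- 2).
Proof.
move=> z0 e e0; have z0' : 0 < cabs z by rewrite cabs_gt0.
(* The remainder is exactly [h ^+ 2 / ((z + h) * z ^+ 2)]. The first bound keeps [cabs (z + h)]
   above [cabs z / 2]; the second then brings the remainder below [e * cabs h]. *)
exists (Num.min (cabs z / 2) (e * cabs z ^+ 3 / 2)).
  by rewrite lt_min !divr_gt0 // mulr_gt0 // exprn_gt0.
move=> h; rewrite lt_min => /andP[h1 h2].
have zh : cabs z / 2 <= cabs (z + h).
  have := cabsB (z + h) h; rewrite addrK; lra.
have zh0 : z + h != 0 by rewrite -cabs_gt0; lra.
have -> : (z + h)^-1 - z^-1 - (- z ^- 2) * h = h * h * ((z + h)^-1 * (z ^+ 2)^-1).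
  by field; rewrite z0.
rewrite !cabsM -mulrA mulrC ler_wpM2r ?cabs_ge0 // !cabsV cabsX -invfM.
rewrite ler_pdivrMr; last by rewrite mulr_gt0 ?exprn_gt0 //; lra.
apply: le_trans (ltW h2) _.
have -> : e * cabs z ^+ 3 / 2 = e * (cabs z / 2 * cabs z ^+ 2) by ring.
by rewrite ler_wpM2l ?(ltW e0) // ler_wpM2r // exprn_ge0 // cabs_ge0.
Qed.

Lemma cdiff_eq f z d d' : d = d' -> cdiff f z d -> cdiff f z d'.
Proof. by move=> ->. Qed.

Lemma cdiff_comp f g z d d' : cdiff g z d' -> cdiff f (g z) d ->
  cdiff (fun x => f (g x)) z (d * d').
Proof.
move=> Hg Hf e e0.
pose A := cabs d + cabs d' + 1.
have d0 := cabs_ge0 d; have d0' := cabs_ge0 d'.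
pose e' := Num.min 1 (e / (2 * A)).
have e'0 : 0 < e' by rewrite lt_min ltr01 /= divr_gt0 //; rewrite /A; lra.
have e'1 : e' <= 1 by rewrite ge_min lexx.
have e'A : e' * (2 * A) <= e.
  rewrite -ler_pdivlMr; last by rewrite /A; lra.
  by rewrite ge_min lexx orbT.
have [r r0 H] := Hf _ e'0; have [s s0 K] := Hg _ e'0.
have [t t0 L] := cdiff_cont Hg r0.
exists (Num.min s t); first by rewrite lt_min s0.
move=> h; rewrite lt_min => /andP[/K h2 /L/H].
set k := g (z + h) - g z in h2 *.
have -> : g z + k = g (z + h) by rewrite /k; ring.
move=> h1.
have kA : cabs k <= A * cabs h.
  have -> : k = (k - d' * h) + d' * h by ring.
  apply: le_trans (cabsD _ _) _; rewrite cabsM /A; have := cabs_ge0 h; nra.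
have -> : f (g (z + h)) - f (g z) - d * d' * h =
  (f (g (z + h)) - f (g z) - d * k) + d * (k - d' * h) by ring.
apply: le_trans (cabsD _ _) _; rewrite cabsM.
have b1 : e' * cabs k <= e' * A * cabs h by rewrite -mulrA ler_wpM2l // ltW.
have b2 : cabs d * cabs (k - d' * h) <= e' * A * cabs h.
  apply: le_trans (ler_wpM2l d0 h2) _; rewrite mulrA ler_wpM2r ?cabs_ge0 // mulrC.
  by rewrite ler_wpM2l ?(ltW e'0) // /A; lra.
have : e' * A * cabs h *+ 2 <= e * cabs h.
  by rewrite -mulrnAl ler_wpM2r ?cabs_ge0 //; move: e'A; lra.
lra.
Qed.

End ComplexDerivative.

(** * Integrals along segments and rectangles *)

Section SegmentIntegral.
Variable R : realType.
Implicit Types (phi : R -> R[i]) (u : R -> R).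

Local Notation mu := (@lebesgue_measure R).

(** Two-sided continuity, also at 0 and 1: stronger than continuity within [[0, 1]], it passes to
    affine reparametrizations point by point. *)
Definition cont01 u := forall t, 0 <= t <= 1 -> {for t, continuous u}.

Definition int01 u : R := (\int[mu]_(t in `[0, 1]) u t)%R.

Lemma cont01_within u a b : cont01 u -> 0 <= a -> b <= 1 ->
  {within `[a, b], continuous u}.
Proof.
move=> cu a0 b1; apply: continuous_in_subspaceT => t /[!inE] /=.
rewrite in_itv /= => /andP[ta tb]; apply: cu.
by rewrite (le_trans a0 ta) (le_trans tb b1).
Qed.

Lemma cont01_integrable u a b : cont01 u -> 0 <= a -> b <= 1 ->
  mu.-integrable `[a, b] (EFin \o u).
Proof.
move=> cu a0 b1; apply: continuous_compact_integrable.
  exact: segment_compact.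
exact: cont01_within.
Qed.

Lemma int01D u v : cont01 u -> cont01 v ->
  int01 (fun t => u t + v t) = int01 u + int01 v.
Proof.
by move=> cu cv; rewrite /int01 RintegralD //; exact: cont01_integrable.
Qed.

Lemma int01Z r u : cont01 u -> int01 (fun t => r * u t) = r * int01 u.
Proof.
by move=> cu; rewrite /int01 RintegralZl //; exact: cont01_integrable.
Qed.

Lemma int01_cst r : int01 (fun=> r) = r.
Proof.
rewrite /int01 Rintegral_cst //= lebesgue_measure_itv /= lte_fin ltr01.
by rewrite oppr0 adde0 /= mulr1.
Qed.

Lemma le_int01 u v : cont01 u -> cont01 v ->
  (forall t, 0 <= t <= 1 -> u t <= v t) -> int01 u <= int01 v.
Proof.
move=> cu cv H; apply: le_Rintegral => //; try exact: cont01_integrable.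
Qed.

Lemma cont01_cst r : cont01 (fun=> r).
Proof. by move=> t _; exact: cvg_cst. Qed.

Lemma int01_bound u M : cont01 u -> (forall t, 0 <= t <= 1 -> `|u t| <= M) ->
  `|int01 u| <= M.
Proof.
move=> cu H; rewrite ler_norml -{1}(int01_cst (- M)) -{2}(int01_cst M).
apply/andP; split; apply: le_int01 => //; try exact: cont01_cst.
  by move=> t /H; rewrite ler_norml => /andP[].
by move=> t /H; rewrite ler_norml => /andP[].
Qed.

Lemma Rintegral_affine u a b : 0 <= a -> a < b -> b <= 1 -> cont01 u ->
  (\int[mu]_(t in `[a, b]) u t)%R = (b - a) * int01 (fun t => u (a + (b - a) * t)).
Proof.
move=> a0 ab b1 cu; pose F t : R := a + (b - a) * t.
have dF t : is_derive t (1 : R) F (b - a).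
  rewrite /F; apply: is_derive_eq; rewrite add0r.
  by rewrite mul1r; exact: mulr1.
have F' : F^`()%classic = fun=> (b - a).
  by apply/funext => t; rewrite derive1E derive_val.
have cF : continuous F.
  by move=> t; apply/differentiable_continuous/derivable1_diffP; have [] := dF t.
have F0 : F 0 = a by rewrite /F mulr0 addr0.
have F1 : F 1 = b by rewrite /F mulr1; ring.
have := @integration_by_substitution_increasing R F u 0 1 ler01.
rewrite F0 F1 F' {1}/Rintegral => ->.
- rewrite -[fine _]/(Rintegral mu `[0, 1] (fun t => u (F t) * (b - a))) -RintegralZl //.
    by apply: eq_Rintegral => t _ /=; rewrite mulrC.
  apply: cont01_integrable => // t /andP[t0 t1].
  apply: (@continuous_comp _ _ _ F u); first exact: cF.
  apply: cu; rewrite /F; apply/andP; split; nra.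
- by move=> x y _ _ xy; rewrite /F; nra.
- by move=> t _; exact: cvg_cst.
- by apply: is_cvg_cst.
- by apply: is_cvg_cst.
- split.
  + by move=> t _; have [] := dF t.
  + exact/cvg_at_right_filter/cF.
  + exact/cvg_at_left_filter/cF.
- exact: cont01_within.
Qed.

Lemma int01_split u l : 0 <= l <= 1 -> cont01 u ->
  int01 u = l * int01 (fun t => u (l * t)) +
            (1 - l) * int01 (fun t => u (l + (1 - l) * t)).
Proof.
move=> /andP[l0 l1] cu.
(* [Rintegral_affine] needs a nondegenerate interval, so a cut at an end point is treated apart. *)
have [->|ln0] := eqVneq l 0.
  rewrite mul0r add0r subr0 mul1r; congr int01; apply/funext => t.
  by rewrite add0r mul1r.
have [->|ln1] := eqVneq l 1.
  rewrite subrr mul0r addr0 mul1r; congr int01; apply/funext => t.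
  by rewrite mul1r.
have lgt0 : 0 < l by rewrite lt_neqAle eq_sym ln0.
have llt1 : l < 1 by rewrite lt_neqAle ln1.
have E1 := Rintegral_affine (lexx 0) lgt0 l1 cu.
have E2 := Rintegral_affine l0 llt1 (lexx 1) cu.
rewrite subr0 in E1.
have -> : (fun t => u (l * t)) = (fun t => u (0 + l * t)).
  by apply/funext => t; rewrite add0r.
rewrite -E1 -E2 /int01.
have := @Rintegral_itvB R u (BLeft 0) (BRight 1) l (cont01_integrable cu (lexx 0) (lexx 1)).
rewrite !bnd_simp => /(_ l0 l1).
rewrite Rintegral_itv_obnd_cbnd; last first.
  apply: (integrableS _ _ _ (cont01_integrable cu (lexx 0) (lexx 1))) => //.
  by apply: subset_itvr; rewrite bnd_simp.
lra.
Qed.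

End SegmentIntegral.

Section ComplexSegmentIntegral.
Variable R : realType.
Implicit Types (phi psi : R -> R[i]).

Definition ccont01 phi := forall t, 0 <= t <= 1 -> forall e : R, 0 < e ->
  exists2 r : R, 0 < r & forall s, `|s - t| < r -> cabs (phi s - phi t) < e.

Definition cint01 phi : R[i] :=
  int01 (cRe \o phi) +i* int01 (cIm \o phi).

Lemma ccont01_Re phi : ccont01 phi -> cont01 (cRe \o phi).
Proof.
move=> H t /H Ht; apply/cvgrPdist_lt => e /Ht [r r0 K].
near=> s; rewrite -normrN opprB /= -ReN -ReD.
apply: le_lt_trans (cabs_Re _) _; apply: K.
near: s; exists r => //= s; by rewrite /ball /= distrC.
Unshelve. all: by end_near. Qed.

Lemma ccont01_Im phi : ccont01 phi -> cont01 (cIm \o phi).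
Proof.
move=> H t /H Ht; apply/cvgrPdist_lt => e /Ht [r r0 K].
near=> s; rewrite -normrN opprB /= -ImN -ImD.
apply: le_lt_trans (cabs_Im _) _; apply: K.
near: s; exists r => //= s; by rewrite /ball /= distrC.
Unshelve. all: by end_near. Qed.

Lemma ccont01_cst c : ccont01 (fun=> c).
Proof. by move=> t _ e e0; exists 1 => // s _; rewrite subrr cabs0. Qed.

Lemma ccont01Z (c : R[i]) phi : ccont01 phi -> ccont01 (fun t => c * phi t).
Proof.
move=> H t t01 e e0; have c0 := cabs_ge0 c.
have [|r r0 Hr] := H _ t01 (e / (cabs c + 1)); first by rewrite divr_gt0 //; lra.
exists r => // x /Hr; rewrite ltr_pdivlMr; last by lra.
rewrite -mulrBr cabsM; have := cabs_ge0 (phi x - phi t); nra.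
Qed.

Lemma ccont01_path (f : R[i] -> R[i]) (p q : R[i]) :
  (forall t : R, 0 <= t <= 1 -> exists d, cdiff f (p + t%:C * (q - p)) d) ->
  ccont01 (fun t => f (p + t%:C * (q - p))).
Proof.
move=> H t /H [d Hd] e /(cdiff_cont Hd) [r r0 K].
have c0 := cabs_ge0 (q - p).
exists (r / (cabs (q - p) + 1)); first by rewrite divr_gt0 //; lra.
move=> s; rewrite ltr_pdivlMr; last by lra.
move=> hs.
have -> : p + s%:C * (q - p) = p + t%:C * (q - p) + (s - t)%:C * (q - p).
  by rewrite rmorphB; ring.
apply: K; rewrite cabsM cabs_real; have := normr_ge0 (s - t); nra.
Qed.

Lemma cint01D phi psi : ccont01 phi -> ccont01 psi ->
  cint01 (fun t => phi t + psi t) = cint01 phi + cint01 psi.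
Proof.
move=> H K; rewrite /cint01.
have -> : cRe \o (fun t => phi t + psi t) =
          (fun t => (cRe \o phi) t + (cRe \o psi) t).
  by apply/funext => t /=; rewrite ReD.
have -> : cIm \o (fun t => phi t + psi t) =
          (fun t => (cIm \o phi) t + (cIm \o psi) t).
  by apply/funext => t /=; rewrite ImD.
rewrite (int01D (ccont01_Re H) (ccont01_Re K)).
by rewrite (int01D (ccont01_Im H) (ccont01_Im K)).
Qed.

Lemma cint01Z (c : R[i]) phi : ccont01 phi ->
  cint01 (fun t => c * phi t) = c * cint01 phi.
Proof.
move=> H; rewrite /cint01.
have cR := ccont01_Re H; have cI := ccont01_Im H.
have cZ (r : R) u : cont01 u -> cont01 (fun t => r * u t).
  by move=> cu t /cu cut; apply: continuousM => //; exact: cvg_cst.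
have -> : cRe \o (fun t => c * phi t) =
    (fun t => cRe c * (cRe \o phi) t + (- cIm c) * (cIm \o phi) t).
  by apply/funext => t /=; rewrite ReM; ring.
have -> : cIm \o (fun t => c * phi t) =
    (fun t => cRe c * (cIm \o phi) t + cIm c * (cRe \o phi) t).
  by apply/funext => t /=; rewrite ImM; ring.
rewrite !int01D ?int01Z //; try exact: cZ.
by rewrite [c in RHS]complex_ReIm; congr (_ +i* _); ring.
Qed.

Lemma cint01_cst c : cint01 (fun=> c) = c.
Proof.
rewrite /cint01 [c in RHS]complex_ReIm; congr (_ +i* _); exact: int01_cst.
Qed.

(* The factor 2 comes from bounding real and imaginary parts separately. *)
Lemma cint01_bound phi M : ccont01 phi ->
  (forall t, 0 <= t <= 1 -> cabs (phi t) <= M) -> cabs (cint01 phi) <= 2 * M.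
Proof.
move=> H K; apply: le_trans (cabs_le_ReIm _) _ => /=.
have := @int01_bound _ _ M (ccont01_Re H).
have := @int01_bound _ _ M (ccont01_Im H).
move=> /(_ (fun t t01 => le_trans (cabs_Im _) (K t t01))) h1.
move=> /(_ (fun t t01 => le_trans (cabs_Re _) (K t t01))) h2.
lra.
Qed.

Lemma cint01_split phi l : 0 <= l <= 1 -> ccont01 phi ->
  cint01 phi = l%:C * cint01 (fun t => phi (l * t)) +
            (1 - l)%:C * cint01 (fun t => phi (l + (1 - l) * t)).
Proof.
move=> l01 H; rewrite /cint01 (int01_split l01 (ccont01_Re H)).
rewrite (int01_split l01 (ccont01_Im H)).
by apply/eqP; rewrite eq_complex /= !mul0r !subr0 !addr0 !eqxx.
Qed.

(** Splitting at 1/2 turns the integral [J] into [J / 2 + 1 / 4]. *)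
Lemma int01_id : int01 (fun t : R => t) = 1 / 2.
Proof.
have cid : cont01 (fun t : R => t) by move=> t _; exact: cvg_id.
have l01 : 0 <= (1 / 2 : R) <= 1 by lra.
have c2 : cont01 (fun t : R => 1 / 2 * t).
  by move=> t _; apply: continuousM; [exact: cvg_cst | exact: cvg_id].
have := int01_split l01 cid.
rewrite int01Z //.
rewrite (int01D (@cont01_cst _ (1/2))); last first.
  by move=> t _; apply: continuousM; [exact: cvg_cst | exact: cvg_id].
rewrite int01_cst int01Z //; lra.
Qed.

Lemma cint01_id : cint01 (fun t : R => t%:C) = (1 / 2)%:C.
Proof.
rewrite /cint01; congr (_ +i* _); first exact: int01_id.
exact: int01_cst.
Qed.

Fact seg_key : unit. Proof. exact: tt. Qed.
(** Locked, so that [ring] and conversion see a segment integral as an atom. *)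
Definition seg (f : R[i] -> R[i]) (p q : R[i]) : R[i] :=
  locked_with seg_key ((q - p) * cint01 (fun t => f (p + t%:C * (q - p)))).

Lemma segE f p q : seg f p q = (q - p) * cint01 (fun t => f (p + t%:C * (q - p))).
Proof. by rewrite /seg unlock. Qed.

Definition diff_on_seg (f : R[i] -> R[i]) (p q : R[i]) :=
  forall t : R, 0 <= t <= 1 -> exists d, cdiff f (p + t%:C * (q - p)) d.

Lemma segD f g p q : diff_on_seg f p q -> diff_on_seg g p q ->
  seg (fun z => f z + g z) p q = seg f p q + seg g p q.
Proof. by move=> Hf Hg; rewrite !segE cint01D ?mulrDr //; exact: ccont01_path. Qed.

Lemma segZ (c : R[i]) f p q : diff_on_seg f p q ->
  seg (fun z => c * f z) p q = c * seg f p q.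
Proof. by move=> Hf; rewrite !segE cint01Z; [ring|exact: ccont01_path]. Qed.

Lemma seg_affine (a b p q : R[i]) :
  seg (fun z => a + b * z) p q = a * (q - p) + b * (q ^+ 2 - p ^+ 2) / 2%:R.
Proof.
have cid : ccont01 (fun t : R => t%:C).
  move=> t _ e e0; exists e => // s; by rewrite -rmorphB cabs_real.
rewrite segE.
have -> : (fun t : R => a + b * (p + t%:C * (q - p))) =
  (fun t : R => (a + b * p) + (b * (q - p)) * t%:C).
  by apply/funext => t; ring.
rewrite cint01D; [|exact: ccont01_cst|exact: ccont01Z].
rewrite cint01_cst cint01Z // cint01_id rmorphM /= fmorphV rmorph1 rmorph_nat.
by field.
Qed.

Lemma seg_bound f p q M : diff_on_seg f p q ->
  (forall t : R, 0 <= t <= 1 -> cabs (f (p + t%:C * (q - p))) <= M) ->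
  cabs (seg f p q) <= 2 * M * cabs (q - p).
Proof.
move=> H K; rewrite segE cabsM mulrC ler_wpM2r ?cabs_ge0 //.
by apply: cint01_bound => //; exact: ccont01_path.
Qed.

Lemma seg_split f p q (l : R) : 0 <= l <= 1 -> diff_on_seg f p q ->
  seg f p q = seg f p (p + l%:C * (q - p)) + seg f (p + l%:C * (q - p)) q.
Proof.
move=> l01 H; rewrite segE (cint01_split l01 (ccont01_path H)) !segE.
rewrite mulrDr; congr (_ + _).
- rewrite mulrA; congr (_ * cint01 _); first by ring.
  by apply/funext => t; congr f; rewrite rmorphM; ring.
- rewrite mulrA rmorphB rmorph1; congr (_ * cint01 _); first by ring.
  by apply/funext => t; congr f; rewrite rmorphD rmorphM rmorphB rmorph1; ring.
Qed.

End ComplexSegmentIntegral.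

(** * Goursat's theorem on rectangles *)

Section Goursat.
Variable R : realType.
Implicit Types (f g : R[i] -> R[i]) (x y w k : R).

Fact rect_key : unit. Proof. exact: tt. Qed.
(** The boundary is run counterclockwise; locked for the same reason as [seg]. *)
Definition rect f (x1 x2 y1 y2 : R) : R[i] :=
  locked_with rect_key
  (seg f (x1 +i* y1) (x2 +i* y1) + seg f (x2 +i* y1) (x2 +i* y2)
  - seg f (x1 +i* y2) (x2 +i* y2) - seg f (x1 +i* y1) (x1 +i* y2)).

Lemma rectE f (x1 x2 y1 y2 : R) : rect f x1 x2 y1 y2 =
  seg f (x1 +i* y1) (x2 +i* y1) + seg f (x2 +i* y1) (x2 +i* y2)
  - seg f (x1 +i* y2) (x2 +i* y2) - seg f (x1 +i* y1) (x1 +i* y2).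
Proof. by rewrite /rect unlock. Qed.

Definition diff_on_rect f (x1 x2 y1 y2 : R) :=
  forall x y, x1 <= x <= x2 -> y1 <= y <= y2 -> exists d, cdiff f (x +i* y) d.

(** Cauchy's integrands have a pole inside the rectangle, so linearity, splitting and bounds are
    stated under differentiability on the boundary alone. *)
Definition diff_on_bd f (x1 x2 y1 y2 : R) :=
  forall x y, x1 <= x <= x2 -> y1 <= y <= y2 ->
  [|| x == x1, x == x2, y == y1 | y == y2] -> exists d, cdiff f (x +i* y) d.

Lemma diff_rect_bd f (x1 x2 y1 y2 : R) :
  diff_on_rect f x1 x2 y1 y2 -> diff_on_bd f x1 x2 y1 y2.
Proof. by move=> H x y hx hy _; exact: H. Qed.

Lemma hseg_pt (x1 x2 y t : R) :
  (x1 +i* y) + t%:C * ((x2 +i* y) - (x1 +i* y)) = (x1 + t * (x2 - x1)) +i* y.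
Proof. by apply/eqP; rewrite eq_complex /=; apply/andP; split; apply/eqP; ring. Qed.

Lemma vseg_pt (x y1 y2 t : R) :
  (x +i* y1) + t%:C * ((x +i* y2) - (x +i* y1)) = x +i* (y1 + t * (y2 - y1)).
Proof. by apply/eqP; rewrite eq_complex /=; apply/andP; split; apply/eqP; ring. Qed.

Lemma diff_hseg f (x1 x2 y : R) : x1 <= x2 ->
  (forall x, x1 <= x <= x2 -> exists d, cdiff f (x +i* y) d) ->
  diff_on_seg f (x1 +i* y) (x2 +i* y).
Proof. move=> x12 H t t01; rewrite hseg_pt; apply: H; nra. Qed.

Lemma diff_vseg f (x y1 y2 : R) : y1 <= y2 ->
  (forall y, y1 <= y <= y2 -> exists d, cdiff f (x +i* y) d) ->
  diff_on_seg f (x +i* y1) (x +i* y2).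
Proof. move=> x12 H t t01; rewrite vseg_pt; apply: H; nra. Qed.

Section Rect.
Variables (f : R[i] -> R[i]) (x1 x2 y1 y2 : R).
Hypotheses (x12 : x1 <= x2) (y12 : y1 <= y2) (df : diff_on_bd f x1 x2 y1 y2).

Lemma diff_bottom : diff_on_seg f (x1 +i* y1) (x2 +i* y1).
Proof. by apply: diff_hseg => // x hx; apply: df; rewrite ?lexx ?y12 ?eqxx ?orbT. Qed.
Lemma diff_top : diff_on_seg f (x1 +i* y2) (x2 +i* y2).
Proof. by apply: diff_hseg => // x hx; apply: df; rewrite ?lexx ?y12 ?eqxx ?orbT. Qed.
Lemma diff_left : diff_on_seg f (x1 +i* y1) (x1 +i* y2).
Proof. by apply: diff_vseg => // x hx; apply: df; rewrite ?lexx ?x12 ?eqxx ?orbT. Qed.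
Lemma diff_right : diff_on_seg f (x2 +i* y1) (x2 +i* y2).
Proof. by apply: diff_vseg => // x hx; apply: df; rewrite ?lexx ?x12 ?eqxx ?orbT. Qed.

End Rect.

Lemma hseg_split f (x1 m x2 y : R) : x1 < x2 -> x1 <= m <= x2 ->
  diff_on_seg f (x1 +i* y) (x2 +i* y) ->
  seg f (x1 +i* y) (x2 +i* y) = seg f (x1 +i* y) (m +i* y) + seg f (m +i* y) (x2 +i* y).
Proof.
move=> x12 m12 df.
rewrite (@seg_split _ _ _ _ ((m - x1) / (x2 - x1))) // ?hseg_pt.
  by rewrite divfK ?subr_eq0 ?gt_eqF // [x1 + _]addrC subrK.
by rewrite divr_ge0 ?ler_pdivrMr; lra.
Qed.

Lemma vseg_split f (x y1 m y2 : R) : y1 < y2 -> y1 <= m <= y2 ->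
  diff_on_seg f (x +i* y1) (x +i* y2) ->
  seg f (x +i* y1) (x +i* y2) = seg f (x +i* y1) (x +i* m) + seg f (x +i* m) (x +i* y2).
Proof.
move=> x12 m12 df.
rewrite (@seg_split _ _ _ _ ((m - y1) / (y2 - y1))) // ?vseg_pt.
  by rewrite divfK ?subr_eq0 ?gt_eqF // [y1 + _]addrC subrK.
by rewrite divr_ge0 ?ler_pdivrMr; lra.
Qed.

(** The common side at [m] occurs with opposite signs and cancels whatever its value, so the
    assumption concerns the outer boundary only. *)
Lemma rect_vsplit f (x1 m x2 y1 y2 : R) : x1 < x2 -> y1 <= y2 -> x1 <= m <= x2 ->
  diff_on_bd f x1 x2 y1 y2 ->
  rect f x1 x2 y1 y2 = rect f x1 m y1 y2 + rect f m x2 y1 y2.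
Proof.
move=> x12 y12 m12 df; rewrite !rectE.
rewrite (hseg_split x12 m12 (diff_bottom (ltW x12) y12 df)).
rewrite (hseg_split x12 m12 (diff_top (ltW x12) y12 df)).
by do ?[move: (seg _ _ _) => ?]; ring.
Qed.

Lemma rect_hsplit f (x1 x2 y1 m y2 : R) : x1 <= x2 -> y1 < y2 -> y1 <= m <= y2 ->
  diff_on_bd f x1 x2 y1 y2 ->
  rect f x1 x2 y1 y2 = rect f x1 x2 y1 m + rect f x1 x2 m y2.
Proof.
move=> x12 y12 m12 df; rewrite !rectE.
rewrite (vseg_split y12 m12 (diff_left x12 (ltW y12) df)).
rewrite (vseg_split y12 m12 (diff_right x12 (ltW y12) df)).
by do ?[move: (seg _ _ _) => ?]; ring.
Qed.

Lemma rectD f g (x1 x2 y1 y2 : R) : x1 <= x2 -> y1 <= y2 ->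
  diff_on_bd f x1 x2 y1 y2 -> diff_on_bd g x1 x2 y1 y2 ->
  rect (fun z => f z + g z) x1 x2 y1 y2 = rect f x1 x2 y1 y2 + rect g x1 x2 y1 y2.
Proof.
move=> x12 y12 df dg; rewrite !rectE.
rewrite (segD (diff_bottom x12 y12 df) (diff_bottom x12 y12 dg)).
rewrite (segD (diff_top x12 y12 df) (diff_top x12 y12 dg)).
rewrite (segD (diff_left x12 y12 df) (diff_left x12 y12 dg)).
rewrite (segD (diff_right x12 y12 df) (diff_right x12 y12 dg)).
by do ?[move: (seg _ _ _) => ?]; ring.
Qed.

Lemma rectZ (c : R[i]) f (x1 x2 y1 y2 : R) : x1 <= x2 -> y1 <= y2 ->
  diff_on_bd f x1 x2 y1 y2 ->
  rect (fun z => c * f z) x1 x2 y1 y2 = c * rect f x1 x2 y1 y2.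
Proof.
move=> x12 y12 df; rewrite !rectE.
rewrite (segZ c (diff_bottom x12 y12 df)) (segZ c (diff_top x12 y12 df)).
rewrite (segZ c (diff_left x12 y12 df)) (segZ c (diff_right x12 y12 df)).
by do ?[move: (seg _ _ _) => ?]; ring.
Qed.

(** By [seg_affine] each side contributes the increment of a primitive, and these telescope. This
    lets [Goursat] subtract a first-order expansion. *)
Lemma rect_affine (a b : R[i]) (x1 x2 y1 y2 : R) :
  rect (fun z => a + b * z) x1 x2 y1 y2 = 0.
Proof. by rewrite rectE !seg_affine; field. Qed.

Lemma seg_ext f g p q :
  (forall t : R, 0 <= t <= 1 -> f (p + t%:C * (q - p)) = g (p + t%:C * (q - p))) ->
  seg f p q = seg g p q.
Proof.
move=> fg; rewrite !segE; congr (_ * (_ +i* _)); apply: eq_Rintegral => t.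
  by rewrite inE /= in_itv /= => /fg ->.
by rewrite inE /= in_itv /= => /fg ->.
Qed.

Lemma rect_ext f g (x1 x2 y1 y2 : R) : x1 <= x2 -> y1 <= y2 ->
  (forall x y, x1 <= x <= x2 -> y1 <= y <= y2 ->
     [|| x == x1, x == x2, y == y1 | y == y2] -> f (x +i* y) = g (x +i* y)) ->
  rect f x1 x2 y1 y2 = rect g x1 x2 y1 y2.
Proof.
move=> x12 y12 fg; rewrite !rectE.
have cx t : 0 <= t <= 1 -> x1 <= x1 + t * (x2 - x1) <= x2 by nra.
have cy t : 0 <= t <= 1 -> y1 <= y1 + t * (y2 - y1) <= y2 by nra.
congr (_ + _ - _ - _); apply: seg_ext => t t01; rewrite ?hseg_pt ?vseg_pt;
  by apply: fg; rewrite ?cx ?cy ?lexx ?x12 ?y12 ?eqxx ?orbT.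
Qed.

Lemma cabs_hlen (x1 x2 y : R) : x1 <= x2 ->
  cabs ((x2 +i* y) - (x1 +i* y)) = x2 - x1.
Proof.
move=> x12; have -> : (x2 +i* y) - (x1 +i* y) = (x2 - x1)%:C.
  by apply/eqP; rewrite eq_complex /= subrr !eqxx.
by rewrite cabs_real ger0_norm // subr_ge0.
Qed.

Lemma cabs_vlen (x y1 y2 : R) : y1 <= y2 ->
  cabs ((x +i* y2) - (x +i* y1)) = y2 - y1.
Proof.
move=> y12; rewrite /Normc.normc /= subrr expr0n /= add0r sqrtr_sqr ger0_norm //.
by rewrite subr_ge0.
Qed.

Lemma rect_bound f (x1 x2 y1 y2 M : R) : x1 <= x2 -> y1 <= y2 ->
  diff_on_bd f x1 x2 y1 y2 ->
  (forall x y, x1 <= x <= x2 -> y1 <= y <= y2 ->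
     [|| x == x1, x == x2, y == y1 | y == y2] -> cabs (f (x +i* y)) <= M) ->
  cabs (rect f x1 x2 y1 y2) <= 4 * M * ((x2 - x1) + (y2 - y1)).
Proof.
move=> x12 y12 df H; rewrite !rectE.
have hb : cabs (seg f (x1 +i* y1) (x2 +i* y1)) <= 2 * M * (x2 - x1).
  rewrite -(cabs_hlen y1 x12); apply: seg_bound; first exact: (diff_bottom x12 y12 df).
  by move=> t t01; rewrite hseg_pt; apply: H; rewrite ?eqxx ?orbT //; nra.
have ht : cabs (seg f (x1 +i* y2) (x2 +i* y2)) <= 2 * M * (x2 - x1).
  rewrite -(cabs_hlen y2 x12); apply: seg_bound; first exact: (diff_top x12 y12 df).
  by move=> t t01; rewrite hseg_pt; apply: H; rewrite ?eqxx ?orbT //; nra.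
have hl : cabs (seg f (x1 +i* y1) (x1 +i* y2)) <= 2 * M * (y2 - y1).
  rewrite -(cabs_vlen x1 y12); apply: seg_bound; first exact: (diff_left x12 y12 df).
  by move=> t t01; rewrite vseg_pt; apply: H; rewrite ?eqxx ?orbT //; nra.
have hr : cabs (seg f (x2 +i* y1) (x2 +i* y2)) <= 2 * M * (y2 - y1).
  rewrite -(cabs_vlen x2 y12); apply: seg_bound; first exact: (diff_right x12 y12 df).
  by move=> t t01; rewrite vseg_pt; apply: H; rewrite ?eqxx ?orbT //; nra.
apply: le_trans (cabsB _ _) _; apply: le_trans (lerD (cabsB _ _) (lexx _)) _.
apply: le_trans (lerD (lerD (cabsD _ _) (lexx _)) (lexx _)) _.
by move: hb ht hl hr; do 4![move: (cabs (seg _ _ _)) => ?]; lra.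
Qed.

Lemma nested_intervals (x b : nat -> R) :
  (forall n, x n <= x n.+1) -> (forall n, b n.+1 <= b n) ->
  (forall n, x n <= b n) -> exists p, forall n, x n <= p <= b n.
Proof.
move=> xi bd xb.
have xm : {homo x : m n / (m <= n)%N >-> m <= n} by apply: homo_leq => //; exact: le_trans.
have bm : {homo b : m n / (m <= n)%N >-> n <= m}.
  by apply: homo_leq => // u v t uv vt; exact: le_trans vt uv.
have xbmn m n : x m <= b n.
  apply: le_trans (xm _ _ (leq_maxl m n)) _.
  by apply: le_trans (xb _) _; apply: bm; exact: leq_maxr.
exists (sup (range x)) => n; apply/andP; split.
  apply: ub_le_sup; last by exists n.
  by exists (b 0%N) => _ [m _ <-].
apply: ge_sup; first by exists (x 0%N), 0%N.
by move=> _ [m _ <-].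
Qed.

Lemma rect_quarters f (x w y k : R) : 0 < w -> 0 < k ->
  diff_on_rect f x (x + (w + w)) y (y + (k + k)) ->
  rect f x (x + (w + w)) y (y + (k + k)) =
    rect f x (x + w) y (y + k) + rect f x (x + w) (y + k) (y + k + k) +
    rect f (x + w) (x + w + w) y (y + k) +
    rect f (x + w) (x + w + w) (y + k) (y + k + k).
Proof.
move=> w0 k0; rewrite !addrA => df.
have b0 : x < x + w + w by lra.
have b1 : y <= y + k + k by lra.
have b2 : x <= x + w <= x + w + w by lra.
have b3 : x <= x + w by lra.
have b4 : x + w <= x + w + w by lra.
have b5 : y < y + k + k by lra.
have b6 : y <= y + k <= y + k + k by lra.
rewrite (rect_vsplit b0 b1 b2 (diff_rect_bd df)) (rect_hsplit b3 b5 b6); last first.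
  by apply: diff_rect_bd => a b ha hb; apply: df; lra.
rewrite (rect_hsplit b4 b5 b6) ?addrA //.
by apply: diff_rect_bd => a b ha hb; apply: df; lra.
Qed.

Lemma cabs_pigeon4 (A B C D : R[i]) (m : R) : m *+ 4 <= cabs (A + B + C + D) ->
  cabs A < m -> cabs B < m -> cabs C < m -> m <= cabs D.
Proof.
move=> h; move: (cabsD (A + B + C) D) (cabsD (A + B) C) (cabsD A B); lra.
Qed.

(** Bisection: were the integral nonzero, nested quarters would each keep a quarter of its modulus,
    whereas differentiability at their common point makes these integrals smaller than that. *)
Theorem Goursat f (x1 x2 y1 y2 : R) : x1 < x2 -> y1 < y2 ->
  diff_on_rect f x1 x2 y1 y2 -> rect f x1 x2 y1 y2 = 0.
Proof.
move=> x12 y12 df; apply/eqP; rewrite -cabs_eq0 -[_ == _]negbK; apply/negP => M0.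
pose M := cabs (rect f x1 x2 y1 y2).
have {}M0 : 0 < M by rewrite lt_def M0 cabs_ge0.
pose w := x2 - x1; pose k := y2 - y1.
have w0 : 0 < w by rewrite subr_gt0. have k0 : 0 < k by rewrite subr_gt0.
pose big n (q : R * R) :=
  M / 4 ^+ n <= cabs (rect f q.1 (q.1 + w / 2 ^+ n) q.2 (q.2 + k / 2 ^+ n)).
(* The upper right quarter is the default choice; [Qbig] shows with [cabs_pigeon4] that it carries
   enough of the integral when the other three do not. *)
pose step n (q : R * R) : R * R :=
  let w' := w / 2 ^+ n.+1 in let k' := k / 2 ^+ n.+1 in
  if big n.+1 q then q else
  if big n.+1 (q.1 + w', q.2) then (q.1 + w', q.2) else
  if big n.+1 (q.1, q.2 + k') then (q.1, q.2 + k') else (q.1 + w', q.2 + k').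
pose Q := fix Q n := if n is m.+1 then step m (Q m) else (x1, y1).
have pw n : 0 < w / 2 ^+ n by rewrite divr_gt0 // exprn_gt0.
have pk n : 0 < k / 2 ^+ n by rewrite divr_gt0 // exprn_gt0.
have hw n : w / 2 ^+ n = w / 2 ^+ n.+1 + w / 2 ^+ n.+1.
  by rewrite exprS invfM; field; rewrite expf_neq0 // pnatr_eq0.
have hk n : k / 2 ^+ n = k / 2 ^+ n.+1 + k / 2 ^+ n.+1.
  by rewrite exprS invfM; field; rewrite expf_neq0 // pnatr_eq0.
have Qx n : (Q n).1 <= (Q n.+1).1 /\
   (Q n.+1).1 + w / 2 ^+ n.+1 <= (Q n).1 + w / 2 ^+ n.
  rewrite /= /step (hw n); have := pw n.+1.
  by do ?[case: ifP => _ /=]; move=> *; split; lra.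
have Qy n : (Q n).2 <= (Q n.+1).2 /\
   (Q n.+1).2 + k / 2 ^+ n.+1 <= (Q n).2 + k / 2 ^+ n.
  rewrite /= /step (hk n); have := pk n.+1.
  by do ?[case: ifP => _ /=]; move=> *; split; lra.
have Qin n : [/\ x1 <= (Q n).1, (Q n).1 + w / 2 ^+ n <= x2,
               y1 <= (Q n).2 & (Q n).2 + k / 2 ^+ n <= y2].
  elim: n => [|n [h1 h2 h3 h4]].
    by rewrite /= expr0 !divr1 /w /k; split; lra.
  have [? ?] := Qx n; have [? ?] := Qy n; split; lra.
have Qbig n : big n (Q n).
  elim: n => [|n IH].
    rewrite /big /= expr0 !divr1 /w /k.
    by rewrite (addrC x1) (addrC y1) !subrK.
  rewrite /= /step; case: ifPn => // n1; case: ifPn => // n2; case: ifPn => // n3.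
  move: IH n1 n2 n3; rewrite /big /= -!ltNge.
  have [h1 h2 h3 h4] := Qin n; move: h1 h2 h3 h4.
  case: (Q n) => x y /= h1 h2 h3 h4.
  rewrite (hw n) (hk n) in h2 h4 *.
  have := pw n.+1; have := pk n.+1.
  move: (w / _ ^+ _) (k / _ ^+ _) h2 h4 => w' k' h2 h4 k'0 w'0.
  rewrite rect_quarters //; last by move=> a b ha hb; apply: df; lra.
  have -> : M / 4 ^+ n = M / 4 ^+ n.+1 *+ 4.
    by rewrite exprS invfM; field; rewrite expf_neq0 // pnatr_eq0.
  by move=> h n1 n2 n3; exact: cabs_pigeon4 h n1 n3 n2.
have [p1 Hp1] : exists p, forall n, (Q n).1 <= p <= (Q n).1 + w / 2 ^+ n.
  apply: nested_intervals => n; first by have [] := Qx n.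
    by have [] := Qx n.
  by rewrite lerDl ltW.
have [p2 Hp2] : exists p, forall n, (Q n).2 <= p <= (Q n).2 + k / 2 ^+ n.
  apply: nested_intervals => n; first by have [] := Qy n.
    by have [] := Qy n.
  by rewrite lerDl ltW.
have [d Hd] : exists d, cdiff f (p1 +i* p2) d.
  have := Hp1 0%N; have := Hp2 0%N; rewrite /= expr0 !divr1 /w /k => *.
  apply: df; lra.
(* With this [e], the bound [4 * (e * (w' + k')) * (w' + k')] from [rect_bound] equals
   [M / 4 ^+ n / 2], half of what [big] asserts. *)
pose e := M / (8 * (w + k) ^+ 2).
have e0 : 0 < e by rewrite divr_gt0 // mulr_gt0 // exprn_gt0 // addr_gt0.
have [r r0 Hr] := Hd _ e0.
have [n Hn] : exists n, (w + k) / 2 ^+ n < r.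
  have [n Hn] : exists n : nat, (w + k) / r < n%:R.
    exists (Num.bound ((w + k) / r)); apply: archi_boundP.
    by rewrite divr_ge0 ?ltW // addr_gt0.
  exists n; rewrite ltr_pdivrMr ?exprn_gt0 // mulrC -ltr_pdivrMr //.
  apply: lt_trans Hn _; rewrite -natrX ltr_nat; exact: ltn_expl.
have := Qbig n; have [h1 h2 h3 h4] := Qin n.
have := Hp1 n; have := Hp2 n; rewrite /big; move: h1 h2 h3 h4.
case: (Q n) => x y /=; set w' := w / _; set k' := k / _.
have w'0 : 0 < w' by exact: pw. have k'0 : 0 < k' by exact: pk.
move=> h1 h2 h3 h4 hp2 hp1.
have wkr : w' + k' < r by rewrite /w' /k' -mulrDl.
pose p := p1 +i* p2.
(* [g] is [f] minus its first-order expansion at [p]: same boundary integral by [rect_affine], but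
   of size [e] times the distance to [p]. *)
pose g z := f z + (- (f p - d * p) + (- d) * z).
have dr : diff_on_rect f x (x + w') y (y + k').
  by move=> a b ha hb; apply: df; lra.
have da (a b : R[i]) : diff_on_rect (fun z => a + b * z) x (x + w') y (y + k').
  move=> u v _ _; exists (0 + (0 * (u +i* v) + b * 1)).
  apply: (@cdiffD R (fun=> a)); first exact: cdiff_cst.
  by apply: (@cdiffM R (fun=> b) id); [exact: cdiff_cst | exact: cdiff_id].
have -> : rect f x (x + w') y (y + k') = rect g x (x + w') y (y + k').
  rewrite /g rectD ?rect_affine ?addr0 //; try lra; exact: diff_rect_bd.
move=> Mg.
have dg : diff_on_rect g x (x + w') y (y + k').
  move=> a b ha hb; have [d1 H1] := dr a b ha hb.
  have [d2 H2] := da (- (f p - d * p)) (- d) a b ha hb.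
  by exists (d1 + d2); exact: cdiffD.
have gb a b : x <= a <= x + w' -> y <= b <= y + k' ->
    [|| a == x, a == x + w', b == y | b == y + k'] -> cabs (g (a +i* b)) <= e * (w' + k').
  move=> ha hb _; pose h := (a +i* b) - p.
  have hh : cabs h <= w' + k'.
    apply: le_trans (cabs_le_ReIm _) _; rewrite /h /p /=.
    by rewrite lerD // ler_norml; lra.
  have := Hr h (le_lt_trans hh wkr).
  have -> : (p1 +i* p2) + h = a +i* b by rewrite /h /p addrC subrK.
  have -> : g (a +i* b) = f (a +i* b) - f p - d * h by rewrite /g /h; ring.
  by move=> H; apply: le_trans H _; apply: ler_wpM2l => //; exact: ltW.
have gM : cabs (rect g x (x + w') y (y + k')) <= M / 4 ^+ n / 2.
  apply: le_trans (rect_bound _ _ (diff_rect_bd dg) gb) _; try lra.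
  have -> : x + w' - x = w' by ring.
  have -> : y + k' - y = k' by ring.
  have -> : w' + k' = (w + k) / 2 ^+ n by rewrite -mulrDl.
  rewrite /e; have -> : (4 : R) ^+ n = 2 ^+ n * 2 ^+ n by rewrite -exprMn -natrM.
  rewrite le_eqVlt; apply/orP; left; apply/eqP; field.
  by rewrite expf_neq0 ?pnatr_eq0 // gt_eqF // addr_gt0.
have : 0 < M / 4 ^+ n by rewrite divr_gt0 // exprn_gt0.
lra.
Qed.

End Goursat.

(** * Cauchy's formula and power series *)

Section Cauchy.
Variable R : realType.
Implicit Types (f g : R[i] -> R[i]) (b c h : R[i]).

Lemma ccont01_bounded (phi : R -> R[i]) : ccont01 phi ->
  exists M, forall t, 0 <= t <= 1 -> cabs (phi t) <= M.
Proof.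
move=> H.
have bnd (u : R -> R) : cont01 u -> exists M, forall t, 0 <= t <= 1 -> `|u t| <= M.
  move=> cu; have cu' := cont01_within cu (lexx 0) (lexx 1).
  have [c1 _ H1] := EVT_max (@ler01 R) cu'.
  have [c2 _ H2] := EVT_min (@ler01 R) cu'.
  exists (Num.max (u c1) (- u c2)) => t t01.
  have t01' : t \in `[0, 1] by rewrite in_itv.
  have := H1 _ t01'; have := H2 _ t01'; rewrite ler_norml => *.
  rewrite lerNl le_max; apply/andP; split; last by rewrite le_max; apply/orP; left.
  by rewrite lerN2; apply/orP; right.
have [M1 h1] := bnd _ (ccont01_Re H); have [M2 h2] := bnd _ (ccont01_Im H).
exists (M1 + M2) => t t01; apply: le_trans (cabs_le_ReIm _) _.
by rewrite lerD ?h1 ?h2.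
Qed.

Lemma rect_bd_bounded f (x1 x2 y1 y2 : R) : x1 <= x2 -> y1 <= y2 ->
  diff_on_bd f x1 x2 y1 y2 -> exists2 M, 0 <= M &
  (forall x y, x1 <= x <= x2 -> y1 <= y <= y2 ->
     [|| x == x1, x == x2, y == y1 | y == y2] -> cabs (f (x +i* y)) <= M).
Proof.
move=> x12 y12 df.
have [M1 h1] := ccont01_bounded (ccont01_path (diff_left x12 y12 df)).
have [M2 h2] := ccont01_bounded (ccont01_path (diff_right x12 y12 df)).
have [M3 h3] := ccont01_bounded (ccont01_path (diff_bottom x12 y12 df)).
have [M4 h4] := ccont01_bounded (ccont01_path (diff_top x12 y12 df)).
exists (`|M1| + `|M2| + `|M3| + `|M4|); first by rewrite !addr_ge0.
have n1 := ler_norm M1; have n2 := ler_norm M2.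
have n3 := ler_norm M3; have n4 := ler_norm M4.
have z1 := normr_ge0 M1; have z2 := normr_ge0 M2.
have z3 := normr_ge0 M3; have z4 := normr_ge0 M4.
have par (a b t : R) : a <= t <= b -> exists2 l, 0 <= l <= 1 & t = a + l * (b - a).
  move=> ht; have [ab|ab] := eqVneq a b.
    by exists 0; [lra|]; move: ht; rewrite ab; lra.
  have ab' : 0 < b - a by rewrite subr_gt0 lt_neqAle ab; lra.
  exists ((t - a) / (b - a)); first by rewrite divr_ge0 ?ler_pdivrMr; lra.
  by rewrite divfK ?gt_eqF // addrC subrK.
move=> x y /par[l l01 ->] /par[m m01 ->] /or4P[] /eqP ->.
- by have := h1 _ m01; rewrite vseg_pt => H; apply: le_trans H _; lra.
- by have := h2 _ m01; rewrite vseg_pt => H; apply: le_trans H _; lra.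
- by have := h3 _ l01; rewrite hseg_pt => H; apply: le_trans H _; lra.
- by have := h4 _ l01; rewrite hseg_pt => H; apply: le_trans H _; lra.
Qed.

(** Four cuts at distance [r] from the exceptional point detach four rectangles that avoid it, and
    [Goursat] kills each of them. *)
Lemma rect_shrink f (x1 x2 y1 y2 b1 b2 r : R) : 0 < r ->
  x1 < b1 - r -> b1 + r < x2 -> y1 < b2 - r -> b2 + r < y2 ->
  (forall x y, x1 <= x <= x2 -> y1 <= y <= y2 -> x +i* y != b1 +i* b2 ->
     exists d, cdiff f (x +i* y) d) ->
  rect f x1 x2 y1 y2 = rect f (b1 - r) (b1 + r) (b2 - r) (b2 + r).
Proof.
move=> r0 h1 h2 h3 h4 df.
have ne x y : (x != b1) || (y != b2) -> x +i* y != b1 +i* b2.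
  by rewrite eq_complex /= negb_and.
rewrite (@rect_vsplit _ f x1 (b1 - r) x2); [|lra|lra|lra|]; last first.
  move=> x y hx hy hxy; apply: df => //; apply: ne; apply/orP.
  by case/or4P: hxy => /eqP ->; [left|left|right|right]; apply/eqP; lra.
rewrite [X in X + _ = _]Goursat; [rewrite add0r|lra|lra|]; last first.
  by move=> x y hx hy; apply: df; try lra; apply: ne; apply/orP; left; apply/eqP; lra.
rewrite (@rect_vsplit _ f (b1 - r) (b1 + r) x2); [|lra|lra|lra|]; last first.
  move=> x y hx hy hxy; apply: df; try lra; apply: ne; apply/orP.
  by case/or4P: hxy => /eqP ->; [left|left|right|right]; apply/eqP; lra.
rewrite [X in _ + X = _]Goursat; [rewrite addr0|lra|lra|]; last first.
  by move=> x y hx hy; apply: df; try lra; apply: ne; apply/orP; left; apply/eqP; lra.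
rewrite (@rect_hsplit _ f (b1 - r) (b1 + r) y1 (b2 - r) y2); [|lra|lra|lra|]; last first.
  move=> x y hx hy hxy; apply: df; try lra; apply: ne; apply/orP.
  by case/or4P: hxy => /eqP ->; [left|left|right|right]; apply/eqP; lra.
rewrite [X in X + _ = _]Goursat; [rewrite add0r|lra|lra|]; last first.
  by move=> x y hx hy; apply: df; try lra; apply: ne; apply/orP; right; apply/eqP; lra.
rewrite (@rect_hsplit _ f (b1 - r) (b1 + r) (b2 - r) (b2 + r) y2); [|lra|lra|lra|]; last first.
  move=> x y hx hy hxy; apply: df; try lra; apply: ne; apply/orP.
  by case/or4P: hxy => /eqP ->; [left|left|right|right]; apply/eqP; lra.
rewrite [X in _ + X = _]Goursat; [by rewrite addr0|lra|lra|].
by move=> x y hx hy; apply: df; try lra; apply: ne; apply/orP; right; apply/eqP; lra.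
Qed.

Definition cinv (z : R[i]) : R[i] := z^-1.

(* The value of this integral is [2 * pi * i]; only [winding != 0] matters. *)
Definition winding : R[i] := rect cinv (-1) 1 (-1) 1.

Lemma diff_cinv_seg p q :
  (forall t : R, 0 <= t <= 1 -> p + t%:C * (q - p) != 0) -> diff_on_seg cinv p q.
Proof. by move=> H t /H z0; eexists; exact: cdiff_inv. Qed.

(** The form [dz / (z - b)] pulls back to [dz / z] under [z |-> b + r z]; hence all squares centred
    at [b] give the same integral, [winding]. *)
Lemma seg_inv_scale b p q (r : R) : r != 0 -> diff_on_seg cinv p q ->
  seg (fun z => (z - b)^-1) (b + r%:C * p) (b + r%:C * q) = seg cinv p q.
Proof.
move=> r0 H; have rC : r%:C != 0 :> R[i] by rewrite fmorph_eq0.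
rewrite !segE.
have -> : (fun t : R => (b + r%:C * p + t%:C * (b + r%:C * q - (b + r%:C * p)) - b)^-1)
  = (fun t : R => r%:C^-1 * cinv (p + t%:C * (q - p))).
  apply/funext => t; rewrite /cinv -invfM; congr (_^-1); ring.
rewrite cint01Z; last exact: ccont01_path.
by rewrite mulrA; congr (_ * _); field.
Qed.

Lemma rect_inv_square (b1 b2 r : R) : 0 < r ->
  rect (fun z => (z - (b1 +i* b2))^-1) (b1 - r) (b1 + r) (b2 - r) (b2 + r) = winding.
Proof.
move=> r0; have rn0 : r != 0 by rewrite gt_eqF.
have pt (x y : R) : (b1 + r * x) +i* (b2 + r * y) = (b1 +i* b2) + r%:C * (x +i* y).
  by apply/eqP; rewrite eq_complex /=; apply/andP; split; apply/eqP; ring.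
have m (a : R) : a - r = a + r * (- 1) by ring.
have p (a : R) : a + r = a + r * 1 by ring.
rewrite /winding !rectE !(m, p) !pt !seg_inv_scale //.
all: apply: diff_cinv_seg => t t01; rewrite ?hseg_pt ?vseg_pt eq_complex /= negb_and.
all: by apply/orP; first [left; apply/eqP; lra | right; apply/eqP; lra].
Qed.

Lemma Re_cinv (x y : R) : cRe (cinv (x +i* y)) = x / (x ^+ 2 + y ^+ 2).
Proof. by []. Qed.

Lemma Im_cinv (x y : R) : cIm (cinv (x +i* y)) = - y / (x ^+ 2 + y ^+ 2).
Proof. by rewrite mulNr. Qed.

(** On each side, of length 2, the relevant part of [1 / z] is [1 / (1 + a ^+ 2)] up to sign, at
    least 1/2 in modulus. With orientation, each side adds at least 1 to the imaginary part, which
    is therefore at least 4. *)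
Lemma winding_neq0 : winding != 0.
Proof.
have dv (x y1 y2 : R) : x != 0 -> ccont01 (fun t => cinv ((x +i* y1) + t%:C * ((x +i* y2) - (x +i* y1)))).
  move=> x0; apply: ccont01_path; apply: diff_cinv_seg => t _; rewrite vseg_pt.
  by rewrite eq_complex /= negb_and x0.
have dh (y x1 x2 : R) : y != 0 -> ccont01 (fun t => cinv ((x1 +i* y) + t%:C * ((x2 +i* y) - (x1 +i* y)))).
  move=> y0; apply: ccont01_path; apply: diff_cinv_seg => t _; rewrite hseg_pt.
  by rewrite eq_complex /= negb_and y0 orbT.
have N1 : (-1 : R) != 0 by rewrite oppr_eq0 oner_eq0.
have lb (a : R) : -1 <= a <= 1 -> 1 / 2 <= (1 + a ^+ 2)^-1.
  move=> ha; rewrite div1r lef_pV2 ?posrE //; nra.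
have tt (t : R) : 0 <= t <= 1 -> -1 <= -1 + t * (1 - -1) <= 1 by lra.
have hb : 1 <= cIm (seg cinv ((-1) +i* (-1)) (1 +i* (-1))).
  rewrite segE ImM /cint01 [cRe (_ - _)]/= [cIm (_ - _)]/=.
  rewrite -[cRe (_ +i* _)]/(int01 _) -[cIm (_ +i* _)]/(int01 _).
  have : 1 / 2 <= int01 (cIm \o (fun t : R => cinv ((-1) +i* (-1) + t%:C * (1 +i* (-1) - (-1) +i* (-1))))).
    rewrite -[X in X <= _]int01_cst; apply: le_int01; [exact: cont01_cst|exact/ccont01_Im/dh|].
    move=> t /tt/lb h; rewrite -[(_ \o _) t]/(cIm (cinv _)) hseg_pt Im_cinv.
    by rewrite opprK in h; rewrite sqrrN expr1n opprK [X in _ <= X]div1r [_ ^+ 2 + 1]addrC.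
  lra.
have ht : cIm (seg cinv ((-1) +i* 1) (1 +i* 1)) <= - 1.
  rewrite segE ImM /cint01 [cRe (_ - _)]/= [cIm (_ - _)]/=.
  rewrite -[cRe (_ +i* _)]/(int01 _) -[cIm (_ +i* _)]/(int01 _).
  have : int01 (cIm \o (fun t : R => cinv ((-1) +i* 1 + t%:C * (1 +i* 1 - (-1) +i* 1)))) <= - (1 / 2).
    rewrite -[X in _ <= X]int01_cst; apply: le_int01; [exact/ccont01_Im/dh/oner_neq0|exact: cont01_cst|].
    move=> t /tt/lb h; rewrite -[(_ \o _) t]/(cIm (cinv _)) hseg_pt Im_cinv.
    by rewrite expr1n mulNr lerN2 [X in _ <= X]div1r [_ ^+ 2 + 1]addrC.
  lra.
have hr : 1 <= cIm (seg cinv (1 +i* (-1)) (1 +i* 1)).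
  rewrite segE ImM /cint01 [cRe (_ - _)]/= [cIm (_ - _)]/=.
  rewrite -[cRe (_ +i* _)]/(int01 _) -[cIm (_ +i* _)]/(int01 _).
  have : 1 / 2 <= int01 (cRe \o (fun t : R => cinv (1 +i* (-1) + t%:C * (1 +i* 1 - 1 +i* (-1))))).
    rewrite -[X in X <= _]int01_cst; apply: le_int01; [exact: cont01_cst|exact/ccont01_Re/dv/oner_neq0|].
    move=> t /tt/lb h; rewrite -[(_ \o _) t]/(cRe (cinv _)) vseg_pt Re_cinv.
    by rewrite expr1n [X in _ <= X]div1r.
  lra.
have hl : cIm (seg cinv ((-1) +i* (-1)) ((-1) +i* 1)) <= - 1.
  rewrite segE ImM /cint01 [cRe (_ - _)]/= [cIm (_ - _)]/=.
  rewrite -[cRe (_ +i* _)]/(int01 _) -[cIm (_ +i* _)]/(int01 _).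
  have : int01 (cRe \o (fun t : R => cinv ((-1) +i* (-1) + t%:C * ((-1) +i* 1 - (-1) +i* (-1))))) <= - (1 / 2).
    rewrite -[X in _ <= X]int01_cst; apply: le_int01; [exact/ccont01_Re/dv|exact: cont01_cst|].
    move=> t /tt/lb h; rewrite -[(_ \o _) t]/(cRe (cinv _)) vseg_pt Re_cinv.
    by rewrite sqrrN expr1n mulNr lerN2 [X in _ <= X]div1r.
  lra.
apply/eqP => W0; have : cIm winding = 0 by rewrite W0.
rewrite /winding rectE !ImD !ImN; move: hb ht hr hl.
by do 4![move: (cIm (seg _ _ _)) => ?]; lra.
Qed.

Lemma cdiff_sub_inv b z : z != b -> cdiff (fun z => (z - b)^-1) z (- (z - b) ^- 2).
Proof.
move=> zb; have d1 : cdiff (fun z => z + - b) z 1.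
  by apply: cdiff_eq (cdiffD (cdiff_id z) (cdiff_cst (- b) z)); rewrite addr0.
have := cdiff_comp d1 (cdiff_inv _); rewrite subr_eq0 => /(_ zb).
by rewrite mulr1.
Qed.

(** Near [b] the quotient [(f z - f b) / (z - b)] is bounded by [cabs d + 1], while its integral can
    be moved by [rect_shrink] to squares of arbitrarily small perimeter. *)
Lemma Cauchy_formula f (x1 x2 y1 y2 b1 b2 : R) :
  x1 < b1 < x2 -> y1 < b2 < y2 -> diff_on_rect f x1 x2 y1 y2 ->
  rect (fun z => f z * (z - (b1 +i* b2))^-1) x1 x2 y1 y2 = winding * f (b1 +i* b2).
Proof.
move=> /andP[xb1 xb2] /andP[yb1 yb2] df; set b := b1 +i* b2.
have [d Hd] : exists d, cdiff f b d by apply: df; lra.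
have dq z d1 : z != b -> cdiff f z d1 -> exists d2, cdiff (fun z => f z * (z - b)^-1) z d2.
  by move=> zb H; eexists; exact: cdiffM H (cdiff_sub_inv zb).
pose A := rect (fun z => f z * (z - b)^-1) x1 x2 y1 y2 - winding * f b.
suff A0 : A = 0 by apply/eqP; rewrite -subr_eq0 -/A A0.
apply/eqP; rewrite -cabs_eq0; apply/eqP/le_anti; rewrite cabs_ge0 andbT.
have [r r0 Hr] := Hd 1 ltr01.
pose N := cabs d + 1.
have N0 : 0 < N by have := cabs_ge0 d; rewrite /N; lra.
apply/ler_addgt0Pl => e e0; rewrite addr0.
pose s0 := Num.min (Num.min (b1 - x1) (x2 - b1)) (Num.min (b2 - y1) (y2 - b2)).
(* [s0 / 2] keeps the square inside the rectangle; [r / 3] puts it in the disc of radius [r], its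
   points being within [2 * s] of [b]; 16 comes from [rect_bound], namely
   [4 * N * (2 * s + 2 * s)]. *)
pose s := Num.min (s0 / 2) (Num.min (r / 3) (e / (16 * N))).
have s00 : 0 < s0 by rewrite !lt_min; lra.
have s_0 : 0 < s by rewrite !lt_min !divr_gt0 // mulr_gt0.
have : s0 <= Num.min (b1 - x1) (x2 - b1) by rewrite ge_min lexx.
rewrite le_min => /andP[s01 s02].
have : s0 <= Num.min (b2 - y1) (y2 - b2) by rewrite ge_min lexx orbT.
rewrite le_min => /andP[s03 s04].
have ss0 : s <= s0 / 2 by rewrite ge_min lexx.
have : s <= Num.min (r / 3) (e / (16 * N)) by rewrite ge_min lexx orbT.
rewrite le_min => /andP[sr se].
have {}se : 16 * N * s <= e by rewrite mulrC -ler_pdivlMr // mulr_gt0.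
have bd_neq x y : [|| x == b1 - s, x == b1 + s, y == b2 - s | y == b2 + s] -> x +i* y != b.
  rewrite /b eq_complex /= negb_and => /or4P[] /eqP ->; apply/orP;
    by [left; apply/eqP; lra | right; apply/eqP; lra].
have dsm : diff_on_bd (fun z => f z * (z - b)^-1) (b1 - s) (b1 + s) (b2 - s) (b2 + s).
  move=> x y hx hy /bd_neq hb; have [|| d1 H1] := df x y; try lra.
  exact: dq hb H1.
have dinv : diff_on_bd (fun z => (z - b)^-1) (b1 - s) (b1 + s) (b2 - s) (b2 + s).
  by move=> x y hx hy /bd_neq hb; eexists; exact: cdiff_sub_inv.
have dcinv : diff_on_bd (fun z => - f b * (z - b)^-1) (b1 - s) (b1 + s) (b2 - s) (b2 + s).
  move=> x y hx hy /bd_neq hb; eexists; apply: cdiffM (cdiff_sub_inv hb).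
  exact: cdiff_cst.
have -> : A = rect (fun z => f z * (z - b)^-1 + - f b * (z - b)^-1)
    (b1 - s) (b1 + s) (b2 - s) (b2 + s).
  rewrite rectD //; [|lra|lra].
  rewrite (rectZ (- f b) _ _ dinv); [|lra|lra].
  rewrite rect_inv_square // /A (@rect_shrink _ x1 x2 y1 y2 b1 b2 s) //; [|lra|lra|lra|lra|].
    by congr (_ + _); rewrite mulrC mulNr.
  move=> x y hx hy hb; have [|| d1 H1] := df x y; try lra.
  exact: dq hb H1.
have Mb x y : b1 - s <= x <= b1 + s -> b2 - s <= y <= b2 + s ->
    [|| x == b1 - s, x == b1 + s, y == b2 - s | y == b2 + s] ->
    cabs (f (x +i* y) * ((x +i* y) - b)^-1 + - f b * ((x +i* y) - b)^-1) <= N.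
  move=> hx hy /bd_neq hb; set h := (x +i* y) - b.
  have h0 : h != 0 by rewrite subr_eq0.
  have hr : cabs h < r.
    apply: le_lt_trans (cabs_le_ReIm _) _; rewrite /h /b /=.
    have : `|x - b1| <= s by rewrite ler_norml; lra.
    have : `|y - b2| <= s by rewrite ler_norml; lra.
    lra.
  rewrite -mulrDl cabsM cabsV ler_pdivrMr ?cabs_gt0 //.
  have := Hr h hr; have -> : b + h = x +i* y by rewrite /h; ring.
  move: (f (x +i* y) - f b) => u H; have -> : u = (u - d * h) + d * h by ring.
  apply: le_trans (cabsD _ _) _; rewrite cabsM /N mulrDl addrC lerD2l.
  exact: H.
apply: le_trans (rect_bound _ _ _ Mb) _; [lra|lra| |].
  move=> x y hx hy hb; have [d1 H1] := dsm x y hx hy hb.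
  have [d2 H2] := dcinv x y hx hy hb.
  by exists (d1 + d2); exact: cdiffD.
apply: le_trans se; rewrite le_eqVlt; apply/orP; left; apply/eqP; ring.
Qed.

Lemma cabs_bd_center (c1 c2 x y r : R) : 
  [|| x == c1 - r, x == c1 + r, y == c2 - r | y == c2 + r] -> 0 < r ->
  r <= cabs ((x +i* y) - (c1 +i* c2)).
Proof.
move=> H r0; case/or4P: H => /eqP ->.
- apply: le_trans (cabs_Re _); rewrite ler_normr /=; apply/orP; right; lra.
- apply: le_trans (cabs_Re _); rewrite ler_normr /=; apply/orP; left; lra.
- apply: le_trans (cabs_Im _); rewrite ler_normr /=; apply/orP; right; lra.
- apply: le_trans (cabs_Im _); rewrite ler_normr /=; apply/orP; left; lra.
Qed.

(* Expand [1 / (z - c - h)] into a finite geometric series inside Cauchy's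
   formula over the square of half-side [r] centred at [c]. *)
Lemma power_series_square f (c : R[i]) (r : R) : 0 < r ->
  diff_on_rect f (cRe c - r) (cRe c + r) (cIm c - r) (cIm c + r) ->
  exists (a : nat -> R[i]) (M : R), 0 <= M /\
  forall h N, cabs h < r ->
    cabs (f (c + h) - \sum_(n < N) a n * h ^+ n)
      <= M * (cabs h / r) ^+ N / (r - cabs h).
Proof.
case: c => c1 c2 /= r0 df; set c := c1 +i* c2.
have W0 := winding_neq0.
have W0' : 0 < cabs winding by rewrite cabs_gt0.
have x12 : c1 - r <= c1 + r by lra.
have y12 : c2 - r <= c2 + r by lra.
have [M M0 HM] := rect_bd_bounded x12 y12 (diff_rect_bd df).
pose k n z := f z * (z - c)^-1 ^+ n.
pose I (g : R[i] -> R[i]) := rect g (c1 - r) (c1 + r) (c2 - r) (c2 + r).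
pose a n := winding^-1 * I (k n.+1).
(* [rect_bound] on this square contributes the factor [4 * (2 * r + 2 * r)], hence [16 * r * M]
   before the division by [winding]. *)
exists a, (8 * r * M / cabs winding * 2); split.
  by rewrite mulr_ge0 // divr_ge0 ?cabs_ge0 // mulr_ge0 // mulr_ge0 // ltW.
move=> h N hr; set b := c + h.
have bd_c x y : [|| x == c1 - r, x == c1 + r, y == c2 - r | y == c2 + r] ->
    r <= cabs ((x +i* y) - c) by move=> H; exact: cabs_bd_center.
have bd_b x y : [|| x == c1 - r, x == c1 + r, y == c2 - r | y == c2 + r] ->
    r - cabs h <= cabs ((x +i* y) - b).
  move=> /bd_c H; have := cabsD ((x +i* y) - b) h.
  have -> : (x +i* y) - b + h = (x +i* y) - c by rewrite /b; ring.
  lra.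
have neq_c z : r <= cabs (z - c) -> z != c.
  by move=> H; rewrite -subr_eq0 -cabs_gt0; apply: lt_le_trans H.
have neq_b z : r - cabs h <= cabs (z - b) -> z != b.
  by move=> H; rewrite -subr_eq0 -cabs_gt0; apply: lt_le_trans H; lra.
have cdX (g : R[i] -> R[i]) z d n : cdiff g z d -> exists d', cdiff (fun z => g z ^+ n) z d'.
  move=> H; elim: n => [|n [d' IH]]; first by exists 0; exact: cdiff_cst.
  eexists; have -> : (fun z => g z ^+ n.+1) = (fun z => g z * g z ^+ n).
    by apply/funext => u; rewrite exprS.
  exact: cdiffM H IH.
have dk n : diff_on_bd (k n) (c1 - r) (c1 + r) (c2 - r) (c2 + r).
  move=> x y hx hy /bd_c/neq_c hc; have [d Hd] := df x y hx hy.
  have [d' Hd'] := cdX _ _ _ n (cdiff_sub_inv hc).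
  by eexists; exact: cdiffM Hd Hd'.
have dR n : diff_on_bd (fun z => k n z * (z - b)^-1) (c1 - r) (c1 + r) (c2 - r) (c2 + r).
  move=> x y hx hy hxy; have hb := neq_b _ (bd_b _ _ hxy).
  have [d Hd] := dk n x y hx hy hxy.
  by eexists; exact: cdiffM Hd (cdiff_sub_inv hb).
have main : winding * f b = \sum_(n < N) h ^+ n * I (k n.+1)
    + h ^+ N * I (fun z => k N z * (z - b)^-1).
  elim: N => [|N IH].
    rewrite big_ord0 add0r expr0 mul1r.
    have hR := cabs_Re h; have hI := cabs_Im h; move: hR hI; rewrite !ler_norml => hR hI.
    have := @Cauchy_formula f (c1 - r) (c1 + r) (c2 - r) (c2 + r) (c1 + cRe h) (c2 + cIm h).
    have -> : (c1 + cRe h) +i* (c2 + cIm h) = b by rewrite /b /c; case: (h).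
    move=> <- //; [|lra|lra].
    by apply: rect_ext => // x y _ _ _; rewrite /k expr0 mulr1.
  rewrite IH big_ord_recr /= -addrA; congr (_ + _).
  have -> : I (fun z => k N z * (z - b)^-1) =
      I (fun z => k N.+1 z + h * (k N.+1 z * (z - b)^-1)).
    apply: rect_ext => // x y _ _ hxy.
    have hc := neq_c _ (bd_c _ _ hxy); have hb := neq_b _ (bd_b _ _ hxy).
    set z := x +i* y in hc hb *; rewrite /k exprSr.
    have hc' : z - c != 0 by rewrite subr_eq0.
    have hb' : z - b != 0 by rewrite subr_eq0.
    have E : (z - b)^-1 = (z - c)^-1 + h * ((z - c)^-1 * (z - b)^-1).
      have -> : h = (z - c) - (z - b) by rewrite /b; ring.
      by field; rewrite hc' hb'.
    by rewrite {1}E; ring.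
  rewrite /I rectD //; last first.
    move=> x y hx hy hxy; have [d Hd] := dR N.+1 x y hx hy hxy.
    by eexists; apply: cdiffM Hd; exact: cdiff_cst.
  by rewrite rectZ // mulrDr exprSr mulrA.
have -> : f b - \sum_(n < N) a n * h ^+ n = winding^-1 * (h ^+ N * I (fun z => k N z * (z - b)^-1)).
  have -> : \sum_(n < N) a n * h ^+ n = winding^-1 * \sum_(n < N) h ^+ n * I (k n.+1).
    by rewrite mulr_sumr; apply: eq_bigr => n _; rewrite /a; ring.
  by rewrite -[f b](mulKf W0) main; ring.
have rh : 0 < r - cabs h by lra.
have IB : cabs (I (fun z => k N z * (z - b)^-1)) <=
    4 * (M * r^-1 ^+ N / (r - cabs h)) * ((c1 + r - (c1 - r)) + (c2 + r - (c2 - r))).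
  apply: rect_bound => // x y hx hy hxy.
  rewrite /k !cabsM cabsX !cabsV; have hc := bd_c _ _ hxy; have hb := bd_b _ _ hxy.
  apply: ler_pM; rewrite ?mulr_ge0 ?exprn_ge0 ?invr_ge0 ?cabs_ge0 //.
    apply: ler_pM; rewrite ?exprn_ge0 ?invr_ge0 ?cabs_ge0 ?HM //.
    apply: lerXn2r; rewrite ?nnegrE ?invr_ge0 ?cabs_ge0 ?(ltW r0) //.
    by rewrite lef_pV2 ?posrE //; exact: lt_le_trans hc.
  by rewrite lef_pV2 ?posrE //; exact: lt_le_trans hb.
rewrite !cabsM cabsV cabsX.
apply: le_trans (ler_wpM2l _ (ler_wpM2l _ IB)) _.
- by rewrite invr_ge0 cabs_ge0.
- by rewrite exprn_ge0 // cabs_ge0.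
rewrite le_eqVlt; apply/orP; left; apply/eqP; rewrite !exprMn exprVn.
by field; rewrite !gt_eqF // exprn_gt0.
Qed.

End Cauchy.

(** * Power series with alternating coefficients *)

Section RealTaylor.
Variable R : realType.
Implicit Types (u du g : R -> R) (a b x h : R).

Lemma le_of_eq (a b : R) : a = b -> a <= b.
Proof. by move=> ->. Qed.

Lemma mean_value u du a b : a < b ->
  (forall t, a <= t <= b -> is_derive t (1 : R) u (du t)) ->
  exists2 c, a <= c <= b & u b - u a = du c * (b - a).
Proof.
move=> ab dfu; have [| |c] := @MVT R u du a b ab.
- by move=> t; rewrite in_itv /= => /andP[ta tb]; apply: dfu; rewrite !ltW.
- apply: continuous_in_subspaceT => t /[!inE]/=; rewrite in_itv /= => /dfu [dt _].
  exact/differentiable_continuous/derivable1_diffP.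
- by rewrite in_itv /= => /andP[ca cb] E; exists c => //; rewrite !ltW.
Qed.

Lemma mean_bound u du a b K :
  (forall t, Num.min a b <= t <= Num.max a b -> is_derive t (1 : R) u (du t)) ->
  (forall t, Num.min a b <= t <= Num.max a b -> `|du t| <= K) ->
  `|u b - u a| <= K * `|b - a|.
Proof.
suff H x y : x < y -> (forall t, x <= t <= y -> is_derive t (1 : R) u (du t)) ->
    (forall t, x <= t <= y -> `|du t| <= K) -> `|u y - u x| <= K * `|y - x|.
  have [ab|ba|->] := ltgtP a b; first exact: H.
    by move=> H1 H2; rewrite distrC (distrC b); exact: H.
  by rewrite !subrr normr0 mulr0.
move=> xy H1 H2; have [c /H2 cK ->] := mean_value xy H1.
by rewrite normrM ler_wpM2r.
Qed.

Lemma is_derive_shift u x a d : is_derive (a + x) (1 : R) u d ->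
  is_derive x (1 : R) (fun t => u (a + t)) d.
Proof.
move=> H; have := @is_derive1_comp R u (fun t => a + t) x d 1 H.
rewrite mulr1; apply; apply: is_derive_eq.
by rewrite mulr1 add0r.
Qed.

Lemma is_derive_monomial (c : R) n x :
  is_derive x (1 : R) (fun t => c * t ^+ n) (c * (n%:R * x ^+ n.-1)).
Proof.
have -> : (fun t : R => c * t ^+ n) = c *: ((id : R -> R) ^+ n : R -> R).
  by apply/funext => t; rewrite -[RHS]/(c * (id ^+ n) t) exprfctE.
have H := @is_deriveZ R R R ((id : R -> R) ^+ n) c x 1 _ (is_deriveX n (is_derive_id x (1 : R))).
apply: is_derive_eq H _ => /=.
by rewrite -[_ *: 1]/(_ * 1) mulr1.
Qed.

Lemma is_derive_poly (c : nat -> R) N x :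
  is_derive x (1 : R) (fun t => \sum_(n < N.+1) c n * t ^+ n)
    (\sum_(n < N) c n.+1 * (n.+1)%:R * x ^+ n).
Proof.
elim: N => [|N IH].
  rewrite big_ord0; have -> : (fun t : R => \sum_(n < 1) c n * t ^+ n) = cst (c 0%N).
    by apply/funext => t; rewrite big_ord1 expr0 mulr1.
  exact: is_derive_cst.
have -> : (fun t : R => \sum_(n < N.+2) c n * t ^+ n) =
  (fun t : R => \sum_(n < N.+1) c n * t ^+ n) + (fun t => c N.+1 * t ^+ N.+1).
  by apply/funext => t; rewrite big_ord_recr.
rewrite big_ord_recr /=.
have := is_deriveD IH (is_derive_monomial (c N.+1) N.+1 x).
by rewrite /= mulrA.
Qed.

Definition smooth_pos g := forall n x, 0 < x -> derivable (derive1n n g) x 1.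

Lemma smooth_is_derive g n x : smooth_pos g -> 0 < x ->
  is_derive x (1 : R) (derive1n n g) (derive1n n.+1 g x).
Proof. by move=> sg x0; rewrite derive1nS derive1E; exact/derivableP/sg. Qed.

Lemma smooth_derive1 g : smooth_pos g -> smooth_pos (g^`()%classic).
Proof. by move=> sg n x x0; rewrite -derive1Sn; exact: sg. Qed.

Definition taylor_coef g x n : R := derive1n n g x / n`!%:R.

(** Induction on [N]: the derivative of the remainder of order [N.+1] is the remainder of order [N]
    of the derivative of [g], so the mean value bound gains one power of [|h|]. The radius stays
    below [x] so that [x + t] remains positive. *)
Lemma Taylor_Peano g x N : smooth_pos g -> 0 < x ->
  exists C r, [/\ 0 <= C, 0 < r & forall h, `|h| < r ->
    `|g (x + h) - \sum_(n < N) taylor_coef g x n * h ^+ n| <= C * `|h| ^+ N].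
Proof.
move=> sg x0; elim: N g sg => [|N IH] g sg.
  have cg : {for x, continuous g}.
    exact/differentiable_continuous/derivable1_diffP/(sg 0%N).
  have /cvgrPdist_lt /(_ 1 ltr01) [r /= r0 H] := cg.
  exists (`|g x| + 1), r; split => //.
  move=> h hr; rewrite big_ord0 subr0 expr0 mulr1.
  have := H (x + h); rewrite /ball /= opprD addrA subrr add0r normrN => /(_ hr).
  have := ler_normB (g x) (g x - g (x + h)).
  have -> : g x - (g x - g (x + h)) = g (x + h) by ring.
  lra.
have [C [r [C0 r0 H]]] := IH _ (smooth_derive1 sg).
exists C, (Num.min r x); split; rewrite ?lt_min ?r0 // => h.
rewrite lt_min => /andP[hr hx].
pose phi t := g (x + t) - \sum_(n < N.+1) taylor_coef g x n * t ^+ n.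
pose dphi t := g^`()%classic (x + t) - \sum_(n < N) taylor_coef g^`()%classic x n * t ^+ n.
have phi0 : phi 0 = 0.
  rewrite /phi addr0 big_ord_recl /= expr0 mulr1 /taylor_coef /= fact0 divr1.
  by rewrite big1 ?addr0 ?subrr // => i _; rewrite expr0n /= mulr0.
have tint t : Num.min 0 h <= t <= Num.max 0 h -> `|t| <= `|h|.
  by case: (leP 0 h) => h0 /andP[t1 t2]; rewrite ler_norml ?(ger0_norm h0) ?(ltr0_norm h0) /=; apply/andP; split; lra.
have dphiP t : Num.min 0 h <= t <= Num.max 0 h -> is_derive t (1 : R) phi (dphi t).
  move=> /tint th; have xt : 0 < x + t.
    by move: (le_lt_trans th hx); rewrite ltr_norml; lra.
  apply: is_derive_eq (is_deriveB (is_derive_shift (smooth_is_derive 0 sg xt)) (is_derive_poly (taylor_coef g x) N t)) _.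
  rewrite /dphi derive1n1; congr (_ - _); apply: eq_bigr => n _; congr (_ * _).
  rewrite /taylor_coef -derive1Sn factS natrM invfM (mulrC _^-1) mulrA divfK //.
have := @mean_bound phi dphi 0 h (C * `|h| ^+ N) dphiP.
rewrite phi0 !subr0 exprSr mulrA; apply => t /tint th.
apply: le_trans (H t (le_lt_trans th hr)) _.
by rewrite ler_wpM2l // lerXn2r // nnegrE.
Qed.

(** Uniqueness of asymptotic expansions at 0 from the right: once the lower coefficients vanish, the
    bound of order [n.+1] divided by [h ^+ n] forces [d n = 0]. *)
Lemma coef_eq0_of_bigO (d : nat -> R) :
  (forall N, exists C r, [/\ 0 <= C, 0 < r & forall h, 0 < h < r ->
     `|\sum_(n < N) d n * h ^+ n| <= C * h ^+ N]) -> forall n, d n = 0.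
Proof.
move=> H; elim/ltn_ind => n IH.
have [C [r [C0 r0 K]]] := H n.+1.
apply/eqP; rewrite -normr_eq0; apply/eqP/le_anti; rewrite normr_ge0 andbT.
apply/ler_addgt0Pl => e e0; rewrite addr0.
pose h := Num.min (r / 2) (e / (C + 1)).
have h0 : 0 < h by rewrite lt_min !divr_gt0 //; lra.
have hr : h < r.
  have : h <= r / 2 by rewrite ge_min lexx.
  lra.
have he : h * (C + 1) <= e.
  by rewrite -ler_pdivlMr; [rewrite ge_min lexx orbT|lra].
have := K h; rewrite h0 hr => /(_ isT).
rewrite big_ord_recr /= big1 ?add0r; last first.
  by move=> i _; rewrite IH ?mul0r.
rewrite normrM (ger0_norm (exprn_ge0 n (ltW h0))) exprSr mulrA mulrAC.
rewrite ler_pM2r ?exprn_gt0 //; nra.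
Qed.

Lemma cvg_geometric_le (M q e : R) : 0 <= q < 1 -> 0 <= M -> 0 < e ->
  exists N0, forall N, (N0 <= N)%N -> M * q ^+ N < e.
Proof.
move=> /andP[q0 q1] M0 e0; have qn : `|q| < 1 by rewrite ger0_norm.
have /cvgrPdist_lt /(_ (e / (M + 1))) := cvg_expr qn.
rewrite divr_gt0 ?ltr_wpDl // => /(_ isT) [N0 _ H].
exists N0 => N /H /=; rewrite sub0r normrN ger0_norm ?exprn_ge0 //.
rewrite ltr_pdivlMr ?ltr_wpDl // => h; have := exprn_ge0 N q0; nra.
Qed.

End RealTaylor.

Section PowerSeries.
Variable R : realType.
Implicit Types (f u : R[i] -> R[i]) (c : nat -> R) (x : R) (h k z w : R[i]).

Definition psum c N h : R[i] := \sum_(n < N) (c n)%:C * h ^+ n.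

Definition is_psum c h (s : R[i]) := forall e : R, 0 < e ->
  exists N0, forall N, (N0 <= N)%N -> cabs (s - psum c N h) < e.

Lemma psum_real c N (x : R) : psum c N x%:C = (\sum_(n < N) c n * x ^+ n)%:C.
Proof.
by rewrite /psum rmorph_sum; apply: eq_bigr => n _; rewrite rmorphM rmorphXn.
Qed.

Lemma Re_sum N (F : 'I_N -> R[i]) : cRe (\sum_(n < N) F n) = \sum_(n < N) cRe (F n).
Proof.
by elim: N F => [|N IH] F; rewrite ?big_ord0 // !big_ord_recr /= ReD IH.
Qed.

Lemma Im_sum N (F : 'I_N -> R[i]) : cIm (\sum_(n < N) F n) = \sum_(n < N) cIm (F n).
Proof.
by elim: N F => [|N IH] F; rewrite ?big_ord0 // !big_ord_recr /= ImD IH.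
Qed.

(** For [r] strictly between [cabs h] and [x], the square of half-side [r] centred at [x] lies in
    the half-plane and gives a convergent expansion; it remains to recognize its coefficients from
    the values of [f] on the axis. *)
Theorem half_plane_Taylor f x h :
  (forall z, right_half_plane z -> exists d, cdiff f z d) ->
  (forall y : R, 0 < y -> cIm (f y%:C) = 0) ->
  smooth_pos (real_restr f) -> 0 < x -> cabs h < x ->
  is_psum (taylor_coef (real_restr f) x) h (f (x%:C + h)).
Proof.
move=> df If sg x0 hx; set g := real_restr f in sg *.
have h0 := cabs_ge0 h.
have [r [r0 rx hr]] : exists r, [/\ 0 < r, r < x & cabs h < r].
  by exists ((x + cabs h) / 2); split; lra.
have [|a [M [M0 HM]]] := @power_series_square R f x%:C r r0.
  by move=> u v /= hu hv; apply: df; rewrite /right_half_plane /=; lra.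
(* Staying below [r / 2] keeps the denominator [r - t] away from 0, so the error is [O(t ^+ N)] with
   a fixed constant. *)
pose rho := r / 2.
have small (t : R) N : 0 < t < rho ->
    cabs (f (x + t)%:C - \sum_(n < N) a n * t%:C ^+ n) <= M / r ^+ N / (r - rho) * t ^+ N.
  move=> /andP[t0 tr]; have tn : cabs t%:C = t by rewrite cabs_real ger0_norm // ltW.
  have := HM t%:C N; rewrite tn -rmorphD => /(_ _)H.
  apply: le_trans (H _) _; first by rewrite /rho in tr; lra.
  have -> : M / r ^+ N / (r - rho) * t ^+ N = M * (t / r) ^+ N / (r - rho).
    by rewrite exprMn exprVn; ring.
  apply: ler_wpM2l; first by rewrite mulr_ge0 // exprn_ge0 // divr_ge0 ?ltW.
  have rr : rho < r by rewrite /rho; lra.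
  by rewrite lef_pV2 ?posrE; lra.
(* On the axis [f] is real: the imaginary parts of the [a n] expand the function 0, and their real
   parts expand [g (x + t)], just as the Taylor coefficients do. *)
have aE n : a n = (taylor_coef g x n)%:C.
  have E1 : cIm (a n) = 0.
    move: n; apply: coef_eq0_of_bigO => N; exists (M / r ^+ N / (r - rho)), rho; split.
    - by rewrite !mulr_ge0 ?invr_ge0 ?exprn_ge0 // ?ltW // /rho; lra.
    - by rewrite /rho; lra.
    - move=> t tr; apply: le_trans (small _ N tr).
      apply: le_trans (cabs_Im _); rewrite ImD ImN Im_sum If; last by move: tr; lra.
      rewrite sub0r normrN; apply: le_of_eq; congr `|_|; apply: eq_bigr => i _.
      by rewrite -rmorphXn ImM /= mulr0 add0r mulrC.
  have E2 : cRe (a n) - taylor_coef g x n = 0.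
    move: n {E1}; apply: coef_eq0_of_bigO => N.
    have [C [s [C0 s0 HT]]] := Taylor_Peano N sg x0.
    exists (M / r ^+ N / (r - rho) + C), (Num.min s rho); split.
    - by rewrite addr_ge0 // !mulr_ge0 ?invr_ge0 ?exprn_ge0 // ?ltW // /rho; lra.
    - by rewrite lt_min s0 /rho; lra.
    - move=> t; rewrite lt_min => /and3P[t0 ts tr].
      have := small t N; rewrite t0 tr => /(_ isT) H1.
      have := HT t; rewrite (ger0_norm (ltW t0)) => /(_ ts) H2.
      have {}H1 := le_trans (cabs_Re _) H1.
      rewrite ReD ReN Re_sum in H1.
      have E : \sum_(n < N) (cRe (a n) - taylor_coef g x n) * t ^+ n =
        (g (x + t) - \sum_(n < N) taylor_coef g x n * t ^+ n) -
        (cRe (f (x + t)%:C) - \sum_(n < N) cRe (a n * t%:C ^+ n)).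
        have -> : \sum_(n < N) cRe (a n * t%:C ^+ n) = \sum_(n < N) cRe (a n) * t ^+ n.
          by apply: eq_bigr => i _; rewrite -rmorphXn ReM /= mulr0 subr0.
        have -> : \sum_(n < N) (cRe (a n) - taylor_coef g x n) * t ^+ n =
          \sum_(n < N) cRe (a n) * t ^+ n - \sum_(n < N) taylor_coef g x n * t ^+ n.
          by rewrite -sumrB; apply: eq_bigr => i _; rewrite mulrBl.
        rewrite /g /real_restr; ring.
      rewrite E; apply: le_trans (ler_normB _ _) _; rewrite mulrDl addrC.
      exact: lerD.
  by rewrite (complex_ReIm (a n)) E1; congr (_ +i* _); lra.
move=> e e0.
have q01 : 0 <= cabs h / r < 1 by rewrite divr_ge0 ?ltr_pdivrMr //; lra.
have [|N0 HN0] := @cvg_geometric_le _ (M / (r - cabs h)) _ _ q01 _ e0.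
  by rewrite divr_ge0 //; lra.
exists N0 => N /HN0 HN; apply: le_lt_trans HN.
have := HM h N hr; rewrite /psum.
under eq_bigr do rewrite aE.
move=> H; apply: le_trans H _; apply: le_of_eq; ring.
Qed.

(** Up to the factors [h - k] and [s - r], this compares the sums of [h ^+ i * k ^+ j] and of
    [s ^+ i * r ^+ j] over [i + j = n - 1], term by term. *)
Lemma cabs_powB h k (r s : R) n : cabs h <= r -> cabs k <= r -> r < s ->
  cabs (h ^+ n - k ^+ n) * (s - r) <= cabs (h - k) * (s ^+ n - r ^+ n).
Proof.
move=> hr kr rs; have r0 : 0 <= r by apply: le_trans hr; exact: cabs_ge0.
have s0 : 0 <= s by lra.
elim: n => [|n IH]; first by rewrite !expr0 !subrr cabs0 mul0r mulr0.
have -> : h ^+ n.+1 - k ^+ n.+1 = h * (h ^+ n - k ^+ n) + (h - k) * k ^+ n.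
  by rewrite !exprS; ring.
have -> : s ^+ n.+1 - r ^+ n.+1 = s * (s ^+ n - r ^+ n) + (s - r) * r ^+ n.
  by rewrite !exprS; ring.
apply: le_trans (ler_wpM2r _ (cabsD _ _)) _; first by lra.
rewrite !cabsM cabsX [X in X <= _]mulrDl [X in _ <= X]mulrDr lerD //.
  rewrite -mulrA mulrCA [X in _ <= X]mulrCA; apply: le_trans (_ : s * (cabs (h ^+ n - k ^+ n) * (s - r)) <= _).
    rewrite mulrCA; apply: ler_wpM2r; last by lra.
    by rewrite mulr_ge0 ?cabs_ge0; lra.
  by rewrite ler_wpM2l.
rewrite -mulrA ler_wpM2l ?cabs_ge0 // mulrC ler_wpM2l; first by [].
  by lra.
by rewrite lerXn2r ?nnegrE ?cabs_ge0.
Qed.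

Section AlternatingCoefficients.
Variables (c : nat -> R) (u : R[i] -> R[i]) (x : R).
Hypothesis c_alt : forall n, (0 < n)%N -> 0 <= (-1) ^+ n.+1 * c n.
Hypothesis u_psum : forall h, cabs h < x -> is_psum c h (u h).

Lemma alt_norm n : (0 < n)%N -> `|c n| = (-1) ^+ n.+1 * c n.
Proof. by move=> /c_alt/ger0_norm <-; rewrite normrM normrX normrN1 expr1n mul1r. Qed.

Lemma alt_termE n (r s : R) :
  `|c n| * (s ^+ n - r ^+ n) = c n * ((- r) ^+ n - (- s) ^+ n).
Proof.
case: n => [|n]; first by rewrite !expr0 !subrr !mulr0.
rewrite alt_norm // [(- r) ^+ _]exprNn [(- s) ^+ _]exprNn exprS; ring.
Qed.

(* By [alt_termE] the termwise bounds on [h ^+ n - k ^+ n] add up to a difference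
   of values at two negative reals. *)
Lemma alt_psumB N h k (r s : R) : cabs h <= r -> cabs k <= r -> r < s ->
  cabs (psum c N h - psum c N k) * (s - r) <=
  cabs (h - k) * (cRe (psum c N (- r)%:C) - cRe (psum c N (- s)%:C)).
Proof.
move=> hr kr rs.
have -> : cRe (psum c N (- r)%:C) - cRe (psum c N (- s)%:C) =
    \sum_(n < N) (c n * (- r) ^+ n - c n * (- s) ^+ n).
  by rewrite !psum_real sumrB.
rewrite mulr_sumr /psum -sumrB.
apply: le_trans (ler_wpM2r _ (cabs_sum _)) _; first by lra.
rewrite mulr_suml; apply: ler_sum => n _.
rewrite -!mulrBr cabsM cabs_real -mulrA -alt_termE [X in _ <= X]mulrCA.
by apply: ler_wpM2l; rewrite ?normr_ge0 // cabs_powB.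
Qed.

(** [alt_psumB] in the limit [N -> oo]: a bound on the slopes of [u] along the negative real radius
    becomes a Lipschitz constant on the whole disc. *)
Lemma alt_lipschitz (L : R) h k :
  (forall r s : R, 0 <= r -> r < s -> s < x ->
     cRe (u (- r)%:C) - cRe (u (- s)%:C) <= L * (s - r)) ->
  cabs h < x -> cabs k < x -> cabs (u h - u k) <= L * cabs (h - k).
Proof.
move=> uL hx kx; pose r := Num.max (cabs h) (cabs k).
have hr : cabs h <= r by rewrite le_max lexx.
have kr : cabs k <= r by rewrite le_max lexx orbT.
have rx : r < x by rewrite gt_max hx.
have r0 : 0 <= r by apply: le_trans hr; exact: cabs_ge0.
(* Any [s] between [r] and [x] would do: the factor [s - r] cancels. *)
pose s := (r + x) / 2; have rs : r < s by rewrite /s; lra.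
have sx : s < x by rewrite /s; lra.
suff : cabs (u h - u k) * (s - r) <= L * cabs (h - k) * (s - r).
  by rewrite ler_pM2r // subr_gt0.
have rx' : cabs (- r)%:C < x by rewrite cabs_real normrN ger0_norm.
have sx' : cabs (- s)%:C < x by rewrite cabs_real normrN ger0_norm; lra.
apply/ler_addgt0Pr => e e0.
(* Two truncation errors are multiplied by [s - r], the other two by [cabs (h - k)]; with accuracy
   [e / K] they total at most [e]. *)
pose K := 2 * (s - r) + 2 * cabs (h - k) + 1.
have K0 : 0 < K by have := cabs_ge0 (h - k); rewrite /K; lra.
have eK : 0 < e / K by rewrite divr_gt0.
have [N1 H1] := u_psum hx eK; have [N2 H2] := u_psum kx eK.
have [N3 H3] := u_psum rx' eK; have [N4 H4] := u_psum sx' eK.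
pose N := maxn (maxn N1 N2) (maxn N3 N4).
have := alt_psumB N hr kr rs.
have {H1} := H1 N (leq_trans (leq_maxl _ _) (leq_maxl _ _)).
have {H2} := H2 N (leq_trans (leq_maxr _ _) (leq_maxl _ _)).
have {H3} := H3 N (leq_trans (leq_maxl _ _) (leq_maxr _ _)).
have {H4} := H4 N (leq_trans (leq_maxr _ _) (leq_maxr _ _)).
move: (psum c N h) (psum c N k) (psum c N _) (psum c N _) => p1 p2 p3 p4.
move=> /(le_lt_trans (cabs_Re _)); rewrite ReD ReN ltr_norml => /andP[a1 a2].
move=> /(le_lt_trans (cabs_Re _)); rewrite ReD ReN ltr_norml => /andP[a3 a4] a5 a6 a7.
have b1 : cabs (u h - u k) <= cabs (p1 - p2) + 2 * (e / K).
  have -> : u h - u k = (p1 - p2) + (u h - p1) - (u k - p2) by ring.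
  by apply: le_trans (cabsB _ _) _; have := cabsD (p1 - p2) (u h - p1); lra.
have b2 : cRe p3 - cRe p4 <= L * (s - r) + 2 * (e / K).
  by have := uL _ _ r0 rs sx; lra.
have sr : 0 < s - r by lra.
have c0 := cabs_ge0 (h - k).
apply: le_trans (ler_wpM2r (ltW sr) b1) _; rewrite mulrDl.
apply: le_trans (lerD a7 (lexx _)) _.
apply: le_trans (lerD (ler_wpM2l c0 b2) (lexx _)) _.
have : e / K * K = e by rewrite divfK // gt_eqF.
rewrite {2}/K; nra.
Qed.

(** For [n >= 1] the real part of [c n * h ^+ n] is at least [- |c n| * cabs h ^+ n], which by
    alternation is the term at [- cabs h]. *)
Lemma alt_Re_ge h : cabs h < x -> cRe (u (- cabs h)%:C) <= cRe (u h).
Proof.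
move=> hx; have hx' : cabs (- cabs h)%:C < x.
  by rewrite cabs_real normrN ger0_norm // cabs_ge0.
apply/ler_addgt0Pr => e e0; have e20 : 0 < e / 2 by lra.
have [N1 H1] := u_psum hx e20; have [N2 H2] := u_psum hx' e20.
have {H1} := H1 _ (leq_maxl N1 N2); have {H2} := H2 _ (leq_maxr N1 N2).
move=> /(le_lt_trans (cabs_Re _)); rewrite ReD ReN ltr_norml => /andP[a1 a2].
move=> /(le_lt_trans (cabs_Re _)); rewrite ReD ReN ltr_norml => /andP[a3 a4].
suff : cRe (psum c (maxn N1 N2) (- cabs h)%:C) <= cRe (psum c (maxn N1 N2) h) by lra.
rewrite psum_real /= /psum Re_sum; apply: ler_sum => n _.
rewrite ReM /= mul0r subr0; case: (nat_of_ord n) => [|m]; first by rewrite !expr0.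
rewrite -subr_ge0 -mulrBr exprNn.
have cN := alt_norm (ltn0Sn m).
have : `|cRe (h ^+ m.+1)| <= cabs h ^+ m.+1 by rewrite -cabsX cabs_Re.
rewrite ler_norml => /andP[d1 d2].
have := normr_ge0 (c m.+1).
case/boolP: (odd m) cN => om; rewrite -signr_odd -(signr_odd _ m.+1) /= om /= ?expr0 ?expr1 ?mul1r ?mulN1r;
  move=> -> ?; nra.
Qed.

End AlternatingCoefficients.

Lemma cabs_sub_real_lt z (x : R) : 0 < x -> cRe z ^+ 2 + cIm z ^+ 2 < 2 * cRe z * x ->
  cabs (z - x%:C) < x.
Proof.
move=> x0 H; rewrite -[X in _ < X](ger0_norm (ltW x0)) -sqrtr_sqr.
case: z H => a b /= H; rewrite /Normc.normc /= ltr_sqrt ?exprn_gt0 //.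
rewrite subr0; nra.
Qed.

(** [|z - x| < x] amounts to [|z|^2 < 2 x Re z], true for all large [x]; the witness adds the two
    thresholds [|z|^2 / Re z] and [|w|^2 / Re w]. *)
Lemma two_points_disc z w : right_half_plane z -> right_half_plane w ->
  exists2 x : R, 0 < x & cabs (z - x%:C) < x /\ cabs (w - x%:C) < x.
Proof.
rewrite /right_half_plane /= => z0 w0.
pose A := cRe z ^+ 2 + cIm z ^+ 2; pose B := cRe w ^+ 2 + cIm w ^+ 2.
have A0 : 0 <= A by rewrite addr_ge0 ?sqr_ge0.
have B0 : 0 <= B by rewrite addr_ge0 ?sqr_ge0.
pose x := 1 + A / cRe z + B / cRe w.
have Az : 0 <= A / cRe z by rewrite divr_ge0 // ltW.
have Bw : 0 <= B / cRe w by rewrite divr_ge0 // ltW.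
have x0 : 0 < x by rewrite /x; lra.
have E1 : A = A / cRe z * cRe z by rewrite divfK // gt_eqF.
have E2 : B = B / cRe w * cRe w by rewrite divfK // gt_eqF.
exists x => //; split; apply: cabs_sub_real_lt => //.
  rewrite -/A {1}E1 /x; nra.
rewrite -/B {1}E2 /x; nra.
Qed.

End PowerSeries.

Section EpsilonDerivative.
Variable R : realType.

Lemma is_derive_eps (u : R -> R) (x d : R) :
  (forall e : R, 0 < e -> exists2 r : R, 0 < r & forall h, `|h| < r ->
     `|u (x + h) - u x - d * h| <= e * `|h|) -> is_derive x (1 : R) u d.
Proof.
move=> H.
have cv : (fun h => h^-1 *: ((u \o shift x) (h *: (1 : R)) - u x)) @ 0^' --> d.
  apply/cvgrPdist_le => e e0; have [r r0 K] := H e e0.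
  exists r => //= h; rewrite /ball /= sub0r normrN => hr h0.
  have := K h hr; rewrite -ler_pdivrMr ?normr_gt0 // -normfV -normrM.
  apply: le_trans; apply: le_of_eq; rewrite -normrN; congr (`|_|).
  rewrite -[h *: 1]/(h * 1) mulr1 -[_ *: _]/(_ * _) (addrC h x); field.
  exact: h0.
have dv : derivable u x 1 by apply/cvg_ex; exists d.
by apply: DeriveDef => //; exact: cvg_lim cv.
Qed.

(** [p] stands for the real or the imaginary part: a real-linear map of norm at most 1 suffices for
    the chain rule along a ray. *)
Lemma cdiff_ray (f : R[i] -> R[i]) (z d : R[i]) (t0 : R) (p : R[i] -> R) :
  (forall x y, p (x + y) = p x + p y) -> (forall x, p (- x) = - p x) ->
  (forall (r : R) x, p (r%:C * x) = r * p x) ->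
  (forall x, `|p x| <= cabs x) ->
  cdiff f (t0%:C * z) d ->
  is_derive t0 (1 : R) (fun t => p (f (t%:C * z))) (p (d * z)).
Proof.
move=> pD pN pZ pb H; apply: is_derive_eps => e e0.
have z0 := cabs_ge0 z.
have e'0 : 0 < e / (cabs z + 1) by rewrite divr_gt0 //; lra.
have [r r0 K] := H _ e'0; exists (r / (cabs z + 1)).
  by rewrite divr_gt0 //; lra.
move=> h; rewrite ltr_pdivlMr; last by lra.
move=> hr; have hz : cabs (h%:C * z) <= `|h| * (cabs z + 1).
  by rewrite cabsM cabs_real ler_wpM2l // lerDl.
have := K _ (le_lt_trans hz hr).
have -> : t0%:C * z + h%:C * z = (t0 + h)%:C * z by rewrite rmorphD mulrDl.
move=> /(le_trans (pb _)); rewrite !pD !pN.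
have -> : d * (h%:C * z) = h%:C * (d * z) by ring.
rewrite pZ (mulrC h) => K'; apply: le_trans K' _.
apply: le_trans (ler_wpM2l (ltW e'0) hz) _.
by apply: le_of_eq; field; rewrite gt_eqF //; lra.
Qed.

End EpsilonDerivative.

(** * Bernstein functions on the half-plane *)

Section BernsteinFunctions.
Variables (R : realType) (f : R[i] -> R[i]).
Hypothesis hf : BF f.
Implicit Types (x y s t : R) (z w h d : R[i]).

Let g : R -> R := real_restr f.

Lemma BF_cdiff z : right_half_plane z -> exists d, cdiff f z d.
Proof. by case: hf => [[H _] _ _ _] /H; exact: derivable_cdiff. Qed.

Lemma BF_real x : 0 < x -> f x%:C = (g x)%:C.
Proof.
by case: hf => [_ H _ _] /H Hx; rewrite [LHS]complex_ReIm Hx.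
Qed.

Lemma BF_smooth : smooth_pos g.
Proof. by case: hf => _ _ [_ H _] _ n x; exact: H. Qed.

Lemma BF_sign n x : (0 < n)%N -> 0 < x -> 0 <= (-1) ^+ n.+1 * derive1n n g x.
Proof. by case: hf => _ _ [_ _ H] _; exact: H. Qed.

Lemma BF_derive1_ge0 x : 0 < x -> 0 <= derive1n 1 g x.
Proof. by move=> x0; have := BF_sign (ltn0Sn 0) x0; rewrite sqrrN expr1n mul1r. Qed.

Lemma BF_derive2_le0 x : 0 < x -> derive1n 2 g x <= 0.
Proof.
move=> x0; have := BF_sign (ltn0Sn 1) x0.
by rewrite exprS sqrrN expr1n mulr1 mulN1r oppr_ge0.
Qed.

Lemma BF_derive3_ge0 x : 0 < x -> 0 <= derive1n 3 g x.
Proof.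
by move=> x0; have := BF_sign (ltn0Sn 2) x0; rewrite -signr_odd mul1r.
Qed.

Lemma BF_mean_value n x y : 0 < x -> x < y -> exists2 c, x <= c <= y &
  derive1n n g y - derive1n n g x = derive1n n.+1 g c * (y - x).
Proof.
move=> x0 xy; apply: (mean_value xy) => t /andP[xt _].
by apply: (smooth_is_derive _ BF_smooth); exact: lt_le_trans xt.
Qed.

Lemma BF_nondecr x y : 0 < x -> x <= y -> g x <= g y.
Proof.
move=> x0; rewrite le_eqVlt => /predU1P[->//|xy].
have [c /andP[xc cy]] := BF_mean_value 0 x0 xy.
rewrite -[derive1n 0 g]/g -subr_ge0 => ->; rewrite mulr_ge0 ?subr_ge0 ?(ltW xy) //.
exact: BF_derive1_ge0 (lt_le_trans x0 xc).
Qed.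

Lemma BF_derive1_nincr x y : 0 < x -> x <= y -> derive1n 1 g y <= derive1n 1 g x.
Proof.
move=> x0; rewrite le_eqVlt => /predU1P[->//|xy].
have [c /andP[xc cy]] := BF_mean_value 1 x0 xy.
rewrite -subr_le0 => ->; rewrite mulr_le0_ge0 ?subr_ge0 ?(ltW xy) //.
exact: BF_derive2_le0 (lt_le_trans x0 xc).
Qed.

Lemma BF_derive2_nondecr x y : 0 < x -> x <= y -> derive1n 2 g x <= derive1n 2 g y.
Proof.
move=> x0; rewrite le_eqVlt => /predU1P[->//|xy].
have [c /andP[xc cy]] := BF_mean_value 2 x0 xy.
rewrite -subr_ge0 => ->; rewrite mulr_ge0 ?subr_ge0 ?(ltW xy) //.
exact: BF_derive3_ge0 (lt_le_trans x0 xc).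
Qed.

(** Concavity: if [g y = 0] and [g x > 0] for some [x > y], then the slope is positive somewhere
    after [y], hence everywhere before, and [g (y / 2)] would be negative. *)
Lemma BF_gt0 y : 0 < y -> 0 < g y.
Proof.
move=> y0; have [_ _ [g0 _ _] [x x0 fx]] := hf.
have gx : 0 < g x.
  rewrite lt_neqAle g0 // andbT eq_sym; apply: contraNneq fx => gx0.
  by rewrite BF_real // gx0.
rewrite lt_neqAle g0 // andbT eq_sym; apply/eqP => gy.
have [xy|yx] := leP x y; first by have := BF_nondecr x0 xy; rewrite gy; lra.
have y20 : 0 < y / 2 by lra.
have [c1 /andP[c1a c1b] E1] := BF_mean_value 0 y0 yx.
have [|c2 /andP[c2a c2b] E2] := @BF_mean_value 0 (y / 2) y y20; first by lra.
have := @BF_derive1_nincr c2 c1 (lt_le_trans y20 c2a) (le_trans c2b c1a).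
have := g0 _ y20.
move: E1 E2; rewrite -[derive1n 0 g]/g gy => E1 E2 g2 c12.
have : derive1n 1 g c2 <= 0 by nra.
nra.
Qed.

Lemma BF_psum x h : 0 < x -> cabs h < x ->
  is_psum (taylor_coef g x) h (f (x%:C + h)).
Proof.
move=> x0 hx; apply: half_plane_Taylor => //; first exact: BF_cdiff.
- by case: hf.
- exact: BF_smooth.
Qed.

Lemma BF_alt x n : 0 < x -> (0 < n)%N -> 0 <= (-1) ^+ n.+1 * taylor_coef g x n.
Proof.
by move=> x0 n0; rewrite /taylor_coef mulrA divr_ge0 ?ler0n // BF_sign.
Qed.

(** [alt_Re_ge] compares [z] with the real point [x - |z - x|], which is positive when [z] lies in
    the disc, and there [f] is positive. *)
Lemma BF_Re_gt0 z : right_half_plane z -> right_half_plane (f z).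
Proof.
move=> zH; have [x x0 [zx _]] := two_points_disc zH zH.
have := alt_Re_ge (fun n => @BF_alt x n x0) (fun h => @BF_psum x h x0) zx.
have -> : x%:C + (z - x%:C) = z by ring.
rewrite /right_half_plane /= -rmorphD /=.
rewrite (@BF_real (x + _)) /=; last by lra.
by apply: lt_le_trans; apply: BF_gt0; lra.
Qed.

Lemma BF_lip L z w : (forall x, 0 < x -> derive1n 1 g x <= L) ->
  right_half_plane z -> right_half_plane w -> cabs (f z - f w) <= L * cabs (z - w).
Proof.
move=> gL zH wH; have [x x0 [zx wx]] := two_points_disc zH wH.
have := @alt_lipschitz _ _ (fun h => f (x%:C + h)) x
  (fun n => @BF_alt x n x0) (fun h => @BF_psum x h x0) L _ _ _ zx wx.
have -> : x%:C + (z - x%:C) = z by ring.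
have -> : x%:C + (w - x%:C) = w by ring.
have -> : z - x%:C - (w - x%:C) = z - w by ring.
apply => r s r0 rs sx; rewrite -!rmorphD /= !BF_real /=; [|lra|lra].
have [||c /andP[c1 c2]] := @BF_mean_value 0 (x - s) (x - r); [lra|lra|].
rewrite -[derive1n 0 g]/g => ->.
have := gL c (lt_le_trans _ c1); rewrite subr_gt0 => /(_ sx); nra.
Qed.

Lemma is_psumB (c1 c2 : nat -> R) h a b : is_psum c1 h a -> is_psum c2 h b ->
  is_psum (fun n => c1 n - c2 n) h (a - b).
Proof.
move=> H1 H2 e e0; have e20 : 0 < e / 2 by lra.
have [N1 K1] := H1 _ e20; have [N2 K2] := H2 _ e20.
exists (maxn N1 N2) => N; rewrite geq_max => /andP[/K1 k1 /K2 k2].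
have -> : a - b - psum (fun n => c1 n - c2 n) N h = (a - psum c1 N h) - (b - psum c2 N h).
  have -> : psum (fun n => c1 n - c2 n) N h = psum c1 N h - psum c2 N h.
    by rewrite /psum -sumrB; apply: eq_bigr => n _; rewrite rmorphB mulrBl.
  ring.
by apply: le_lt_trans (cabsB _ _) _; lra.
Qed.

(* The coefficients of [f - f (s + _)] alternate like those of [f]. *)
Lemma BF_increment_lip (b s : R) z w : 0 < s -> (forall x, 0 < x -> - b <= derive1n 2 g x) ->
  right_half_plane z -> right_half_plane w ->
  cabs ((f z - f (s%:C + z)) - (f w - f (s%:C + w))) <= b * s * cabs (z - w).
Proof.
move=> s0 gb zH wH; have [x x0 [zx wx]] := two_points_disc zH wH.
have sx0 : 0 < s + x by lra.
have c_alt n : (0 < n)%N ->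
    0 <= (-1) ^+ n.+1 * (taylor_coef g x n - taylor_coef g (s + x) n).
  move=> n0; rewrite /taylor_coef -mulrBl mulrA divr_ge0 ?ler0n //.
  have [|c /andP[c1 c2] E] := @BF_mean_value n x (s + x) x0; first by lra.
  have -> : derive1n n g x - derive1n n g (s + x) = - (derive1n n.+1 g c * (s + x - x)).
    by rewrite -E opprB.
  have := BF_sign (ltn0Sn n) (lt_le_trans x0 c1).
  rewrite addrK [(-1) ^+ n.+2]exprS => H.
  have -> : (-1) ^+ n.+1 * - (derive1n n.+1 g c * s) = -1 * (-1) ^+ n.+1 * derive1n n.+1 g c * s.
    by ring.
  by rewrite mulr_ge0 // ltW.
have u_psum h : cabs h < x ->
    is_psum (fun n => taylor_coef g x n - taylor_coef g (s + x) n) h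
      (f (x%:C + h) - f ((s + x)%:C + h)).
  by move=> hx; apply: is_psumB; apply: BF_psum => //; lra.
have := @alt_lipschitz _ _ _ x c_alt u_psum (b * s) _ _ _ zx wx.
have -> : x%:C + (z - x%:C) = z by ring.
have -> : x%:C + (w - x%:C) = w by ring.
have -> : (s + x)%:C + (z - x%:C) = s%:C + z by rewrite rmorphD; ring.
have -> : (s + x)%:C + (w - x%:C) = s%:C + w by rewrite rmorphD; ring.
have -> : z - x%:C - (w - x%:C) = z - w by ring.
apply => r q r0 rq qx; rewrite -!rmorphD /= !ReD !ReN !BF_real /=; [|lra|lra|lra|lra].
pose phi t := g t - g (s + t); pose dphi t := derive1n 1 g t - derive1n 1 g (s + t).
have [||c /andP[c1 c2]] := @mean_value R phi dphi (x - q) (x - r); first by lra.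
  move=> t /andP[t1 t2]; apply: is_deriveB.
    by apply: (smooth_is_derive 0 BF_smooth); lra.
  by apply: is_derive_shift; apply: (smooth_is_derive 0 BF_smooth); lra.
rewrite /phi !addrA => ->.
have [||d /andP[d1 d2] E] := @BF_mean_value 1 c (s + c); [lra|lra|].
have : dphi c <= b * s.
  rewrite /dphi -opprB E addrK -mulNr ler_wpM2r ?(ltW s0) // lerNl; apply: gb; lra.
nra.
Qed.

(** [BF_increment_lip] divided by [s], with [s] tending to 0: the complex derivative is Lipschitz
    although no second complex derivative is available. *)
Lemma BF_cdiff_lip b z w d d' : (forall x, 0 < x -> - b <= derive1n 2 g x) ->
  right_half_plane z -> right_half_plane w -> cdiff f z d -> cdiff f w d' ->
  cabs (d - d') <= b * cabs (z - w).
Proof.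
move=> gb zH wH Hd Hd'; apply/ler_addgt0Pr => e e0.
have e20 : 0 < e / 2 by lra.
have [r r0 K] := Hd _ e20; have [r' r'0 K'] := Hd' _ e20.
pose s := Num.min r r' / 2.
have m0 : 0 < Num.min r r' by rewrite lt_min r0.
have s0 : 0 < s by rewrite /s; lra.
have sm : s < Num.min r r' by rewrite /s; lra.
move: sm; rewrite lt_min => /andP[sr sr'].
have ns : cabs s%:C = s by rewrite cabs_real ger0_norm // ltW.
have := K s%:C; have := K' s%:C; rewrite ns => /(_ sr') k' /(_ sr) k.
have k2 := BF_increment_lip s0 gb zH wH.
rewrite -(ler_pM2r s0).
have -> : cabs (d - d') * s = cabs ((d - d') * s%:C) by rewrite cabsM ns.
have -> : (d - d') * s%:C = (f (w + s%:C) - f w - d' * s%:C) - (f (z + s%:C) - f z - d * s%:C)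
   - ((f z - f (s%:C + z)) - (f w - f (s%:C + w))).
  by rewrite [s%:C + z]addrC [s%:C + w]addrC; ring.
apply: le_trans (cabsB _ _) _; apply: le_trans (lerD (cabsB _ _) (lexx _)) _.
lra.
Qed.

Lemma BF_cdiff_real x d : 0 < x -> cdiff f x%:C d -> d = (derive1n 1 g x)%:C.
Proof.
move=> x0 Hd; set D := derive1n 1 g x.
apply/eqP; rewrite -subr_eq0 -cabs_eq0; apply/eqP/le_anti; rewrite cabs_ge0 andbT.
apply/ler_addgt0Pl => e e0; rewrite addr0.
have e20 : 0 < e / 2 by lra.
have [r r0 K] := Hd _ e20.
have [C [q [C0 q0 T]]] := Taylor_Peano 2 BF_smooth x0.
pose s := Num.min (Num.min (r / 2) (q / 2)) (e / 2 / (C + 1)).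
have s0 : 0 < s by rewrite !lt_min !divr_gt0 //; lra.
have : s <= Num.min (r / 2) (q / 2) by rewrite ge_min lexx.
rewrite le_min => /andP[sr sq].
have sC : s * (C + 1) <= e / 2.
  by rewrite -ler_pdivlMr; [rewrite ge_min lexx orbT|lra].
have ns : cabs s%:C = s by rewrite cabs_real ger0_norm // ltW.
have := K s%:C; rewrite ns -rmorphD /= !BF_real; [|lra|lra].
have := T s; rewrite (ger0_norm (ltW s0)) !big_ord_recr big_ord0 /= add0r.
rewrite /taylor_coef /= !fact0 !divr1 expr0 expr1 mulr1 -/D => /(_ _) T' /(_ _) K'.
rewrite -(ler_pM2r s0).
have -> : cabs (d - D%:C) * s = cabs ((d - D%:C) * s%:C) by rewrite cabsM ns.
have -> : (d - D%:C) * s%:C = (g (x + s) - (g x + D * s))%:C - ((g (x + s))%:C - (g x)%:C - d * s%:C).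
  by rewrite !(rmorphB, rmorphD, rmorphM); ring.
apply: le_trans (cabsB _ _) _; rewrite cabs_real.
have T2 := T' (le_lt_trans sq _); have K2 := K' (le_lt_trans sr _).
have {T2} := T2 ltac:(lra); have {K2} := K2 ltac:(lra).
rewrite expr2; nra.
Qed.

(** [L] and [- b] stand for [f'(0)] and [f''(0)]. Along the ray from 0 to [z], the function
    [f w - L w] starts from the limit 0 and has derivative [(f' - L) z], of modulus at most
    [b |z|^2]. *)
Lemma BF_deviation L b z :
  (forall x, 0 < x -> derive1n 1 g x <= L) ->
  (forall e, 0 < e -> exists2 x, 0 < x < e & L - e <= derive1n 1 g x) ->
  (forall e, 0 < e -> exists2 x, 0 < x < e & g x <= e) ->
  (forall x, 0 < x -> - b <= derive1n 2 g x) ->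
  right_half_plane z -> cabs (f z - L%:C * z) <= 2 * (b * cabs z ^+ 2).
Proof.
move=> gL gL' g0 gb zH.
have L0 : 0 <= L by apply: le_trans (gL 1 ltr01); exact: BF_derive1_ge0.
have b0 : 0 <= b.
  by have := gb 1 ltr01; have := BF_derive2_le0 (@ltr01 R); lra.
have z0 := cabs_ge0 z.
have x0 : 0 < cRe z by [].
have zt t : 0 < t -> right_half_plane (t%:C * z).
  by move=> t0; rewrite /right_half_plane /= ReM /= mul0r subr0 mulr_gt0.
(* The derivative at [w] is compared with the one at a small real [x], which is real and close to
   [L]. *)
have dL w d : right_half_plane w -> cdiff f w d -> cabs (d - L%:C) <= b * cabs w.
  move=> wH Hd; apply/ler_addgt0Pr => e e0.
  have e'0 : 0 < e / (b + 1) by rewrite divr_gt0 //; lra.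
  have [x /andP[xp xe] gx] := gL' _ e'0.
  have xH : right_half_plane x%:C by [].
  have [d' Hd'] := BF_cdiff xH.
  have H := BF_cdiff_lip gb wH xH Hd Hd'.
  have dE := BF_cdiff_real xp Hd'.
  have -> : d - L%:C = (d - d') + (d' - L%:C) by ring.
  apply: le_trans (cabsD _ _) _; rewrite {2}dE -rmorphB cabs_real.
  have -> : `|derive1n 1 g x - L| = L - derive1n 1 g x.
    by rewrite distrC ger0_norm // subr_ge0 gL.
  have : cabs (w - x%:C) <= cabs w + x.
    by apply: le_trans (cabsB _ _) _; rewrite cabs_real ger0_norm // ltW.
  have : e / (b + 1) * (b + 1) = e by rewrite divfK // gt_eqF //; lra.
  nra.
have gle x : 0 < x -> g x <= L * x.
  move=> xp; apply/ler_addgt0Pr => e e0.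
  pose e' := Num.min x e.
  have e'0 : 0 < e' by rewrite lt_min xp.
  have [y /andP[y0 ye] gy] := g0 _ e'0.
  move: ye gy; rewrite lt_min le_min => /andP[yx ye] /andP[_ gye].
  have [c /andP[c1 c2]] := BF_mean_value 0 y0 yx.
  have := gL c (lt_le_trans y0 c1); rewrite -[derive1n 0 g]/g; nra.
(* [K * t0] will bound [f w - L w] at [w = t0 z]: passing from [t0 z] to [t0 Re z] costs
   [2 L t0 |z|], and the value of [f] there and the term [L w] cost [L t0 |z|] each. *)
pose K := L * cabs z * 4.
have K0 : 0 <= K by rewrite !mulr_ge0.
(* The mean value theorem is for real-valued functions, so real and imaginary parts are bounded
   separately; this is the factor 2. *)
suff main (p : R[i] -> R) : (forall x y : R[i], p (x + y) = p x + p y) ->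
    (forall x : R[i], p (- x) = - p x) ->
    (forall (r : R) (x : R[i]), p (r%:C * x) = r * p x) ->
    (forall x : R[i], `|p x| <= cabs x) -> `|p (f z - L%:C * z)| <= b * cabs z ^+ 2.
  apply: le_trans (cabs_le_ReIm _) _; rewrite mulr_natl mulr2n lerD //; apply: main.
  - exact: ReD. - exact: ReN. - by move=> r x; rewrite ReM /= mul0r subr0.
  - exact: cabs_Re.
  - exact: ImD. - exact: ImN. - by move=> r x; rewrite ImM /= mul0r addr0.
  - exact: cabs_Im.
move=> pD pN pZ pb; apply/ler_addgt0Pr => e e0.
(* Nothing is known of [f] at 0 itself, so the ray starts at some [t0 > 0], chosen with
   [K * t0 <= e]. *)
pose t0 := Num.min (1 / 2) (e / (K + 1)).
have t00 : 0 < t0 by rewrite lt_min !divr_gt0 //; lra.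
have t01 : t0 < 1.
  have : t0 <= 1 / 2 by rewrite ge_min lexx.
  lra.
have t0K : t0 * (K + 1) <= e.
  by rewrite -ler_pdivlMr; [rewrite ge_min lexx orbT|lra].
have pray t : exists d, 0 < t -> cdiff f (t%:C * z) d.
  have [tp|tn] := ltP 0 t; last by exists 0.
  by have [d Hd] := BF_cdiff (zt t tp); exists d.
pose d t := sval (cid (pray t)).
have Hd t : 0 < t -> cdiff f (t%:C * z) (d t) by exact: (svalP (cid (pray t))).
pose F w := f w - L%:C * w.
have HF t : 0 < t -> cdiff F (t%:C * z) (d t - L%:C).
  move=> tp; apply: (@cdiff_eq R F _ (d t + (0 * (t%:C * z) + - L%:C * 1))); first by ring.
  have -> : F = (fun w => f w + (- L%:C) * w) by apply/funext => w; rewrite /F mulNr.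
  apply: cdiffD (Hd t tp) _.
  by apply: (@cdiffM R (fun=> - L%:C) id); [exact: cdiff_cst|exact: cdiff_id].
have [|c /andP[c1 c2]] := @mean_value R (fun t => p (F (t%:C * z))) (fun t => p ((d t - L%:C) * z)) t0 1 t01.
  move=> t /andP[t1 _]; apply: cdiff_ray => //; apply: HF; lra.
rewrite rmorph1 mul1r => E.
have Ec : `|p ((d c - L%:C) * z)| <= b * cabs z ^+ 2.
  apply: le_trans (pb _) _; rewrite cabsM expr2 mulrA ler_wpM2r //.
  have cp : 0 < c by lra.
  apply: le_trans (dL _ _ (zt c cp) (Hd c cp)) _.
  by rewrite cabsM cabs_real ger0_norm ?(ltW cp) // ler_wpM2l //; nra.
have Et : `|p (F (t0%:C * z))| <= K * t0.
  apply: le_trans (pb _) _; rewrite /F.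
  have tx : 0 < t0 * cRe z by rewrite mulr_gt0.
  have xz : cRe z <= cabs z by apply: le_trans (cabs_Re z); exact: ler_norm.
  have xH : right_half_plane (t0 * cRe z)%:C by [].
  have H1 := BF_lip gL (zt t0 t00) xH.
  have H2 : cabs (f (t0 * cRe z)%:C) <= L * (t0 * cRe z).
    by rewrite BF_real // cabs_real ger0_norm ?gle // ltW // BF_gt0.
  have H3 : cabs (t0%:C * z - (t0 * cRe z)%:C) <= t0 * cabs z + t0 * cRe z.
    apply: le_trans (cabsB _ _) _; rewrite cabsM !cabs_real.
    by rewrite ger0_norm ?(ltW t00) // ger0_norm // ltW.
  have H4 : cabs (L%:C * (t0%:C * z)) = L * (t0 * cabs z).
    by rewrite !cabsM !cabs_real !ger0_norm // ltW.
  have -> : f (t0%:C * z) - L%:C * (t0%:C * z) = (f (t0%:C * z) - f (t0 * cRe z)%:C)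
     + f (t0 * cRe z)%:C - L%:C * (t0%:C * z) by ring.
  apply: le_trans (cabsB _ _) _; apply: le_trans (lerD (cabsD _ _) (lexx _)) _.
  rewrite H4 /K; have : L * cabs (t0%:C * z - (t0 * cRe z)%:C) <= L * (t0 * cabs z + t0 * cRe z).
    by rewrite ler_wpM2l.
  have : L * (t0 * cRe z) <= L * (t0 * cabs z) by rewrite !ler_wpM2l // ltW.
  lra.
have -> : f z - L%:C * z = F z by [].
have -> : p (F z) = p (F (t0%:C * z)) + p ((d c - L%:C) * z) * (1 - t0) by rewrite -E; ring.
apply: le_trans (ler_normD _ _) _; rewrite normrM (@ger0_norm _ (1 - t0)); last by lra.
have := normr_ge0 (p ((d c - L%:C) * z)).
nra.
Qed.

End BernsteinFunctions.

(** * Derivatives at the boundary point 0 *)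

Section RightLimits.
Variable R : realType.
Implicit Types (u w : R -> R) (l x : R).

Lemma right_lim_eps u l : u x @[x --> 0^'+] --> l <->
  (forall e, 0 < e -> exists2 r, 0 < r & forall x, 0 < x -> x < r -> `|u x - l| < e).
Proof.
split=> [/cvgrPdist_lt H e e0|H].
  have [r /= r0 K] := H e e0; exists r => // x x0 xr.
  by rewrite distrC; apply: K => //; rewrite /= sub0r normrN gtr0_norm.
apply/cvgrPdist_lt => e e0; have [r r0 K] := H e e0.
exists r => //= x; rewrite /= sub0r normrN => xr x0.
by rewrite distrC; apply: K => //; rewrite gtr0_norm in xr.
Qed.

Lemma right_lim_comp u w l : (forall x, 0 < x -> 0 < w x) ->
  w x @[x --> 0^'+] --> (0 : R) -> u x @[x --> 0^'+] --> l ->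
  u (w x) @[x --> 0^'+] --> l.
Proof.
move=> w0 /right_lim_eps Hw /right_lim_eps Hu; apply/right_lim_eps => e /Hu[r r0 K].
have [s s0 L] := Hw r r0; exists s => // x x0 xs; apply: K; first exact: w0.
by have := L x x0 xs; rewrite subr0 gtr0_norm // w0.
Qed.

Lemma right_lim_nincr_le u l x : (forall y z, 0 < y -> y <= z -> u z <= u y) ->
  u y @[y --> 0^'+] --> l -> 0 < x -> u x <= l.
Proof.
move=> un /right_lim_eps H x0; apply/ler_addgt0Pr => e e0.
have [r r0 K] := H e e0; pose y := Num.min x (r / 2).
have y0 : 0 < y by rewrite lt_min x0 divr_gt0.
have yr : y < r.
  have : y <= r / 2 by rewrite ge_min lexx orbT.
  by lra.
have yx : y <= x by rewrite ge_min lexx.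
have := K y y0 yr; rewrite ltr_norml => /andP[_ h].
have := un y x y0 yx; lra.
Qed.

Lemma right_lim_near u l e : u y @[y --> 0^'+] --> l -> 0 < e ->
  exists2 x, 0 < x < e & `|u x - l| <= e.
Proof.
move=> /right_lim_eps H e0; have [r r0 K] := H e e0.
have m0 : 0 < Num.min r e by rewrite lt_min r0.
have hm : Num.min r e / 2 < Num.min r e by lra.
move: (hm); rewrite lt_min => /andP[h1 h2].
exists (Num.min r e / 2); first by rewrite h2 divr_gt0.
by rewrite ltW // K // divr_gt0.
Qed.

Lemma is_derive_eq_pos u w d x : 0 < x -> (forall y, 0 < y -> u y = w y) ->
  is_derive x (1 : R) u d -> is_derive x (1 : R) w d.
Proof.
move=> x0 uw; apply: near_eq_is_derive; near=> y; apply: uw.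
by near: y; exact: lt_nbhsr.
Unshelve. all: by end_near. Qed.

End RightLimits.

Section BoundaryDerivatives.
Variables (R : realType) (f : R[i] -> R[i]).
Hypothesis hf : BF f.
Let g : R -> R := real_restr f.

(** [lim] has a value even without convergence, so finiteness of [bdry_deriv] says nothing until
    monotonicity provides a limit in the extended reals. *)
Lemma bdry_deriv_cvg n (P : (forall x y, 0 < x -> x <= y -> derive1n n g x <= derive1n n g y)
    \/ (forall x y, 0 < x -> x <= y -> derive1n n g y <= derive1n n g x)) :
  bdry_deriv n f \is a fin_num ->
  derive1n n g x @[x --> 0^'+] --> fine (bdry_deriv n f).
Proof.
move=> ff; have cv : cvg ((derive1n n g x)%:E @[x --> (0 : R)^'+]).
  have b : (BRight (0 : R) < BInfty _ false)%O by [].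
  case: P => P.
    have H := @nondecreasing_at_right_cvge R (fun x => (derive1n n g x)%:E) 0 _ b.
    apply: cvgP; apply: H => x y.
    by rewrite !in_itv /= !andbT => x0 y0 xy; rewrite lee_fin P.
  have H := @nonincreasing_at_right_cvge R (fun x => (derive1n n g x)%:E) 0 _ b.
  apply: cvgP; apply: H => x y.
  by rewrite !in_itv /= !andbT => x0 y0 xy; rewrite lee_fin P.
rewrite /bdry_deriv in ff *.
have /fine_cvg : (derive1n n g x)%:E @[x --> (0 : R)^'+] -->
    (fine (lim ((derive1n n g x)%:E @[x --> (0 : R)^'+])))%:E by rewrite fineK.
by [].
Qed.

Lemma bdry0_cvg : bdry_deriv 0 f = 0%E -> g x @[x --> 0^'+] --> (0 : R).
Proof.
move=> f0; have := @bdry_deriv_cvg 0; rewrite f0; apply => //.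
by left; exact: BF_nondecr.
Qed.

Lemma bdry1_cvg : bdry_deriv 1 f \is a fin_num ->
  derive1n 1 g x @[x --> 0^'+] --> fine (bdry_deriv 1 f).
Proof. by apply: bdry_deriv_cvg; right; exact: BF_derive1_nincr. Qed.

Lemma bdry2_cvg : bdry_deriv 2 f \is a fin_num ->
  derive1n 2 g x @[x --> 0^'+] --> fine (bdry_deriv 2 f).
Proof. by apply: bdry_deriv_cvg; left; exact: BF_derive2_nondecr. Qed.

Lemma BF_ex_derive1_gt0 : g x @[x --> 0^'+] --> (0 : R) ->
  exists2 c, 0 < c & 0 < derive1n 1 g c.
Proof.
move=> g0; have g1 := BF_gt0 hf (@ltr01 R).
pose e := Num.min 1 (g 1 / 2).
have e0 : 0 < e by rewrite lt_min ltr01 divr_gt0.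
have [x /andP[x0 xe] gx] := right_lim_near g0 e0.
move: xe gx; rewrite lt_min => /andP[x1 _].
rewrite le_min subr0 => /andP[_ gx].
have [c /andP[c1 c2]] := BF_mean_value hf 0 x0 x1.
rewrite -[derive1n 0 _]/g => E.
exists c; first exact: lt_le_trans x0 c1.
rewrite ltNge; apply/negP => dc.
have : g x <= g 1 / 2 by apply: le_trans gx; exact: ler_norm.
have : derive1n 1 g c * (1 - x) <= 0 by rewrite mulr_le0_ge0 // subr_ge0 ltW.
rewrite -E; lra.
Qed.

(** Rising from 0 to [g 1 > 0] forces a positive slope somewhere, and the slope at 0 dominates it
    since the derivative is nonincreasing. *)
Lemma bdry1_gt0 : bdry_deriv 0 f = 0%E -> bdry_deriv 1 f \is a fin_num ->
  0 < fine (bdry_deriv 1 f).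
Proof.
move=> /bdry0_cvg/BF_ex_derive1_gt0[c c0 dc] /bdry1_cvg f1.
by apply: lt_le_trans dc _; apply: right_lim_nincr_le f1 c0; exact: BF_derive1_nincr.
Qed.

End BoundaryDerivatives.

(** * Boundary derivatives of the transition map: [f], [w], [k] stand for [v_{0,t}], [v_{t,u}],
    [v_{0,u}] *)

Section Transition.
Variables (R : realType) (f w k : R[i] -> R[i]).
Hypotheses (hf : BF f) (hw : BF w) (hk : BF k).
Hypothesis kE : forall z, right_half_plane z -> k z = f (w z).
Hypotheses (f0 : bdry_deriv 0 f = 0%E) (k0 : bdry_deriv 0 k = 0%E).
Hypotheses (f1 : bdry_deriv 1 f \is a fin_num) (k1 : bdry_deriv 1 k \is a fin_num).
Hypotheses (f2 : bdry_deriv 2 f \is a fin_num) (k2 : bdry_deriv 2 k \is a fin_num).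

Let gf : R -> R := real_restr f.
Let gw : R -> R := real_restr w.
Let gk : R -> R := real_restr k.
Let Af := fine (bdry_deriv 1 f).
Let Ak := fine (bdry_deriv 1 k).
Let Bf := fine (bdry_deriv 2 f).
Let Bk := fine (bdry_deriv 2 k).

Lemma real_compE x : 0 < x -> gf (gw x) = gk x.
Proof.
move=> x0; rewrite /gk /real_restr kE // (BF_real hw x0).
by rewrite -/gw (BF_real hf) //; exact: (BF_gt0 hw).
Qed.

(** Otherwise monotonicity keeps [gw] above some [e > 0], so that [gk] stays above [gf e > 0],
    against [k(0) = 0]. *)
Lemma inner_lim0 : gw x @[x --> 0^'+] --> (0 : R).
Proof.
apply/right_lim_eps => e e0; apply: contrapT => H.
have we x : 0 < x -> e <= gw x.
  move=> x0; rewrite leNgt; apply/negP => wx; apply: H; exists x => // y y0 yx.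
  rewrite subr0 gtr0_norm; last exact: (BF_gt0 hw).
  by apply: le_lt_trans wx; exact: (BF_nondecr hw y0 (ltW yx)).
have ge0 := BF_gt0 hf e0.
have [x /andP[x0 _]] := right_lim_near (bdry0_cvg hk k0) (e := gf e / 2) ltac:(by rewrite divr_gt0).
rewrite subr0 -/gk -real_compE // => /(le_trans (ler_norm _)).
have := BF_nondecr hf e0 (we x x0); rewrite -/gf => ? ?.
by have : 0 < gf e by []; lra.
Qed.

Lemma inner_gt0 x : 0 < x -> 0 < gw x.
Proof. exact: (BF_gt0 hw). Qed.

Lemma comp_derive1 x : 0 < x ->
  derive1n 1 gk x = derive1n 1 gf (gw x) * derive1n 1 gw x.
Proof.
move=> x0.
have dw := smooth_is_derive 0 (BF_smooth hw) x0.
have df := smooth_is_derive 0 (BF_smooth hf) (inner_gt0 x0).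
have dk := smooth_is_derive 0 (BF_smooth hk) x0.
have := is_derive_eq_pos x0 real_compE (is_derive1_comp df dw).
by move=> [_ <-]; case: dk => _ <-.
Qed.

Lemma comp_derive2 x : 0 < x ->
  derive1n 2 gk x = derive1n 2 gf (gw x) * derive1n 1 gw x ^+ 2
    + derive1n 1 gf (gw x) * derive1n 2 gw x.
Proof.
move=> x0.
have dw := smooth_is_derive 0 (BF_smooth hw) x0.
have dw1 := smooth_is_derive 1 (BF_smooth hw) x0.
have df1 := smooth_is_derive 1 (BF_smooth hf) (inner_gt0 x0).
have dk := smooth_is_derive 1 (BF_smooth hk) x0.
have H := is_deriveM (is_derive1_comp df1 dw) dw1.
have := is_derive_eq_pos x0 (fun y y0 => esym (comp_derive1 y0)) H.
case: dk => _ dk [_]; rewrite dk => ->.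
by rewrite -![_ *: _]/(_ * _) addrC mulrCA -expr2.
Qed.

Lemma outer_derive1_gt0 : 0 < Af.
Proof. exact: bdry1_gt0. Qed.

Let lim_gf1 : derive1n 1 gf (gw x) @[x --> 0^'+] --> Af.
Proof. exact: right_lim_comp inner_gt0 inner_lim0 (bdry1_cvg hf f1). Qed.

Let near_gf1 : \forall x \near (0 : R)^'+, derive1n 1 gf (gw x) != 0.
Proof.
have [r r0 K] := (right_lim_eps _ _).1 lim_gf1 _ outer_derive1_gt0.
exists r => //= x; rewrite /= sub0r normrN => xr x0.
rewrite gtr0_norm // in xr; apply/eqP => E; have := K x x0 xr.
by rewrite derive1n1 E sub0r normrN gtr0_norm ?ltxx // outer_derive1_gt0.
Qed.

Lemma inner_derive1_lim : derive1n 1 gw x @[x --> 0^'+] --> Ak / Af.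
Proof.
have A0 : Af != 0 by rewrite gt_eqF // outer_derive1_gt0.
have H : derive1n 1 gk x / derive1n 1 gf (gw x) @[x --> 0^'+] --> Ak / Af.
  by apply: cvgM; [exact: (bdry1_cvg hk k1)|exact: cvgV].
apply: cvg_trans H; apply: near_eq_cvg; near=> x.
have x0 : 0 < x by near: x; exact: nbhs_right_gt.
rewrite comp_derive1 // mulrAC divff ?mul1r //.
by near: x; exact: near_gf1.
Unshelve. all: by end_near. Qed.

Lemma inner_derive2_lim :
  derive1n 2 gw x @[x --> 0^'+] --> (Bk - Bf * (Ak / Af) ^+ 2) / Af.
Proof.
have A0 : Af != 0 by rewrite gt_eqF // outer_derive1_gt0.
have H : (derive1n 2 gk x - derive1n 2 gf (gw x) * derive1n 1 gw x ^+ 2)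
    / derive1n 1 gf (gw x) @[x --> 0^'+] --> (Bk - Bf * (Ak / Af) ^+ 2) / Af.
  apply: cvgM; last exact: cvgV.
  apply: cvgB; first exact: (bdry2_cvg hk k2).
  apply: cvgM; first exact: right_lim_comp inner_gt0 inner_lim0 (bdry2_cvg hf f2).
  by rewrite expr2; under eq_fun do rewrite expr2; apply: cvgM; exact: inner_derive1_lim.
apply: cvg_trans H; apply: near_eq_cvg; near=> x.
have x0 : 0 < x by near: x; exact: nbhs_right_gt.
rewrite comp_derive2 // [X in X / _]addrAC subrr add0r mulrAC divff ?mul1r //.
by near: x; exact: near_gf1.
Unshelve. all: by end_near. Qed.

Lemma inner_derive1_le x : 0 < x -> derive1n 1 gw x <= Ak / Af.
Proof. exact: right_lim_nincr_le (BF_derive1_nincr hw) inner_derive1_lim. Qed.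

Lemma transition_lip z z' : right_half_plane z -> right_half_plane z' ->
  cabs (w z - w z') <= Ak / Af * cabs (z - z').
Proof. by apply: (BF_lip hw) => x; exact: inner_derive1_le. Qed.

Lemma transition_deviation z : right_half_plane z ->
  cabs (w z - (Ak / Af)%:C * z) <=
    2 * (- ((Bk - Bf * (Ak / Af) ^+ 2) / Af) * cabs z ^+ 2).
Proof.
apply: (BF_deviation hw).
- exact: inner_derive1_le.
- move=> e /(right_lim_near inner_derive1_lim)[x xe]; rewrite ler_norml => /andP[h _].
  by exists x => //; rewrite lerBlDr -lerBlDl -lerN2 opprB.
- move=> e /(right_lim_near inner_lim0)[x xe]; rewrite subr0 ler_norml => /andP[_ h].
  by exists x.
- move=> x x0; rewrite opprK -lerN2.
  apply: (@right_lim_nincr_le _ (fun x => - derive1n 2 gw x)) x0.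
    by move=> y y' y0 yy; rewrite lerN2 (BF_derive2_nondecr hw).
  exact: cvgN inner_derive2_lim.
Qed.

End Transition.

(** * Densities of absolutely continuous functions *)

Section AbsolutelyContinuousVariation.
Variable R : realType.
Implicit Types (F V : R -> R) (a b c : R).

Definition ac_bound a b F (e d : R) := forall (n : nat) (x y : 'I_n -> R),
  (forall i, a <= x i /\ x i <= y i /\ y i <= b) ->
  trivIset setT (fun i => [set` `]x i, y i[]) ->
  \sum_(i < n) (y i - x i) < d ->
  \sum_(i < n) `|F (y i) - F (x i)| < e.

Lemma abs_cont_finType a b F e d :
  ac_bound a b F e d ->
  forall (T : finType) (x y : T -> R),
      (forall i, a <= x i /\ x i <= y i /\ y i <= b) ->
      trivIset setT (fun i => [set` `]x i, y i[]) ->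
      \sum_i (y i - x i) < d ->
      \sum_i `|F (y i) - F (x i)| < e.
Proof.
move=> H T x y xy tr ss.
have := H #|T| (x \o enum_val) (y \o enum_val).
have E (G : T -> R) : \sum_i G i = \sum_(i < #|T|) G (enum_val i).
  by rewrite -big_enum_val.
rewrite (E (fun i => `|F (y i) - F (x i)|)); apply => //=.
- by move=> i j _ _ /(tr _ _ I I) /enum_val_inj.
- by rewrite -(E (fun i => y i - x i)).
Qed.

Lemma itv_partition_nth_nd a b s j k : itv_partition a b s -> (j <= k)%N ->
  nth b (a :: s) j <= nth b (a :: s) k.
Proof.
move=> abs jk; have [ks|ks] := ltnP k (size s).+1; last first.
  rewrite [X in _ <= X]nth_default //.
  have [js|js] := ltnP j (size s).+1; first exact: itv_partition_nth_le.
  by rewrite nth_default.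
have sorted_as : sorted <=%O (a :: s).
  by case: abs => [+ _]; exact: (sub_path (@ltW _ _)).
by apply: le_sorted_leq_nth => //; rewrite inE //; exact: leq_ltn_trans ks.
Qed.

(** Subdividing the intervals preserves disjointness and total length, so the same [d] controls the
    variation along any partitions. *)
Lemma abs_cont_variation a b F e d :
  ac_bound a b F e d ->
  forall (n : nat) (x y : 'I_n -> R) (s : 'I_n -> seq R),
      (forall i, a <= x i /\ x i <= y i /\ y i <= b) ->
      (forall i, itv_partition (x i) (y i) (s i)) ->
      trivIset setT (fun i => [set` `]x i, y i[]) ->
      \sum_(i < n) (y i - x i) < d ->
      \sum_(i < n) variation (x i) (y i) F (s i) < e.
Proof.
move=> H n x y s xy xys tr ss.
(* All partitions are brought to the common size [m]: beyond its size, [nth] returns the end point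
   [y i], and the added pieces are degenerate. *)
pose m := \max_(i < n) size (s i).
pose X (p : 'I_n * 'I_m) := nth (y p.1) (x p.1 :: s p.1) p.2.
pose Y (p : 'I_n * 'I_m) := nth (y p.1) (x p.1 :: s p.1) p.2.+1.
have sm i : (size (s i) <= m)%N by exact: leq_bigmax.
have varE (G : R -> R) i : variation (x i) (y i) G (s i) =
    \sum_(j < m) `|G (Y (i, j)) - G (X (i, j))|.
  rewrite /variation -(big_mkord xpredT (fun j => `|G (nth (y i) (x i :: s i) j.+1) - G (nth (y i) (x i :: s i) j)|)).
  rewrite (big_cat_nat (leq0n (size (s i))) (sm i)) /=.
  rewrite [X in _ = _ + X]big_nat_cond [X in _ = _ + X]big1 ?addr0 //.
  move=> j /andP[/andP[j1 j2] _]; rewrite (nth_default _ j1).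
  have [->|js] := eqVneq j (size (s i)).
    by rewrite (itv_partition_nth_size _ (xys i)) subrr normr0.
  have : (size (s i) < j)%N by rewrite ltn_neqAle eq_sym js.
  by case: j j1 j2 js => //= j _ _ _ js; rewrite nth_default // subrr normr0.
have XY p : X p <= Y p by exact: itv_partition_nth_nd.
have xX p : x p.1 <= X p.
  rewrite [X in X <= _](_ : _ = nth (y p.1) (x p.1 :: s p.1) 0) //.
  exact: itv_partition_nth_nd.
have Yy p : Y p <= y p.1.
  have [js|js] := ltnP p.2.+1 (size (s p.1)).+1; first exact: itv_partition_nth_le.
  by rewrite /Y nth_default.
have lenE i : y i - x i = \sum_(j < m) (Y (i, j) - X (i, j)).
  have := @nondecreasing_variation R (x i) (y i) idfun (s i) (fun _ _ _ _ h => h) (xys i).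
  rewrite varE => <-; apply: eq_bigr => j _.
  by rewrite -[LHS]/(`|Y (i, j) - X (i, j)|) ger0_norm // subr_ge0.
have := abs_cont_finType H (x := X) (y := Y).
rewrite -(pair_bigA _ (fun i j => `|F (Y (i, j)) - F (X (i, j))|)) /=.
rewrite -(pair_bigA _ (fun i j => Y (i, j) - X (i, j))) /=.
under [X in _ -> _ -> X < _ -> _]eq_bigr do rewrite -lenE.
under [X in X < e]eq_bigr do rewrite -varE.
apply => //.
  move=> p; have [? [? ?]] := xy p.1; split; [exact: le_trans (xX p)|].
  by split => //; exact: le_trans (Yy p) _.
move=> [i j] [i' j'] _ _ [t [/=]]; rewrite !in_itv /= => /andP[t1 t2] /andP[t3 t4].
have ii' : i = i'.
  apply: tr => //; exists t; split; rewrite /= in_itv /=.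
    by rewrite (le_lt_trans (xX (i, j)) t1) (lt_le_trans t2 (Yy (i, j))).
  by rewrite (le_lt_trans (xX (i', j')) t3) (lt_le_trans t4 (Yy (i', j'))).
subst i'; congr (_, _); apply/val_inj/eqP; rewrite eqn_leq /=.
apply/andP; split; rewrite leqNgt; apply/negP => jj.
  have : Y (i, j') <= X (i, j) by exact: itv_partition_nth_nd.
  by rewrite leNgt (lt_trans t1 t4).
have : Y (i, j) <= X (i, j') by exact: itv_partition_nth_nd.
by rewrite leNgt (lt_trans t3 t2).
Qed.

Local Notation TV := (@total_variation R).

Lemma ac_bound_TV a b F e d x y : ac_bound a b F e d ->
  a <= x -> x <= y -> y <= b -> y - x < d -> (TV x y F <= e%:E)%E.
Proof.
move=> H ax xy yb xyd; apply: ge_ereal_sup => _ /= [_ [s xys <-] <-].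
rewrite lee_fin ltW //.
have := abs_cont_variation H (x := fun _ : 'I_1 => x) (y := fun=> y) (s := fun=> s).
rewrite !big_ord1; apply => //.
by move=> i j _ _ _; rewrite !ord1.
Qed.

(** Partitions reach each total variation up to [k], chosen so that [n] such losses stay below [h];
    the supremum turns [< e] into [<= e]. *)
Lemma ac_bound_sum_TV a b F e d : ac_bound a b F e d ->
  forall (n : nat) (x y : 'I_n -> R),
      (forall i, a <= x i /\ x i <= y i /\ y i <= b) ->
      trivIset setT (fun i => [set` `]x i, y i[]) ->
      \sum_(i < n) (y i - x i) < d ->
      \sum_(i < n) fine (TV (x i) (y i) F) <= e.
Proof.
move=> H n x y xy tr ss; apply/ler_addgt0Pr => h h0.
pose k := h / (n%:R + 1).
have k0 : 0 < k by rewrite divr_gt0 // ltr_wpDl.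
have TVfin i : TV (x i) (y i) F \is a fin_num.
  have [ax [xyi yb]] := xy i.
  rewrite fin_numElt (lt_le_trans _ (total_variation_ge0 F xyi)) //=.
  apply: le_lt_trans (ltry e); apply: (ac_bound_TV H) => //.
  apply: le_lt_trans ss; rewrite (bigD1 i) //= lerDl sumr_ge0 // => j _.
  by rewrite subr_ge0; have [_ []] := xy j.
have ex i : exists s, itv_partition (x i) (y i) s /\
    fine (TV (x i) (y i) F) - k <= variation (x i) (y i) F s.
  have [z] := ub_ereal_sup_adherent k0 (TVfin i).
  move=> [_ [s xys <-] <-]; rewrite -/(TV (x i) (y i) F) => hs.
  exists s; split => //; rewrite -lee_fin EFinB fineK // ltW //.
pose s i := sval (cid (ex i)).
have sP i := svalP (cid (ex i)).
have := abs_cont_variation H xy (fun i => (sP i).1) tr ss.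
move=> /ltW hs; apply: le_trans (_ : \sum_(i < n) (variation (x i) (y i) F (s i) + k) <= _).
  by apply: ler_sum => i _; rewrite -lerBlDr; exact: (sP i).2.
rewrite big_split /= sumr_const card_ord; apply: lerD => //.
rewrite -mulr_natl /k mulrA ler_pdivrMr ?ltr_wpDl // mulrDr mulr1 mulrC.
by rewrite lerDl ltW.
Qed.

Section CompactInterval.
Variables (c : R) (F : R -> R).
Hypotheses (c0 : 0 <= c) (Fac : abs_cont 0 c F).

(** On a piece of length [d / 2] the variation is at most 1, and finitely many such pieces cover
    [[x, y]]. *)
Lemma abs_cont_TV_fin x y : 0 <= x -> x <= y -> y <= c -> TV x y F \is a fin_num.
Proof.
have [d d0 H] := Fac ltr01.
suff fin n : forall x y, 0 <= x -> x <= y -> y <= c -> y - x <= n%:R * (d / 2) ->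
    (TV x y F < +oo)%E.
  move=> x0 xy yc; rewrite ge0_fin_numE ?total_variation_ge0 //.
  apply: (fin (Num.bound ((y - x) / (d / 2)))) => //.
  rewrite -ler_pdivrMr ?divr_gt0 // ltW // archi_boundP //.
  by rewrite divr_ge0 ?subr_ge0 // ltW // divr_gt0.
elim: n => [|n IH] {}x {}y x0 xy yc.
  rewrite mul0r subr_le0 => yx.
  by have -> : x = y; [apply: le_anti; rewrite xy | rewrite total_variationxx ltry].
move=> hxy; have [yd|yd] := leP y (x + d / 2).
  apply: le_lt_trans (ltry 1); apply: (ac_bound_TV H) => //; lra.
rewrite (@total_variationD _ x y (x + d / 2)); [|lra|lra].
rewrite lte_add_pinfty //.
  apply: le_lt_trans (ltry 1); apply: (ac_bound_TV H) => //; lra.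
apply: IH; [lra|lra|lra|].
by move: hxy; rewrite -natr1 mulrDl mul1r; lra.
Qed.

(* [total_variation] is only controlled on [0, c]; clipping the argument extends
   the variation function to the whole line, as Stieltjes measures require. *)
Definition clip (t : R) := Num.max 0 (Num.min t c).
Definition cum_var (t : R) : R := fine (TV 0 (clip t) F).

Lemma clip_ge0 t : 0 <= clip t. Proof. by rewrite le_max lexx. Qed.
Lemma clip_le t : clip t <= c. Proof. by rewrite ge_max c0 ge_min lexx orbT. Qed.
Lemma clip_nd s t : s <= t -> clip s <= clip t.
Proof.
move=> st; rewrite /clip ge_max le_max lexx /= le_max ge_min; apply/orP; right.
by rewrite le_min ge_min st /= ge_min lexx orbT.
Qed.
Lemma clip_id t : 0 <= t <= c -> clip t = t.
Proof. by move=> /andP[t0 tc]; rewrite /clip min_l // max_r. Qed.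

Lemma clip_contract s t : s <= t -> clip t - clip s <= t - s.
Proof.
move=> st; rewrite /clip /Order.max /Order.min.
case: (ltP t c) => h1; case: (ltP s c) => h2;
  by do 2?[case: ifPn; rewrite -?leNgt => ?]; lra.
Qed.

Lemma clip_inside x y t : clip x < t < clip y -> x < t < y.
Proof.
rewrite /clip gt_max lt_max => /andP[/andP[t0 t1]].
rewrite ltNge (ltW t0) /= lt_min => /andP[-> tc].
by move: t1; rewrite gt_min => /orP[->//|]; rewrite ltNge (ltW tc).
Qed.

Lemma cum_varB s t : s <= t -> cum_var t - cum_var s = fine (TV (clip s) (clip t) F).
Proof.
move=> st; rewrite /cum_var (@total_variationD _ 0 (clip t) (clip s)).
- by rewrite fineD ?abs_cont_TV_fin ?clip_ge0 ?clip_le ?clip_nd //; ring.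
- exact: clip_ge0.
- exact: clip_nd.
Qed.

Lemma cum_var_nd : {homo cum_var : s t / s <= t}.
Proof.
move=> s t st; rewrite -subr_ge0 cum_varB // fine_ge0 // total_variation_ge0 //.
exact: clip_nd.
Qed.

Lemma cum_var_ge t u : 0 <= t -> t <= u -> u <= c -> `|F u - F t| <= cum_var u - cum_var t.
Proof.
move=> t0 tu uc; rewrite cum_varB // !clip_id; [|lra|lra].
rewrite -lee_fin fineK ?total_variation_ge //; exact: abs_cont_TV_fin.
Qed.

(** [clip] shortens intervals and keeps disjoint ones disjoint, so the condition on [[0, c]] extends
    to intervals anywhere on the line. *)
Lemma cum_var_ac e : 0 < e -> exists2 d, 0 < d &
  forall (n : nat) (x y : 'I_n -> R), (forall i, x i <= y i) ->
      trivIset setT (fun i => [set` `]x i, y i[]) ->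
      \sum_(i < n) (y i - x i) < d ->
      \sum_(i < n) (cum_var (y i) - cum_var (x i)) <= e.
Proof.
move=> /Fac[d d0 H]; exists d => // n x y xy tr ss.
under eq_bigr do rewrite cum_varB //.
apply: (ac_bound_sum_TV H) => [i||].
- by rewrite clip_ge0 clip_le clip_nd.
- move=> i j _ _ [t [/=]]; rewrite !in_itv /= => /clip_inside ti /clip_inside tj.
  by apply: tr => //; exists t; rewrite /= !in_itv.
- by apply: le_lt_trans ss; apply: ler_sum => i _; exact: clip_contract.
Qed.

Lemma cum_var_rc : right_continuous cum_var.
Proof.
move=> x; apply/cvgrPdist_le => e e0.
have [d d0 H] := cum_var_ac e0.
near=> t; have xt : x <= t by near: t; exact: nbhs_right_ge.
have td : t - x < d by rewrite ltrBlDl; near: t; apply: nbhs_right_lt; rewrite ltrDl.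
have := H 1%N (fun=> x) (fun=> t) (fun=> xt).
rewrite !big_ord1 => /(_ _ td) h; rewrite distrC ger0_norm ?subr_ge0 ?cum_var_nd //.
by apply: h => i j _ _ _; rewrite !ord1.
Unshelve. all: by end_near. Qed.

End CompactInterval.

End AbsolutelyContinuousVariation.

(** * Density of the Stieltjes measure of an absolutely continuous function *)

Section StieltjesDensity.
Variables (R : realType) (V : cumulative R R) (c : R).
Hypothesis c0 : 0 <= c.
Hypothesis Vac : forall e : R, 0 < e -> exists2 d : R, 0 < d &
  forall (n : nat) (x y : 'I_n -> R), (forall i, x i <= y i) ->
      trivIset setT (fun i => [set` `]x i, y i[]) ->
      \sum_(i < n) (y i - x i) < d ->
      \sum_(i < n) (V (y i) - V (x i)) <= e.

Let lam := @lebesgue_measure R.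
Let mu := lebesgue_stieltjes_measure V.

Lemma stieltjes_ocitv a b : a <= b -> mu `]a, b]%classic = (V b - V a)%:E.
Proof.
move=> ab; rewrite /mu /= /lebesgue_stieltjes_measure /measure_extension.
rewrite measurable_mu_extE /=; last exact: is_ocitv.
by rewrite wlength_itv_bnd.
Qed.

Lemma open_bounded_interval (X : set R) : open X -> is_interval X ->
  has_lbound X -> has_ubound X -> X = `]inf X, sup X[%classic.
Proof.
move=> oX iX lX uX; have := interval_bounded_interior iX lX uX.
by rewrite (interior_id X).1 // => {1}->.
Qed.

(** An open set is a countable disjoint union of intervals: [Vac] bounds all finite partial sums by
    [e], and countable additivity gives the bound for the union. *)
Lemma stieltjes_small (e : R) : 0 < e -> exists2 d : R, 0 < d &
  forall U : set R, open U -> has_lbound U -> has_ubound U ->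
    (lam U < d%:E)%E -> (mu U <= e%:E)%E.
Proof.
move=> /Vac[d d0 H]; exists d => // U oU lU uU Ud.
pose I := open_disjoint_itv oU.
have UI : U = \bigcup_q I q by exact: open_disjoint_itv_bigcup.
have tI : trivIset setT I by exact: open_disjoint_itv_trivIset.
have IU q : I q `<=` U by rewrite UI; exact: bigcup_sup.
have IE q : I q = `]inf (I q), sup (I q)[%classic.
  apply: open_bounded_interval.
  - exact: open_disjoint_itv_open.
  - exact: open_disjoint_itv_is_interval.
  - exact: subset_has_lbound (IU q) lU.
  - exact: subset_has_ubound (IU q) uU.
have ab q : inf (I q) <= sup (I q).
  (* For an empty component [inf] and [sup] both default to 0. *)
  have [->|/set0P[x Ix]] := eqVneq (I q) set0; first by rewrite inf0 sup0.
  move: Ix; rewrite {1}IE /= in_itv /= => /andP[x1 x2].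
  exact: ltW (lt_trans x1 x2).
have mI q : measurable (I q) by rewrite IE; exact: measurable_itv.
have lamI q : lam (I q) = (sup (I q) - inf (I q))%:E.
  rewrite {1}IE /lam lebesgue_measure_itv /= lte_fin.
  case: ltP => [_|ba]; first by rewrite EFinB.
  by have -> : sup (I q) = inf (I q); [apply: le_anti; rewrite ba ab|rewrite subrr].
have part n : (\sum_(0 <= i < n) mu (I i) <= e%:E)%E.
  apply: (@le_trans _ _ (\sum_(0 <= i < n) (V (sup (I i)) - V (inf (I i)))%:E)%E).
    apply: lee_sum => i _; rewrite -stieltjes_ocitv //.
    apply: le_measure; [by rewrite inE; exact: mI|by rewrite inE; exact: measurable_itv|].
    by rewrite {1}IE; exact: subset_itv_oo_oc.
  rewrite big_mkord sumEFin lee_fin.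
  apply: (H n (fun i => inf (I i)) (fun i => sup (I i))) => //.
    move=> i j _ _; rewrite -!IE => /(tI _ _ Logic.I Logic.I) ij.
    exact: val_inj.
  rewrite -lte_fin -sumEFin; apply: le_lt_trans Ud.
  under eq_bigr do rewrite -lamI.
  rewrite -(big_mkord xpredT (fun i => lam (I i))).
  rewrite big_mkord -measure_bigsetU //.
  apply: le_measure; rewrite ?inE.
  - by apply: bigsetU_measurable => i _; exact: mI.
  - exact: measurable_realfun.open_measurable.
  - by rewrite UI; exact: bigsetU_bigcup.
have -> : mu U = (\sum_(0 <= i <oo) mu (I i))%E.
  rewrite {1}UI; apply: (@measure_semi_bigcup _ _ _ (lebesgue_stieltjes_measure V) I) => //.
  by rewrite -UI; exact: measurable_realfun.open_measurable.
apply: lime_le; first exact: is_cvg_nneseries.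
by apply: nearW => n; exact: part.
Qed.

(** A Lebesgue-null set lies in open sets of arbitrarily small Lebesgue measure, hence of small
    Stieltjes measure by [stieltjes_small]; this is the domination that Radon-Nikodym asks for. *)
Lemma stieltjes_density : exists f : R -> R, [/\ forall x, 0 <= f x,
    lam.-integrable setT (EFin \o f) &
    forall t u, 0 <= t -> t <= u -> u <= c ->
      (V u - V t)%:E = (\int[lam]_(x in `]t, u]) (f x)%:E)%E].
Proof.
(* Restricting to a bounded interval makes the measure finite; this one contains every []t, u]] at
   stake. *)
pose D : set R := `]-1, c]%classic.
have mD : measurable (D : set (measurableTypeR R)) by exact: measurable_itv.
have Nc : -1 <= c by exact: le_trans (lerN10 R) c0.
have muD : (mu D < +oo)%E by rewrite (stieltjes_ocitv Nc) ltry.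
pose nu : {finite_measure set (measurableTypeR R) -> \bar R} := mfrestr mD muD.
have nudom : nu `<< lam.
  apply/null_content_dominatesP => A mA A0.
  apply/eqP; rewrite eq_le measure_ge0 andbT.
  apply/lee_addgt0Pr => e e0; rewrite add0e.
  have [d d0 H] := stieltjes_small e0.
  have A0' : (lam A < +oo)%E by rewrite [X in (X < _)%E]A0 ltry.
  have [U [oU AU Ud]] := @lebesgue_regularity_outer R A d mA A0' d0.
  (* Outer regularity may give an unbounded [U]; the cut keeps it open around [A] intersected with
     [D] and supplies the bounds for [stieltjes_small]. *)
  pose W : set R := U `&` `]-2, c + 1[%classic.
  have oW : open W by apply: openI => //; exact: interval_open.
  have lamW : (lam W < d%:E)%E.
    apply: le_lt_trans Ud; rewrite -[X in (_ <= X)%E]add0e -[X in (_ <= X + _)%E]A0.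
    apply: (@le_trans _ _ (lam (A `|` (U `\` A)))).
      apply: le_measure; rewrite ?inE.
      - exact: measurable_realfun.open_measurable.
      - by apply: measurableU => //; apply: measurableD => //; exact: measurable_realfun.open_measurable.
      - move=> x [Ux _]; have [Ax|Ax] := pselect (A x); [by left|by right].
    apply: (@measureU2 _ _ _ (@lebesgue_measure R)) => //.
    by apply: measurableD => //; exact: measurable_realfun.open_measurable.
  have muW : (mu W <= e%:E)%E.
    apply: H => //; first by exists (-2) => x [_ /=]; rewrite in_itv /= => /andP[/ltW].
    by exists (c + 1) => x [_ /=]; rewrite in_itv /= => /andP[_ /ltW].
  apply: le_trans muW; rewrite /nu /= /mfrestr /mrestr.
  apply: le_measure; rewrite ?inE.
  - by apply: measurableI.
  - exact: measurable_realfun.open_measurable.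
  - move=> x [Ax]; rewrite /D /= in_itv /= => /andP[x1 x2]; split; first exact: AU.
    by rewrite /= in_itv /=; lra.
have [f [f0 ffin fint fE]] := radon_nikodym_sigma_finite nudom.
exists (fine \o f); split => [x||t u t0 tu uc].
- by rewrite /= fine_ge0.
- by apply: eq_integrable fint => // x _; rewrite /= fineK.
- rewrite -(stieltjes_ocitv tu).
  have -> : mu `]t, u]%classic = nu `]t, u]%classic.
    rewrite /nu /= /mfrestr /mrestr setIidl // => x; rewrite /D /= !in_itv /=; lra.
  rewrite fE; last exact: measurable_itv.
  by apply: eq_integral => x _; rewrite /= fineK.
Qed.

End StieltjesDensity.

Lemma abs_cont_density (R : realType) (c : R) (F : R -> R) : 0 <= c -> abs_cont 0 c F ->
  exists f : R -> R, [/\ forall x, 0 <= f x,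
    lebesgue_measure.-integrable setT (EFin \o f) &
    forall t u, 0 <= t -> t <= u -> u <= c ->
      `|F u - F t| <= \int[lebesgue_measure]_(x in `[t, u]) f x].
Proof.
move=> c0 Fac.
pose V : cumulative R R := HB.pack (cum_var c F)
  (isCumulative.Build _ _ _ (cum_var c F) (cum_var_nd c0 Fac) (cum_var_rc c0 Fac)).
have [f [f0 fi fE]] := @stieltjes_density R V c c0 (cum_var_ac c0 Fac).
exists f; split => // t u t0 tu uc.
apply: le_trans (cum_var_ge c0 Fac t0 tu uc) _.
have := fE t u t0 tu uc => /(congr1 fine) /= ->.
rewrite -/(Rintegral _ _ _) Rintegral_itv_obnd_cbnd //.
by apply: integrableS fi.
Qed.

(** * Reverse evolution families *)

Section TimeInterval.
Variables (R : realType) (I : interval R).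
Hypothesis hI : time_interval I.

Lemma time_interval_ge0 x : x \in I -> 0 <= x.
Proof. by case: hI => [[T T0 [->|->]]|->]; rewrite in_itv /= => /andP[]. Qed.

Lemma time_interval0 : 0 \in I.
Proof. by case: hI => [[T T0 [->|->]]|->]; rewrite in_itv /= lexx ?T0 ?ltW. Qed.

Lemma time_interval_le x y : y \in I -> 0 <= x -> x <= y -> x \in I.
Proof.
case: hI => [[T T0 [->|->]]|->]; rewrite !in_itv /= => /andP[_ yT] -> xy //=.
  exact: le_trans yT.
exact: le_lt_trans yT.
Qed.

Lemma time_interval_exhaustion : exists a : nat -> R,
  [/\ forall n, a n \in I, forall n, a n <= a n.+1 &
    forall x, x \in I -> exists n, x <= a n].
Proof.
case: hI => [[T T0 [->|->]]|->].
- exists (fun=> T); split => // [n|x].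
    by rewrite in_itv /= lexx ltW.
  by rewrite in_itv /= => /andP[_ xT]; exists 0%N.
- exists (fun n => T - T / n.+1%:R); split => [n|n|x].
  + rewrite in_itv /= subr_ge0 ler_pdivrMr // ler_pMr // ler1n /=.
    by rewrite ltrBlDr ltrDl divr_gt0.
  + by rewrite lerB // ler_pM2l // lef_pV2 ?posrE // ler_nat.
  + rewrite in_itv /= => /andP[x0 xT].
    have d0 : 0 < T - x by rewrite subr_gt0.
    exists (Num.bound (T / (T - x))).
    rewrite lerBrDr -lerBrDl ler_pdivrMr // mulrC -ler_pdivrMr // ltW //.
    apply: lt_trans (archi_boundP _) _; first by rewrite divr_ge0 // ltW.
    by rewrite ltr_nat.
- exists (fun n => n%:R); split => [n|n|x].
  + by rewrite in_itv /= ler0n.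
  + by rewrite ler_nat.
  + rewrite in_itv /= andbT => x0; exists (Num.bound x).
    by rewrite ltW // archi_boundP.
Qed.

End TimeInterval.

(** * Patching bounds on compact intervals into one on [I] *)

Section Gluing.
Variables (R : realType) (I : interval R) (D : R -> R -> R -> R).
Hypothesis hI : time_interval I.
Hypothesis D_triangle : forall s t m u, s \in I -> t \in I -> m \in I -> u \in I ->
  s <= t -> t <= m -> m <= u -> D s t u <= D s t m + D s m u.
Local Notation lam := (@lebesgue_measure R).
Hypothesis D_local : forall c, c \in I -> exists f : R -> R,
  [/\ forall x, 0 <= f x, lam.-integrable setT (EFin \o f) &
    forall s t u, 0 <= s -> s <= t -> t <= u -> u <= c ->
      D s t u <= \int[lam]_(x in `[t, u]) f x].

Lemma glue_local_bounds : exists f : R -> R,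
  [/\ forall r, r \in I -> 0 <= f r, L1_loc I f &
    forall s t u, s \in I -> t \in I -> u \in I -> s <= t -> t <= u ->
      D s t u <= \int[lam]_(x in `[t, u]) f x].
Proof.
have [a [aI a_nd aex]] := time_interval_exhaustion hI.
have /choice [F HF] : forall n, exists f : R -> R,
    [/\ forall x, 0 <= f x, lam.-integrable setT (EFin \o f) &
    forall s t u, 0 <= s -> s <= t -> t <= u -> u <= a n ->
      D s t u <= \int[lam]_(x in `[t, u]) f x].
  by move=> n; exact: D_local.
have F0 n x : 0 <= F n x by have [] := HF n.
have Fint n : lam.-integrable setT (EFin \o F n) by have [] := HF n.
have a_mono : {homo a : m n / (m <= n)%N >-> m <= n} by apply: homo_leq => //; exact: le_trans.
(* The default 0 is taken only at points beyond every [a n], which lie outside [I]. *)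
pose N r := if pselect (exists n, r <= a n) is left e then ex_minn e else 0%N.
have NP r n : r <= a n -> (N r <= n)%N /\ r <= a (N r).
  move=> rn; rewrite /N; case: pselect => [e|]; last by case; exists n.
  by case: ex_minnP => m rm min; split => //; exact: min.
pose f r := F (N r) r.
have f0 r : 0 <= f r by exact: F0.
have fE n r : a n < r -> r <= a n.+1 -> f r = F n.+1 r.
  move=> ar ra; have [N1 N2] := NP _ _ ra.
  rewrite /f; suff -> : N r = n.+1 by [].
  apply/eqP; rewrite eqn_leq N1 ltnNge; apply/negP => Nn.
  by have := lt_le_trans ar (le_trans N2 (a_mono _ _ Nn)); rewrite ltxx.
have fE0 r : r <= a 0%N -> f r = F 0%N r.
  by move=> /NP[]; rewrite leqn0 => /eqP N0 _; rewrite /f N0.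
have Fmeas n : measurable_fun setT (F n).
  by apply/measurable_realfun.measurable_EFinP; case/integrableP: (Fint n).
pose E n : set R := if n is m.+1 then `]a m, a m.+1]%classic else `]-oo, a 0%N]%classic.
have Em n : measurable (E n) by case: n => [|n]; exact: measurable_itv.
have EF n r : E n r -> f r = F n r.
  case: n => [|n]; rewrite /E /= in_itv /=; first exact: fE0.
  by move=> /andP[]; exact: fE.
have fmeasE : measurable_fun (\bigcup_n E n) f.
  apply/measurable_fun_bigcup => // n; apply: (eq_measurable_fun (F n)).
    by move=> r; rewrite inE => /EF ->.
  exact: measurable_funS (Fmeas n).
have cover r n : r <= a n -> (\bigcup_n E n) r.
  elim: n => [|n IH] ra; first by exists 0%N => //=; rewrite in_itv.
  have [/IH //|ar] := leP r (a n).
  by exists n.+1 => //=; rewrite in_itv /= ar.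
(* This finite sum of integrable functions dominates [f] on [[0, a n]], whence local
   integrability. *)
have fle n r : r <= a n -> f r <= \sum_(i < n.+1) F i r.
  move=> /NP[Nn _]; rewrite (bigD1 (Ordinal (Nn : (N r < n.+1)%N))) //= lerDl.
  by apply: sumr_ge0.
have fint n : lam.-integrable `[0, a n] (EFin \o f).
  have sint : lam.-integrable `[0, a n] (fun x => (\sum_(i < n.+1) (F i x)%:E)%E).
    apply: integrable_sum => // i _.
    by apply: integrableS (Fint i).
  apply: le_integrable sint => //.
    apply/measurable_realfun.measurable_EFinP; apply: measurable_funS fmeasE.
      exact: bigcup_measurable.
    by move=> r /=; rewrite in_itv /= => /andP[_]; exact: cover.
  move=> r /=; rewrite in_itv /= => /andP[_ ra].
  rewrite sumEFin /= lee_fin ger0_norm // ger0_norm ?fle //.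
  by apply: sumr_ge0.
have fintab t u : t \in I -> u \in I -> lam.-integrable `[t, u] (EFin \o f).
  move=> tI uI; have [n un] := aex u uI; apply: integrableS (fint n) => //.
  by apply: subset_itv; rewrite bnd_simp // (time_interval_ge0 hI).
exists f; split => //.
- split => [|t u tI uI _]; last exact: fintab.
  apply: measurable_funS fmeasE; first exact: bigcup_measurable.
  by move=> r /aex [n]; exact: cover.
- have Rf t u : t \in I -> u \in I ->
      \int[lam]_(x in `]t, u]) f x = \int[lam]_(x in `[t, u]) f x.
    move=> tI uI; rewrite Rintegral_itv_obnd_cbnd //.
    apply: integrableS (fintab t u tI uI) => //; exact: subset_itv_oc_cc.
  have RF n t u : \int[lam]_(x in `]t, u]) F n x = \int[lam]_(x in `[t, u]) F n x.
    by rewrite Rintegral_itv_obnd_cbnd //; apply: integrableS (Fint n).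
  have last_piece n s t u : s \in I -> t \in I -> u \in I -> s <= t -> t <= u ->
      a n <= t -> u <= a n.+1 -> D s t u <= \int[lam]_(x in `[t, u]) f x.
    move=> sI tI uI st tu ant un; have [_ _ H] := HF n.+1.
    apply: le_trans (H s t u (time_interval_ge0 hI sI) st tu un) _.
    rewrite -Rf // -RF le_eqVlt; apply/orP; left; apply/eqP.
    apply: eq_Rintegral => r; rewrite inE /= in_itv /= => /andP[tr ru].
    by rewrite (fE n) // ?(le_lt_trans ant tr) // (le_trans ru un).
  move=> s t u sI tI uI st tu; have [n un] := aex u uI.
  elim: n s t u sI tI uI st tu un => [|n IH] s t u sI tI uI st tu un.
    have [_ _ H] := HF 0%N.
    apply: le_trans (H s t u (time_interval_ge0 hI sI) st tu un) _.
    rewrite le_eqVlt; apply/orP; left; apply/eqP.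
    apply: eq_Rintegral => r; rewrite inE /= in_itv /= => /andP[_ ru].
    by rewrite fE0 // (le_trans ru un).
  (* Only when [a n] lies strictly between [t] and [u] is the increment cut, at [a n], with [s]
     unchanged: induction on the left, [F n.+1] on the right. *)
  have [una|anu] := leP u (a n); first exact: IH.
  have [ant|tan] := leP (a n) t; first exact: (last_piece n).
  apply: le_trans (D_triangle sI tI (aI n) uI st (ltW tan) (ltW anu)) _.
  have h1 := IH s t (a n) sI tI (aI n) st (ltW tan) (lexx _).
  have h2 := last_piece n s (a n) u sI (aI n) uI (le_trans st (ltW tan)) (ltW anu) (lexx _) un.
  apply: le_trans (lerD h1 h2) _.
  have := Rintegral_itvB (fintab t u tI uI) (x := a n).
  rewrite !bnd_simp => /(_ (ltW tan) (ltW anu)); rewrite Rf //.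
  by move=> <-; rewrite addrC subrK.
Qed.

End Gluing.

Section AbsContCompact.
Variables (R : realType) (c : R) (F : R -> R).
Hypotheses (c0 : 0 <= c) (Fac : abs_cont 0 c F).

Lemma abs_cont_clip_continuous : continuous (fun t => F (clip c t)).
Proof.
move=> x; apply/cvgrPdist_lt => e /Fac[d d0 H].
have close s t : s <= t -> t - s < d -> `|F (clip c t) - F (clip c s)| < e.
  move=> st std; have := H 1%N (fun=> clip c s) (fun=> clip c t).
  rewrite !big_ord1; apply.
  - by move=> _; rewrite clip_ge0 clip_le // clip_nd.
  - by move=> i j _ _ _; rewrite !ord1.
  - exact: le_lt_trans (clip_contract _ st) std.
exists d => //= t; rewrite /= => xt.
have [le_xt|le_tx] := leP x t.
  by rewrite distrC; apply: close => //; move: xt; rewrite distrC ger0_norm // subr_ge0.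
by apply: close; rewrite ?ltW //; move: xt; rewrite gtr0_norm // subr_gt0.
Qed.

(** Recording that [m] is attained is what makes it positive when [F] is [A]. *)
Lemma abs_cont_EVT : exists m M, [/\ exists2 t, 0 <= t <= c & F t = m &
  forall t, 0 <= t <= c -> m <= F t <= M].
Proof.
have cF : {within `[0, c], continuous (fun t => F (clip c t))}.
  exact/continuous_subspaceT/abs_cont_clip_continuous.
have [x1] := EVT_max c0 cF; rewrite in_itv /= => x1c H1.
have [x2] := EVT_min c0 cF; rewrite in_itv /= => x2c H2.
exists (F x2), (F x1); split; first by exists x2.
move=> t tc; have tc' : t \in `[0, c] by rewrite in_itv.
by have := H1 t tc'; have := H2 t tc'; rewrite !clip_id // => -> ->.
Qed.

End AbsContCompact.

(** * Elementary estimates on the coefficients of the transition map *)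

Section TransitionCoefficients.
Variable R : realType.
Implicit Types m M N a b : R.

Lemma ratio_deviation m a a' : 0 < m -> m <= a ->
  `|a' / a - 1| <= m^-1 * `|a' - a|.
Proof.
move=> m0 ma; have a0 := lt_le_trans m0 ma.
have -> : a' / a - 1 = a^-1 * (a' - a) by field; rewrite gt_eqF.
by rewrite normrM ler_wpM2r // gtr0_norm ?invr_gt0 // lef_pV2 ?posrE.
Qed.

(** The numerator is [b' - b] minus [b ((a' / a)^2 - 1)], and
    [(a' / a)^2 - 1 = (a' + a)(a' - a) / a^2], where [(a' + a) / a^2 <= 2 M / m^2]. *)
Lemma second_coef_bound m M N a a' b b' : 0 < m -> m <= a -> a <= M ->
  m <= a' -> a' <= M -> `|b| <= N ->
  - ((b' - b * (a' / a) ^+ 2) / a) <=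
    m^-1 * (`|b' - b| + N * (2 * M / m ^+ 2 * `|a' - a|)).
Proof.
move=> m0 ma aM ma' aM' bN.
have a0 := lt_le_trans m0 ma; have a'0 := lt_le_trans m0 ma'.
have -> : - ((b' - b * (a' / a) ^+ 2) / a) =
   a^-1 * ((b - b') + b * ((a' + a) / a ^+ 2 * (a' - a))).
  by field; rewrite gt_eqF.
apply: le_trans (ler_norm _) _; rewrite normrM gtr0_norm ?invr_gt0 //.
apply: ler_pM; rewrite ?invr_ge0 ?(ltW a0) //.
  by rewrite lef_pV2 ?posrE.
apply: le_trans (ler_normD _ _) _; rewrite distrC lerD2l normrM.
apply: ler_pM => //.
rewrite normrM ler_wpM2r // gtr0_norm; last first.
  by rewrite divr_gt0 ?exprn_gt0 ?addr_gt0.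
apply: ler_pM; rewrite ?invr_ge0 ?exprn_ge0 ?addr_ge0 ?(ltW a'0) ?(ltW a0) //.
  lra.
by rewrite lef_pV2 ?posrE ?exprn_gt0 // lerXn2r ?nnegrE // ltW.
Qed.

(** The sum of three coefficients: that of [|a' - a|] from [ratio_deviation], and those of
    [|a' - a|] and [|b' - b|] from [second_coef_bound], with [r] for the modulus of [z]. *)
Definition increment_const m M N r :=
  m^-1 * r + 2 * r ^+ 2 * (m^-1 * (N * (2 * M / m ^+ 2))) + 2 * r ^+ 2 * m^-1.

Lemma increment_const_ge0 m M N r : 0 < m -> 0 <= M -> 0 <= N -> 0 <= r ->
  0 <= increment_const m M N r.
Proof.
move=> m0 M0 N0 r0; have im0 : 0 <= m^-1 by rewrite invr_ge0 ltW.
have m20 : 0 <= (m ^+ 2)^-1 by rewrite invr_ge0 exprn_ge0 // ltW.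
by rewrite /increment_const !addr_ge0 ?mulr_ge0 ?exprn_ge0.
Qed.

Lemma coef_increment_bound m M N r a a' b b' : 0 < m -> m <= a -> a <= M ->
  m <= a' -> a' <= M -> 0 <= N -> `|b| <= N -> 0 <= r ->
  2 * (- ((b' - b * (a' / a) ^+ 2) / a) * r ^+ 2) + `|a' / a - 1| * r <=
    increment_const m M N r * (`|a' - a| + `|b' - b|).
Proof.
move=> m0 ma aM ma' aM' N0 bN r0.
have h1 := ratio_deviation a' m0 ma.
have h2 := second_coef_bound b' m0 ma aM ma' aM' bN.
have h3 := ler_wpM2l (ler0n _ 2) (ler_wpM2r (exprn_ge0 2 r0) h2).
apply: le_trans (lerD h3 (ler_wpM2r r0 h1)) _.
rewrite /increment_const.
set x := `|a' - a|; set y := `|b' - b|.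
have x0 : 0 <= x by exact: normr_ge0.
have y0 : 0 <= y by exact: normr_ge0.
have im0 : 0 <= m^-1 by rewrite invr_ge0 ltW.
have M0 : 0 <= M by apply: le_trans aM; exact/ltW/(lt_le_trans m0).
set q := N * (2 * M / m ^+ 2).
have q0 : 0 <= q.
  by rewrite !mulr_ge0 // invr_ge0 exprn_ge0 // ltW.
have -> : N * (2 * M / m ^+ 2 * x) = q * x by rewrite /q !mulrA.
(* [p1], [p2], [p3] are the surplus terms created by using the whole constant for both
   increments. *)
have p1 : 0 <= m^-1 * r * y by rewrite !mulr_ge0.
have p2 : 0 <= 2 * r ^+ 2 * (m^-1 * q) * y.
  exact: mulr_ge0 (mulr_ge0 (mulr_ge0 (ler0n _ 2) (exprn_ge0 2 r0)) (mulr_ge0 im0 q0)) y0.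
have p3 : 0 <= 2 * r ^+ 2 * m^-1 * x.
  exact: mulr_ge0 (mulr_ge0 (mulr_ge0 (ler0n _ 2) (exprn_ge0 2 r0)) im0) x0.
rewrite -subr_ge0.
have -> : forall p r2, (p * r + 2 * r2 * (p * q) + 2 * r2 * p) * (x + y) -
    (2 * (p * (y + q * x) * r2) + p * x * r) =
    p * r * y + 2 * r2 * (p * q) * y + 2 * r2 * p * x by move=> p r2; ring.
by rewrite !addr_ge0.
Qed.

Lemma ratio_le m M a b : 0 < m -> m <= a -> 0 <= b -> b <= M -> b / a <= M / m.
Proof.
move=> m0 ma b0 bM; have a0 := lt_le_trans m0 ma.
by apply: ler_pM; rewrite ?invr_ge0 ?(ltW a0) // lef_pV2 ?posrE.
Qed.

End TransitionCoefficients.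

(** * The increment bound and REF3 *)

Section Main.
Variables (R : realType) (I : interval R) (v : R -> R -> R[i] -> R[i]).
Hypothesis hI : time_interval I.
Hypothesis hBF : forall s t, s \in I -> t \in I -> s <= t -> BF (v s t).
Hypothesis hcomp : forall s t u, s \in I -> t \in I -> u \in I -> s <= t -> t <= u ->
  forall z, right_half_plane z -> v s u z = v s t (v t u z).
Hypothesis h_i : forall t, t \in I -> bdry_deriv 0 (v 0 t) = 0%E.
Hypothesis h_ii : forall t, t \in I ->
  bdry_deriv 1 (v 0 t) \is a fin_num /\ bdry_deriv 2 (v 0 t) \is a fin_num.

Let A t := fine (bdry_deriv 1 (v 0 t)).
Let B t := fine (bdry_deriv 2 (v 0 t)).

Hypothesis A_ac : AC_loc I A.
Hypothesis B_ac : AC_loc I B.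

Let I0 : 0 \in I. Proof. exact: time_interval0. Qed.
Let I_ge0 t : t \in I -> 0 <= t. Proof. exact: time_interval_ge0. Qed.

Lemma family_derive_gt0 t : t \in I -> 0 < A t.
Proof.
move=> tI; have [A1 _] := h_ii tI.
by apply: bdry1_gt0 => //; [exact: hBF (I_ge0 tI)|exact: h_i].
Qed.

Lemma family_lip s t z z' : s \in I -> t \in I -> s <= t ->
  right_half_plane z -> right_half_plane z' ->
  cabs (v s t z - v s t z') <= A t / A s * cabs (z - z').
Proof.
move=> sI tI st; have [? ?] := h_ii sI; have [? ?] := h_ii tI.
by apply: (@transition_lip R (v 0 s) (v s t) (v 0 t)); rewrite ?h_i //;
  try (by apply: hBF; rewrite ?I_ge0); apply: hcomp; rewrite ?I_ge0.
Qed.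

Lemma family_deviation t u z : t \in I -> u \in I -> t <= u -> right_half_plane z ->
  cabs (v t u z - (A u / A t)%:C * z) <=
    2 * (- ((B u - B t * (A u / A t) ^+ 2) / A t) * cabs z ^+ 2).
Proof.
move=> sI tI st; have [? ?] := h_ii sI; have [? ?] := h_ii tI.
by apply: (@transition_deviation R (v 0 t) (v t u) (v 0 u)); rewrite ?h_i //;
  try (by apply: hBF; rewrite ?I_ge0); apply: hcomp; rewrite ?I_ge0.
Qed.

(** [M / m] bounds the Lipschitz constant of [v s t], and [increment_const] handles [v t u z - z].
    [K] depends on [c] and [z] but not on [s], as a common density for all [s] requires. *)
Lemma increment_bound c z : c \in I -> right_half_plane z -> exists2 K, 0 <= K &
  forall s t u, 0 <= s -> s <= t -> t <= u -> u <= c ->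
  cabs (v s u z - v s t z) <= K * (`|A u - A t| + `|B u - B t|).
Proof.
move=> cI zH; have c0 := I_ge0 cI.
have [m [M [[t0 t0c Am] HA]]] := abs_cont_EVT c0 (A_ac I0 cI c0).
have [mB [MB [_ HB]]] := abs_cont_EVT c0 (B_ac I0 cI c0).
have inI t : 0 <= t -> t <= c -> t \in I by exact: time_interval_le.
have m0 : 0 < m by rewrite -Am family_derive_gt0 //; case/andP: t0c => *; exact: inI.
have mM : m <= M by have /andP[] := HA t0 t0c; exact: le_trans.
pose N := `|mB| + `|MB|.
have BN t : 0 <= t <= c -> `|B t| <= N.
  move=> /HB /andP[b1 b2]; rewrite /N ler_norml; apply/andP; split.
    by have := normr_ge0 MB; have := ler_norm (- mB); rewrite normrN; lra.
  by have := normr_ge0 mB; have := ler_norm MB; lra.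
have N0 : 0 <= N by rewrite addr_ge0.
pose r := cabs z; have r0 : 0 <= r by exact: cabs_ge0.
have M0 : 0 <= M by exact: le_trans (ltW m0) mM.
have K0 := increment_const_ge0 m0 M0 N0 r0.
have Mm0 : 0 <= M / m by exact: divr_ge0 M0 (ltW m0).
exists (M / m * increment_const m M N r); first exact: mulr_ge0 Mm0 K0.
move=> s t u s0 st tu uc.
have t0' := le_trans s0 st; have u0 := le_trans t0' tu.
have tc := le_trans tu uc; have sc := le_trans st tc.
have sI := inI s s0 sc; have tI := inI t t0' tc; have uI := inI u u0 uc.
have bnds x : 0 <= x -> x <= c -> m <= A x <= M by move=> x0 xc; apply: HA; rewrite x0.
have /andP[s1 s2] := bnds s s0 sc; have /andP[t1 t2] := bnds t t0' tc.
have /andP[u1 u2] := bnds u u0 uc.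
rewrite (hcomp sI tI uI st tu zH).
have vzH : right_half_plane (v t u z) by apply: BF_Re_gt0 => //; exact: hBF.
apply: le_trans (family_lip sI tI st vzH zH) _.
rewrite -[X in _ <= X]mulrA; apply: ler_pM.
- exact: divr_ge0 (ltW (family_derive_gt0 tI)) (ltW (family_derive_gt0 sI)).
- exact: cabs_ge0.
- exact: ratio_le m0 s1 (ltW (family_derive_gt0 tI)) t2.
have -> : v t u z - z = (v t u z - (A u / A t)%:C * z) + (A u / A t - 1)%:C * z.
  by rewrite rmorphB rmorph1; ring.
apply: le_trans (cabsD _ _) _; rewrite [X in _ + X]cabsM cabs_real -/r.
have tc' : 0 <= t <= c by rewrite t0'.
apply: le_trans (coef_increment_bound (B u) m0 t1 t2 u1 u2 N0 (BN t tc') r0).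
by rewrite lerD2r; exact: family_deviation tI uI tu zH.
Qed.

Lemma family_REF3 z : right_half_plane z -> exists f : R -> R,
  [/\ forall r, r \in I -> 0 <= f r, L1_loc I f &
    forall s t u, s \in I -> t \in I -> u \in I -> s <= t -> t <= u ->
      cabs (v s u z - v s t z) <= \int[lebesgue_measure]_(r in `[t, u]) f r].
Proof.
move=> zH; apply: (glue_local_bounds (D := fun s t u => cabs (v s u z - v s t z)) hI).
  move=> s t m u _ _ _ _ _ _ _.
  have -> : v s u z - v s t z = (v s m z - v s t z) + (v s u z - v s m z) by ring.
  exact: cabsD.
move=> c cI; have c0 := I_ge0 cI.
have [K K0 HK] := increment_bound cI zH.
have [fA [fA0 fAi HA]] := abs_cont_density c0 (A_ac I0 cI c0).
have [fB [fB0 fBi HB]] := abs_cont_density c0 (B_ac I0 cI c0).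
have fABi : (@lebesgue_measure R).-integrable setT (EFin \o (fun x => fA x + fB x)).
  by apply: (integrableD measurableT fAi fBi).
exists (fun x => K * (fA x + fB x)); split.
- by move=> x; rewrite mulr_ge0 // addr_ge0.
- by apply: (integrableZl measurableT _ fABi).
- move=> s t u s0 st tu uc; apply: le_trans (HK s t u s0 st tu uc) _.
  rewrite RintegralZl //; last by apply: integrableS fABi.
  rewrite RintegralD //; [|by apply: integrableS fAi|by apply: integrableS fBi].
  rewrite (ler_wpM2l K0) //; apply: lerD.
    by apply: HA => //; exact: le_trans st.
  by apply: HB => //; exact: le_trans st.
Qed.

End Main.

Theorem corollary3p17 (R : realType) (I : interval R)
    (v : R -> R -> R[i] -> R[i])
    (hI : time_interval I)
    (hBF : forall s t, s \in I -> t \in I -> s <= t -> BF (v s t))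
    (hid : forall s, s \in I ->
       forall z, right_half_plane z -> v s s z = z)
    (hcomp : forall s t u, s \in I -> t \in I -> u \in I -> s <= t -> t <= u ->
       forall z, right_half_plane z -> v s u z = v s t (v t u z))
    (h_i : forall t, t \in I -> bdry_deriv 0 (v 0 t) = 0%E)
    (h_ii : forall t, t \in I ->
       bdry_deriv 1 (v 0 t) \is a fin_num /\ bdry_deriv 2 (v 0 t) \is a fin_num)
    (h_iii : AC_loc I (fun t => fine (bdry_deriv 1 (v 0 t))) /\
             AC_loc I (fun t => fine (bdry_deriv 2 (v 0 t)))) :
  ac_reverse_evolution_family I v.
Proof.
have [A_ac B_ac] := h_iii.
split=> //.
- move=> s t sI tI st; have hv := hBF s t sI tI st.
  split; first by case: hv => [[]].
  by move=> z; exact: BF_Re_gt0.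
- move=> z zH; have [f [f0 fL fE]] := family_REF3 hI hBF hcomp h_i h_ii A_ac B_ac zH.
  exists f; split => // s t u sI tI uI st tu.
  by rewrite cabsE lecR; exact: fE.
Qed.
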